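(* Let $(F,s)$ be a primitive, recognisable, self-correcting mixed substitution system on a finite alphabet $\mathcal{A}$. Let $K_F$ be the universal Barge–Diamond complex for $F$ and for each $i\ge 0$ let $g_{\phi_{s_i}}\colon K_F\to K_F$ be the cellular map induced by $\phi_{s_i}$. Then there is an isomorphism $$\check{H}^1(\Omega_{F,s})\cong\varinjlim(H^1(K_F),g_{\phi_{s_i}}^* ).$$
   Context: Let $\mathcal{A}$ be a finite alphabet, $\mathcal{A}^*=\bigcup_{n\ge 1}\mathcal{A}^n$. A substitution is a map $\phi\colon\mathcal{A}\to\mathcal{A}^*$, extended to words and to bi-infinite sequences by concatenation: $\phi(\dots a_{-1}\cdot a_0a_1\dots)=\dots\phi(a_{-1})\cdot\phi(a_0)\phi(a_1)\dots$, the dot marking the boundary between positions $-1$ and $0$. Its matrix $M_\phi$ has $(i,j)$ entry the number of occurrences of the $i$th letter in the image under $\phi$ of the $j$th letter. A mixed substitution system is a pair $(F,s)$ with $F=\{\phi_0,\dots,\phi_k\}$ a finite set of substitutions on $\mathcal{A}$ and $s=(s_0,s_1,\dots)\in\{0,\dots,k\}^{\mathbb{N}}$; $\sigma$ denotes the left shift, on $s$ and on $\mathcal{A}^{\mathbb{Z}}$. Write $\phi_{s[m,n]}=\phi_{s_m}\circ\cdots\circ\phi_{s_n}$, with matrix $M_{s[m,n]}$. The system is (weakly) primitive if for every $n\ge 0$ there is $k\ge 1$ such that $M_{s[n,n+k]}$ has strictly positive entries. A bi-infinite sequence is admitted by $(F,s)$ if each of its finite subwords is a subword of $\phi_{s[0,n]}(a)$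 for some $n\ge 0$, $a\in\mathcal{A}$. $\Sigma_{F,s}\subset\mathcal{A}^{\mathbb{Z}}$ is the space of admitted sequences, and $\mathcal{L}^2_{F,s}$ is the set of two-letter words occurring in elements of $\Sigma_{F,s}$. The tiling space is $\Omega_{F,s}=(\Sigma_{F,s}\times[0,1])/{\sim}$ with $(\mathcal{T},1)\sim(\sigma(\mathcal{T}),0)$. The continuous map $\phi_{s_i}\colon\Omega_{F,\sigma^{i+1}(s)}\to\Omega_{F,\sigma^i(s)}$ sends $(\mathcal{T},t)$, with $t\in[0,1)$ and $\mathcal{T}=\dots a_{-1}\cdot a_0a_1\dots$, to $(\sigma^{\lfloor\tilde t\rfloor}(\phi_{s_i}(\mathcal{T})),\tilde t-\lfloor\tilde t\rfloor)$, where $\tilde t=|\phi_{s_i}(a_0)|\,t$. The system is recognisable if all these maps, $i\ge 0$, are injective. For a word $w$ let $l(w)$, $r(w)$ be its leftmost and rightmost letters. $(F,s)$ is self-correcting if for every $i\ge 0$ there is $N\ge 1$ such that for all $ab\in\mathcal{A}^2$ the two-letter word $r(\phi_{s[i,i+N]}(a))\,l(\phi_{s[i,i+N]}(b))$ belongs to $\mathcal{L}^2_{F,\sigma^i(s)}$. Universal Barge–Diamond complex: let $\epsilon=\min_{a\in\mathcal{A},\phi\in F}\frac{1}{2|\phi(a)|}$, $e_a=[\epsilon,1-\epsilon]\times\{a\}$ for $a\in\mathcal{A}$, and $e_{ab}=[-\epsilon,\epsilon]\times\{ab\}$ for $ab\in\mathcal{A}^2$. Then $K_F=\left(\bigcup_{a\in\mathcal{A}}e_a\cup\bigcup_{ab\in\mathcal{A}^2}e_{ab}\right)/{\sim}$,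 where $(1-\epsilon,a)\sim(-\epsilon,ab)\sim(-\epsilon,ac)$ and $(\epsilon,a)\sim(\epsilon,ba)\sim(\epsilon,ca)$ for all $a,b,c\in\mathcal{A}$. For $\phi\in F$, $g_\phi\colon K_F\to K_F$: if $\phi(a)=a_1a_2\cdots a_k$, then $g_\phi$ maps $e_a$ onto the edge path $e_{a_1}\cup e_{a_1a_2}\cup\cdots\cup e_{a_{k-1}a_k}\cup e_{a_k}$ in an orientation-preserving and uniformly expanding way. On $e_{ab}$ it is the orientation-preserving identification with $e_{cd}$, where $c=r(\phi(a))$ and $d=l(\phi(b))$. Cohomology has integer coefficients. *)

(* Defs.v *)
From HB Require Import structures.
From Stdlib Require Import Relation_Operators.
From mathcomp Require Import all_boot all_order all_algebra.
From mathcomp Require Import generic_quotient ring_quotient.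
From mathcomp Require Import ring lra zify.
From mathcomp Require Import all_classical all_reals all_analysis.

Set Implicit Arguments.
Unset Strict Implicit.
Unset Printing Implicit Defensive.

Import Order.TTheory GRing.Theory Num.Theory.
Import numFieldNormedType.Exports.

Local Open Scope classical_set_scope.
Local Open Scope ring_scope.
Local Open Scope quotient_scope.

Definition elt T (A : set T) (x : T) (Ax : x \in A) : A :=
  exist (fun y => y \in A) x Ax.

Section GeneratedQuotient.
Variables (T : choiceType) (r : T -> T -> Prop).

Definition gen_eqv (x y : T) : bool := `[< clos_refl_sym_trans T r x y >].

Lemma gen_eqv_refl : reflexive gen_eqv.
Proof. by move=> x; apply/asboolP; exact: rst_refl. Qed.

Lemma gen_eqv_sym : symmetric gen_eqv.
Proof. by move=> x y; apply/asboolP/asboolP; exact: rst_sym. Qed.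

Lemma gen_eqv_trans : transitive gen_eqv.
Proof.
move=> y x z /asboolP xy /asboolP yz; apply/asboolP.
exact: rst_trans xy yz.
Qed.

Canonical gen_eqv_rel := EquivRel gen_eqv gen_eqv_refl gen_eqv_sym gen_eqv_trans.

End GeneratedQuotient.

Record direct_system := DirectSystem {
  ds_index : choiceType;
  ds_le : ds_index -> ds_index -> Prop;
  ds_refl : forall i, ds_le i i;
  ds_trans : forall j i k, ds_le i j -> ds_le j k -> ds_le i k;
  ds_inhabited : ds_index;
  ds_directed : forall i j, exists k, ds_le i k /\ ds_le j k;
  ds_obj : ds_index -> zmodType;
  ds_map : forall i j, ds_le i j -> {additive ds_obj i -> ds_obj j};
  ds_map_id : forall i (h : ds_le i i) x, ds_map h x = x;
  ds_map_comp : forall i j k (hij : ds_le i j) (hjk : ds_le j k)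
    (hik : ds_le i k) x, ds_map hjk (ds_map hij x) = ds_map hik x
}.

Section DirectLimit.
Variable D : direct_system.
Notation I := (ds_index D).
Notation G := (@ds_obj D).
Notation le := (@ds_le D).

Definition dlim_pre := {i : I & G i}.
HB.instance Definition _ := Choice.on dlim_pre.

Definition dlim_eq (x y : dlim_pre) : Prop :=
  exists k (hx : le (tag x) k) (hy : le (tag y) k),
    ds_map hx (tagged x) = ds_map hy (tagged y).

Definition dlim_eqb (x y : dlim_pre) : bool := `[< dlim_eq x y >].

Lemma dlim_eqb_refl : reflexive dlim_eqb.
Proof.
move=> x; apply/asboolP; exists (tag x), (ds_refl _), (ds_refl _).
by [].
Qed.

Lemma dlim_eqb_sym : symmetric dlim_eqb.
Proof.
by move=> x y; apply/asboolP/asboolP => -[k [hx [hy e]]]; exists k, hy, hx.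
Qed.

Lemma dlim_eqb_trans : transitive dlim_eqb.
Proof.
move=> y x z /asboolP[k [hx [hy e]]] /asboolP[l [hy' [hz e']]].
apply/asboolP; have [m [hkm hlm]] := ds_directed k l.
exists m, (ds_trans hx hkm), (ds_trans hz hlm).
rewrite -(ds_map_comp hx hkm (ds_trans hx hkm)) e.
rewrite -(ds_map_comp hz hlm (ds_trans hz hlm)) -e'.
by rewrite (ds_map_comp hy hkm (ds_trans hy hkm)) (ds_map_comp hy' hlm (ds_trans hy hkm)).
Qed.

Canonical dlim_eqv := EquivRel dlim_eqb dlim_eqb_refl dlim_eqb_sym dlim_eqb_trans.

Definition dlim := {eq_quot dlim_eqv}.
HB.instance Definition _ := Choice.on dlim.
HB.instance Definition _ := Quotient.on dlim.

Definition dlim_in (i : I) (x : G i) : dlim := \pi_dlim (Tagged G x).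

Lemma dlim_inE i j (x : G i) (y : G j) :
  dlim_in x = dlim_in y <->
  exists k (hx : le i k) (hy : le j k), ds_map hx x = ds_map hy y.
Proof.
split=> [/eqmodP/asboolP//|h].
by apply/eqmodP/asboolP.
Qed.

Lemma dlim_in_map i j (h : le i j) (x : G i) : dlim_in (ds_map h x) = dlim_in x.
Proof.
by apply/dlim_inE; exists j, (ds_refl _), h; rewrite ds_map_id.
Qed.

Lemma dlim_elim (x : dlim) : exists i (y : G i), x = dlim_in y.
Proof.
exists (tag (repr x)), (tagged (repr x)); rewrite /dlim_in.
by case: (repr x) (reprK x).
Qed.

Definition dlim_ub (i j : I) : I := sval (cid (ds_directed i j)).
Lemma dlim_ubl i j : le i (dlim_ub i j).
Proof. by rewrite /dlim_ub; case: cid => ? []. Qed.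
Lemma dlim_ubr i j : le j (dlim_ub i j).
Proof. by rewrite /dlim_ub; case: cid => ? []. Qed.

Definition dlim_zero : dlim := @dlim_in (ds_inhabited D) 0.
Definition dlim_opp (x : dlim) : dlim := dlim_in (- tagged (repr x)).
Definition dlim_add (x y : dlim) : dlim :=
  dlim_in (ds_map (dlim_ubl (tag (repr x)) (tag (repr y))) (tagged (repr x))
         + ds_map (dlim_ubr (tag (repr x)) (tag (repr y))) (tagged (repr y))).

Lemma dlim_in0 i : @dlim_in i 0 = dlim_zero.
Proof.
apply/dlim_inE; exists (dlim_ub i (ds_inhabited D)), (dlim_ubl _ _).
by exists (dlim_ubr _ _); rewrite !raddf0.
Qed.

Lemma dlim_repr i (x : G i) : exists k (h : le (tag (repr (dlim_in x))) k)
  (h' : le i k), ds_map h (tagged (repr (dlim_in x))) = ds_map h' x.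
Proof.
apply/dlim_inE; rewrite -[RHS](reprK (dlim_in x)) /dlim_in.
by case: (repr _).
Qed.

Lemma dlim_inN i (x : G i) : dlim_opp (dlim_in x) = dlim_in (- x).
Proof.
have [k [h [h' e]]] := dlim_repr x.
by apply/dlim_inE; exists k, h, h'; rewrite !raddfN /= e.
Qed.

Lemma dlim_inD i (x y : G i) : dlim_add (dlim_in x) (dlim_in y) = dlim_in (x + y).
Proof.
have [k [h [h' e]]] := dlim_repr x; have [l [g [g' e']]] := dlim_repr y.
rewrite /dlim_add; set m := dlim_ub _ _; set a := dlim_ubl _ _.
set b := dlim_ubr _ _.
have [n [hkn hln]] := ds_directed k l; have [p [hnp hmp]] := ds_directed n m.
have hkp := ds_trans hkn hnp; have hlp := ds_trans hln hnp.
have hip : le i p := ds_trans h' hkp.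
apply/dlim_inE; exists p, hmp, hip; rewrite !raddfD /=; congr (_ + _).
- rewrite (ds_map_comp a hmp (ds_trans h hkp)) -(ds_map_comp h hkp) e.
  by rewrite (ds_map_comp h' hkp hip).
- rewrite (ds_map_comp b hmp (ds_trans g hlp)) -(ds_map_comp g hlp) e'.
  by rewrite (ds_map_comp g' hlp hip).
Qed.

Lemma dlim_elim2 (x y : dlim) :
  exists i (a b : G i), x = dlim_in a /\ y = dlim_in b.
Proof.
have [i [a ->]] := dlim_elim x; have [j [b ->]] := dlim_elim y.
exists (dlim_ub i j), (ds_map (dlim_ubl i j) a), (ds_map (dlim_ubr i j) b).
by rewrite !dlim_in_map.
Qed.

Lemma dlim_addC : commutative dlim_add.
Proof.
move=> x y; have [i [a [b [-> ->]]]] := dlim_elim2 x y.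
by rewrite !dlim_inD addrC.
Qed.

Lemma dlim_addA : associative dlim_add.
Proof.
move=> x y z; have [i [a [b [-> ->]]]] := dlim_elim2 x y.
have [j [c ->]] := dlim_elim z; pose u := dlim_ub i j.
rewrite -(dlim_in_map (dlim_ubl i j) a) -(dlim_in_map (dlim_ubl i j) b).
by rewrite -(dlim_in_map (dlim_ubr i j) c) !dlim_inD addrA.
Qed.

Lemma dlim_add0 : left_id dlim_zero dlim_add.
Proof.
by move=> x; have [i [a ->]] := dlim_elim x; rewrite -(dlim_in0 i) dlim_inD add0r.
Qed.

Lemma dlim_addN : left_inverse dlim_zero dlim_opp dlim_add.
Proof.
move=> x; have [i [a ->]] := dlim_elim x.
by rewrite dlim_inN dlim_inD addNr dlim_in0.
Qed.

HB.instance Definition _ :=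
  GRing.isZmodule.Build dlim dlim_addA dlim_addC dlim_add0 dlim_addN.

End DirectLimit.

(* The system G --h 0--> G --h 1--> G --h 2--> ... *)
Section SequentialSystem.
Variables (G : zmodType) (h : nat -> {additive G -> G}).

Definition seq_map (i j : nat) (x : G) : G :=
  foldl (fun y n => h n y) x (index_iota i j).

Lemma seq_map_is_additive i j : zmod_morphism (seq_map i j).
Proof.
move=> x y; rewrite /seq_map; elim: (index_iota i j) x y => [|n s IH] x y //=.
by rewrite raddfB IH.
Qed.

HB.instance Definition _ i j :=
  GRing.isZmodMorphism.Build G G (seq_map i j) (seq_map_is_additive i j).

Lemma seq_map_id i (_ : (i <= i)%N) x : seq_map i i x = x.
Proof. by rewrite /seq_map /index_iota subnn. Qed.

Lemma seq_map_comp i j k (hij : (i <= j)%N) (hjk : (j <= k)%N)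
  (_ : (i <= k)%N) x : seq_map j k (seq_map i j x) = seq_map i k x.
Proof.
rewrite /seq_map -foldl_cat /index_iota -{2}(subnKC hij) -iotaD.
by congr (foldl _ _ (iota _ _)); rewrite addnC addnBA// subnK.
Qed.

Lemma seq_directed (i j : nat) : exists k, (i <= k)%N /\ (j <= k)%N.
Proof. by exists (maxn i j); rewrite leq_maxl leq_maxr. Qed.

Definition sequential_system : direct_system :=
  @DirectSystem nat (fun i j => (i <= j)%N) leqnn
    (fun j i k => @leq_trans j i k) 0%N seq_directed (fun=> G)
    (fun i j _ => seq_map i j) seq_map_id seq_map_comp.

End SequentialSystem.

(* Only the faces are recorded: the simplicial identities, which hold for the
   nerve of a cover and for singular simplices, play no role in the definition
   of Z^1 and of its subgroup of coboundaries. *)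
Record semisimplicial := SemiSimplicial {
  simp : nat -> Type;
  face : forall n, 'I_n.+2 -> simp n.+1 -> simp n
}.

Section Cohomology.
Variable S : semisimplicial.

Definition coboundary_map n (c : simp S n -> int) : simp S n.+1 -> int :=
  fun x => \sum_(i < n.+2) (-1) ^+ i * c (face i x).

Lemma coboundary_map_is_additive n : zmod_morphism (@coboundary_map n).
Proof.
move=> c d; apply/funext => x.
rewrite -[RHS]/(coboundary_map c x - coboundary_map d x) -sumrB.
by apply: eq_bigr => i _; rewrite -mulrBr.
Qed.

HB.instance Definition _ n := GRing.isZmodMorphism.Build _ _
  (@coboundary_map n) (@coboundary_map_is_additive n).

Definition is_cocycle : pred (simp S 1 -> int) :=
  fun c => coboundary_map c == 0.

Lemma is_cocycle_closed : zmod_closed is_cocycle.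
Proof.
split=> [|c d]; rewrite !unfold_in ?raddf0// => /eqP c0 /eqP d0.
by rewrite raddfB /= c0 d0 subr0.
Qed.

HB.instance Definition _ :=
  GRing.isZmodClosed.Build (simp S 1 -> int) is_cocycle is_cocycle_closed.

Record cocycle := Cocycle {
  cocycle_val :> simp S 1 -> int;
  _ : cocycle_val \in is_cocycle
}.

HB.instance Definition _ := [isSub for cocycle_val].
HB.instance Definition _ := [Choice of cocycle by <:].
HB.instance Definition _ := [SubChoice_isSubZmodule of cocycle by <:].

Definition is_coboundary : pred cocycle :=
  fun z => `[< exists f : simp S 0 -> int, val z = coboundary_map f >].

Lemma is_coboundary_closed : zmod_closed is_coboundary.
Proof.
split=> [|z w]; rewrite !unfold_in.
  by apply/asboolP; exists 0; rewrite !raddf0.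
move=> /asboolP[f zf] /asboolP[g wg]; apply/asboolP.
by exists (f - g); rewrite raddfB /= zf wg raddfB.
Qed.

HB.instance Definition _ :=
  GRing.isZmodClosed.Build cocycle is_coboundary is_coboundary_closed.

Definition coboundaries : zmodClosed cocycle :=
  GRing.ZmodClosed.clone cocycle is_coboundary _.

Definition H1 := Quotient.quot coboundaries.
HB.instance Definition _ := GRing.Zmodule.on H1.
HB.instance Definition _ := Quotient.on H1.

Definition H1_class (z : cocycle) : H1 := \pi_H1 z.

Lemma H1_classE (z w : cocycle) : H1_class z = H1_class w <->
  exists f, val z - val w = coboundary_map f.
Proof.
split=> [/eqP|[f e]].
  rewrite -Quotient.idealrBE => /asboolP[f e].
  by exists f; rewrite -e raddfB.
apply/eqP; rewrite -Quotient.idealrBE; apply/asboolP.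
by exists f; rewrite -e raddfB.
Qed.

Lemma H1_reprK (x : H1) : H1_class (repr x) = x.
Proof. exact: reprK. Qed.

Lemma H1_classB (z w : cocycle) : H1_class (z - w) = H1_class z - H1_class w.
Proof. exact: raddfB. Qed.

End Cohomology.

Record ss_map (S T : semisimplicial) := SSMap {
  ss_fun :> forall n, simp S n -> simp T n;
  ss_face : forall n (i : 'I_n.+2) x, ss_fun (face i x) = face i (ss_fun x)
}.
Arguments ss_fun {S T} _ n.

Section Pullback.
Variables (S T : semisimplicial) (f : ss_map S T).

Lemma pull_cocycle_subproof (z : cocycle T) :
  (fun x => z (f 1%N x)) \in @is_cocycle S.
Proof.
case: z => z /= /eqP z0; apply/eqP/funext => x.
transitivity (coboundary_map z (f 2%N x)); last by rewrite z0.
by apply: eq_bigr => i _; rewrite ss_face.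
Qed.

Definition pull_cocycle (z : cocycle T) : cocycle S :=
  Cocycle (pull_cocycle_subproof z).

Definition H1_map (x : H1 T) : H1 S := H1_class (pull_cocycle (repr x)).

Lemma H1_mapE (z : cocycle T) : H1_map (H1_class z) = H1_class (pull_cocycle z).
Proof.
have /H1_classE[g e] := H1_reprK (H1_class z).
apply/H1_classE; exists (fun x => g (f 0%N x)); apply/funext => x.
rewrite -[LHS]/((val (repr (H1_class z)) - val z) (f 1%N x)) e.
by apply: eq_bigr => i _; rewrite ss_face.
Qed.

Lemma H1_map_is_additive : zmod_morphism H1_map.
Proof.
move=> x y; rewrite -(H1_reprK x) -(H1_reprK y) -H1_classB !H1_mapE -H1_classB.
by congr H1_class; apply: val_inj.
Qed.

HB.instance Definition _ :=
  GRing.isZmodMorphism.Build (H1 T) (H1 S) H1_map H1_map_is_additive.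

End Pullback.

Record open_cover (X : topologicalType) := OpenCover {
  cover_sets :> set X -> Prop;
  cover_open : forall U, cover_sets U -> open U;
  cover_full : \bigcup_(U in cover_sets) U = [set: X]
}.

HB.instance Definition _ (X : topologicalType) := gen_eqMixin (open_cover X).
HB.instance Definition _ (X : topologicalType) := gen_choiceMixin (open_cover X).

Section Nerve.
Variable X : topologicalType.
Implicit Types U V W : open_cover X.

(* Ordered simplices of the nerve, repetitions allowed: they give the same
   cohomology as the oriented ones. *)
Definition nerve_simplex U n : set ('I_n.+1 -> set X) :=
  [set t | (forall i, U (t i)) /\ \bigcap_i t i !=set0].
Arguments nerve_simplex U n _ : clear implicits.

Lemma nerve_face_subproof U n (i : 'I_n.+2) (t : nerve_simplex U n.+1) :
  (val t \o lift i) \in nerve_simplex U n.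
Proof.
case: t => t /= /set_mem[Ut [x tx]]; apply/mem_set; split=> [j|]; first exact: Ut.
by exists x => j _; exact: tx.
Qed.

Definition nerve_face U n (i : 'I_n.+2) (t : nerve_simplex U n.+1) :
  nerve_simplex U n := elt (nerve_face_subproof i t).

Definition nerve U : semisimplicial :=
  @SemiSimplicial (fun n => nerve_simplex U n) (@nerve_face U).

(* [cover_le U V]: the cover [V] refines [U]. *)
Definition cover_le U V : Prop :=
  forall B, V B -> exists2 A, U A & B `<=` A.

Definition refining U V (p : set X -> set X) : Prop :=
  forall B, V B -> U (p B) /\ B `<=` p B.

Lemma refining_exists U V : cover_le U V -> exists p, refining U V p.
Proof.
move=> h; have /choice[p hp] : forall B, exists A, V B -> U A /\ B `<=` A.
  move=> B; have [vB|nvB] := pselect (V B); last by exists B.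
  by have [A] := h B vB; exists A.
by exists p.
Qed.

Lemma nerve_map_subproof U V p (hp : refining U V p) n (t : nerve_simplex V n) :
  (p \o val t) \in nerve_simplex U n.
Proof.
case: t => t /= /set_mem[Vt [x tx]]; apply/mem_set; split=> [j|].
  by have [] := hp _ (Vt j).
by exists x => j _; have [_] := hp _ (Vt j); apply; exact: tx.
Qed.

Definition nerve_map_fun U V p (hp : refining U V p) n (t : nerve_simplex V n) :
  nerve_simplex U n := elt (nerve_map_subproof hp t).

Lemma nerve_map_face U V p (hp : refining U V p) n (i : 'I_n.+2)
    (t : nerve_simplex V n.+1) :
  nerve_map_fun hp (nerve_face i t) = nerve_face i (nerve_map_fun hp t).
Proof. exact: val_inj. Qed.

Definition nerve_map U V p (hp : refining U V p) : ss_map (nerve V) (nerve U) :=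
  @SSMap (nerve V) (nerve U) (@nerve_map_fun U V p hp)
    (@nerve_map_face U V p hp).

Lemma pair_subproof U (A B : set X) : U A -> U B -> A `&` B !=set0 ->
  (fun i : 'I_2 => nth set0 [:: A; B] i) \in nerve_simplex U 1.
Proof.
move=> UA UB [x [Ax Bx]]; apply/mem_set; split=> [[[|[|//]]]//|].
by exists x => -[[|[|//]]].
Qed.

Lemma triple_subproof U (A B C : set X) : U A -> U B -> U C ->
  A `&` B `&` C !=set0 ->
  (fun i : 'I_3 => nth set0 [:: A; B; C] i) \in nerve_simplex U 2.
Proof.
move=> UA UB UC [x [[Ax Bx] Cx]]; apply/mem_set; split=> [[[|[|[|//]]]]//|].
by exists x => -[[|[|[|//]]]].
Qed.

Lemma nerve_cocycle U (z : cocycle (nerve U)) (A B C : set X)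
    (a : (fun i : 'I_2 => nth set0 [:: A; B] i) \in nerve_simplex U 1)
    (b : (fun i : 'I_2 => nth set0 [:: B; C] i) \in nerve_simplex U 1)
    (c : (fun i : 'I_2 => nth set0 [:: A; C] i) \in nerve_simplex U 1) :
  A `&` B `&` C !=set0 ->
  val z (elt c) = val z (elt a) + val z (elt b).
Proof.
move=> ABC; have UA : U A by have /set_mem[/(_ ord0)] := a.
have UB : U B by have /set_mem[/(_ ord0)] := b.
have UC : U C by have /set_mem[/(_ ord_max)] := b.
case: z => z /= /eqP/(congr1 (fun f => f (elt (triple_subproof UA UB UC ABC)))).
rewrite /coboundary_map !big_ord_recr big_ord0 /= add0r.
set x := nerve_face _ _; set y := nerve_face _ _; set w := nerve_face _ _.
have -> : x = elt b.
  by apply/val_inj/funext => -[[|[|//]] ?].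
have -> : y = elt c.
  by apply/val_inj/funext => -[[|[|//]] ?].
have -> : w = elt a.
  by apply/val_inj/funext => -[[|[|//]] ?].
rewrite expr0 mul1r expr1 mulN1r expr2 mulrNN !mul1r => /eqP.
rewrite -addrA addrCA addrC subr_eq0 => /eqP <-.
by rewrite addrC.
Qed.

Lemma refining_cohomologous U V p q (hp : refining U V p) (hq : refining U V q)
    (z : cocycle (nerve U)) :
  H1_class (pull_cocycle (nerve_map hp) z) =
  H1_class (pull_cocycle (nerve_map hq) z).
Proof.
have sub0 (t : nerve_simplex V 0) :
    (fun i : 'I_2 => nth set0 [:: q (val t ord0); p (val t ord0)] i)
      \in nerve_simplex U 1.
  case: t => t /= /set_mem[Vt [x tx]].
  have [Up sp] := hp _ (Vt ord0); have [Uq sq] := hq _ (Vt ord0).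
  by apply: pair_subproof => //; exists x; split; [apply: sq|apply: sp]; exact: tx.
apply/H1_classE; exists (fun t => val z (elt (sub0 t))).
apply/funext => t; rewrite /coboundary_map !big_ord_recr big_ord0 /= add0r.
rewrite expr0 mul1r expr1 mulN1r.
rewrite -[LHS]/(val z (nerve_map hp 1%N t) - val z (nerve_map hq 1%N t)).
set h0 := sub0 _; set h1 := sub0 _.
have tV : forall i, V (val t i) by case: t {h0 h1} => t /= /set_mem[].
have [x tx] : \bigcap_i val t i !=set0 by case: t {h0 h1 tV} => t /= /set_mem[].
pose A := val t ord0; pose B := val t ord_max.
have [[UpA spA] [UqA sqA]] := (hp _ (tV ord0), hq _ (tV ord0)).
have [[UpB spB] [UqB sqB]] := (hp _ (tV ord_max), hq _ (tV ord_max)).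
have [xA xB] : A x /\ B x by split; exact: tx.
have pp : (fun i : 'I_2 => nth set0 [:: p A; p B] i) \in nerve_simplex U 1.
  by apply: pair_subproof => //; exists x; split; [exact: spA|exact: spB].
have qq : (fun i : 'I_2 => nth set0 [:: q A; q B] i) \in nerve_simplex U 1.
  by apply: pair_subproof => //; exists x; split; [exact: sqA|exact: sqB].
have qp : (fun i : 'I_2 => nth set0 [:: q A; p B] i) \in nerve_simplex U 1.
  by apply: pair_subproof => //; exists x; split; [exact: sqA|exact: spB].
have pA : (fun i : 'I_2 => nth set0 [:: q A; p A] i) \in nerve_simplex U 1.
  by apply: pair_subproof => //; exists x; split; [exact: sqA|exact: spA].
have pB : (fun i : 'I_2 => nth set0 [:: q B; p B] i) \in nerve_simplex U 1.
  by apply: pair_subproof => //; exists x; split; [exact: sqB|exact: spB].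
have -> : nerve_map hp 1%N t = elt pp.
  by apply/val_inj/funext => -[[|[|//]] ?]; rewrite /=;
    congr (p (val t _)); exact: val_inj.
have -> : nerve_map hq 1%N t = elt qq.
  by apply/val_inj/funext => -[[|[|//]] ?]; rewrite /=;
    congr (q (val t _)); exact: val_inj.
have -> : elt h0 = elt pB :> nerve_simplex U 1.
  apply/val_inj/funext => i /=.
  by rewrite (_ : @lift 2 _ (@ord0 0) = ord_max)//; exact: val_inj.
have -> : elt h1 = elt pA :> nerve_simplex U 1.
  apply/val_inj/funext => i /=.
  by rewrite (_ : @lift 2 _ (@ord0 0) = ord0)//; exact: val_inj.
have e1 : val z (elt qp) = val z (elt pA) + val z (elt pp).
  apply: nerve_cocycle; exists x.
  by split; [split; [exact: sqA|exact: spA]|exact: spB].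
have e2 : val z (elt qp) = val z (elt qq) + val z (elt pB).
  apply: nerve_cocycle; exists x.
  by split; [split; [exact: sqA|exact: sqB]|exact: spB].
apply/eqP; rewrite subr_eq addrAC eq_sym subr_eq eq_sym.
by rewrite [X in X == _]addrC -e1 e2 addrC.
Qed.

Definition refining_map U V (h : cover_le U V) : H1 (nerve U) -> H1 (nerve V) :=
  H1_map (nerve_map (svalP (cid (refining_exists h)))).

HB.instance Definition _ U V (h : cover_le U V) :=
  GRing.Additive.on (refining_map h).

Lemma refining_mapE U V (h : cover_le U V) p (hp : refining U V p)
    (z : cocycle (nerve U)) :
  refining_map h (H1_class z) = H1_class (pull_cocycle (nerve_map hp) z).
Proof. by rewrite /refining_map H1_mapE; exact: refining_cohomologous. Qed.

Lemma cover_le_refl U : cover_le U U.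
Proof. by move=> A UA; exists A. Qed.

Lemma cover_le_trans V U W : cover_le U V -> cover_le V W -> cover_le U W.
Proof.
move=> UV VW C /VW[B /UV[A UA BA] CB]; exists A => //.
exact: subset_trans CB BA.
Qed.

Lemma refining_map_id U (h : cover_le U U) x : refining_map h x = x.
Proof.
have hid : refining U U id by move=> A UA; split.
rewrite -(H1_reprK x) (refining_mapE h hid); congr H1_class.
apply/val_inj/funext => t /=; congr (cocycle_val _ _).
exact: val_inj.
Qed.

Lemma refining_map_comp U V W (hUV : cover_le U V) (hVW : cover_le V W)
    (hUW : cover_le U W) x :
  refining_map hVW (refining_map hUV x) = refining_map hUW x.
Proof.
have [p hp] := refining_exists hUV; have [q hq] := refining_exists hVW.
have hpq : refining U W (p \o q).
  move=> C /hq[Vq Cq]; have [Up qp] := hp _ Vq; split=> //=.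
  exact: subset_trans Cq qp.
rewrite -(H1_reprK x) (refining_mapE hUV hp) (refining_mapE hVW hq).
rewrite (refining_mapE hUW hpq); congr H1_class.
apply/val_inj/funext => t /=; congr (cocycle_val _ _).
exact: val_inj.
Qed.

Lemma trivial_cover_open (A : set X) : [set [set: X]] A -> open A.
Proof. by move=> ->; exact: openT. Qed.

Lemma trivial_cover_full : \bigcup_(A in [set [set: X]]) A = [set: X].
Proof. by rewrite bigcup_set1. Qed.

Definition trivial_cover : open_cover X :=
  OpenCover trivial_cover_open trivial_cover_full.

Lemma meet_cover_open U V (C : set X) :
  [set A `&` B | A in cover_sets U & B in cover_sets V] C -> open C.
Proof.
by move=> [A UA [B VB <-]]; apply: openI; [exact: cover_open UA|exact: cover_open VB].
Qed.

Lemma meet_cover_full U V :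
  \bigcup_(C in [set A `&` B | A in cover_sets U & B in cover_sets V]) C
  = [set: X].
Proof.
apply/seteqP; split=> // x _.
have [A UA Ax] : (\bigcup_(A in cover_sets U) A) x by rewrite cover_full.
have [B VB Bx] : (\bigcup_(B in cover_sets V) B) x by rewrite cover_full.
by exists (A `&` B) => //; exists A => //; exists B.
Qed.

Definition meet_cover U V : open_cover X :=
  OpenCover (@meet_cover_open U V) (@meet_cover_full U V).

Lemma cover_directed U V : exists W, cover_le U W /\ cover_le V W.
Proof.
exists (meet_cover U V); split=> _ [A UA [B VB <-]].
  by exists A.
by exists B.
Qed.

Definition cech_system : direct_system :=
  @DirectSystem (open_cover X) cover_le cover_le_refl cover_le_trans
    trivial_cover cover_directed (fun U => H1 (nerve U)) refining_map
    refining_map_id refining_map_comp.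

End Nerve.

Definition cech_H1 (X : topologicalType) := dlim (cech_system X).
HB.instance Definition _ (X : topologicalType) := GRing.Zmodule.on (cech_H1 X).

Section Singular.
Variable R : realType.

Definition std_simplex n : set 'rV[R]_n.+1 :=
  [set t | (forall i, 0 <= t 0 i) /\ \sum_i t 0 i = 1].
Arguments std_simplex n _ : clear implicits.

Definition face_incl_fun n (i : 'I_n.+2) (t : 'rV[R]_n.+1) : 'rV[R]_n.+2 :=
  \row_j (if unlift i j is Some k then t 0 k else 0).

Lemma face_incl_subproof n (i : 'I_n.+2) (t : std_simplex n) :
  face_incl_fun i (val t) \in std_simplex n.+1.
Proof.
case: t => t /= /set_mem[t0 t1]; apply/mem_set; split=> [j|].
  by rewrite mxE; case: unliftP.
rewrite (bigD1_ord i)//= mxE unlift_none add0r -[RHS]t1.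
by apply: eq_bigr => j _; rewrite mxE liftK.
Qed.

Definition face_incl n (i : 'I_n.+2) (t : std_simplex n) : std_simplex n.+1 :=
  elt (face_incl_subproof i t).

Lemma face_incl_fun_continuous n (i : 'I_n.+2) : continuous (@face_incl_fun n i).
Proof.
move=> u A /nbhs_ballP[e /= e0 eA].
apply/nbhs_ballP; exists e => //= v [_ uv]; apply: eA; split => // k j.
by rewrite !mxE; case: unliftP => [j'|] _; [exact: uv|exact: ballxx].
Qed.

Lemma face_incl_continuous n (i : 'I_n.+2) : continuous (@face_incl n i).
Proof.
apply: continuous_comp_initial => t.
apply: (@continuous_comp (std_simplex n) _ _ set_val (@face_incl_fun n i)).
  exact: initial_continuous.
exact: face_incl_fun_continuous.
Qed.

HB.instance Definition _ n (i : 'I_n.+2) :=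
  @isContinuous.Build _ _ (@face_incl n i) (@face_incl_continuous n i).

Definition singular (X : topologicalType) : semisimplicial :=
  @SemiSimplicial (fun n => continuousType (std_simplex n) X)
    (fun n i s => s \o @face_incl n i).

Lemma singular_map_face (X Y : topologicalType) (f : continuousType X Y) n
    (i : 'I_n.+2) (s : simp (singular X) n.+1) :
  f \o face i s = face i (f \o s : simp (singular Y) n.+1)
    :> simp (singular Y) n.
Proof. exact/continuousEP. Qed.

Definition singular_map (X Y : topologicalType) (f : continuousType X Y) :
  ss_map (singular X) (singular Y) :=
  @SSMap (singular X) (singular Y) (fun n s => f \o s) (singular_map_face f).

Definition singular_H1 (X : topologicalType) := H1 (singular X).

Definition singular_H1_map (X Y : topologicalType) (f : continuousType X Y) :
  {additive singular_H1 Y -> singular_H1 X} := H1_map (singular_map f).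

End Singular.

Record substitution (A : finType) := Substitution {
  subst_fun :> A -> seq A;
  subst_nonempty : forall a, subst_fun a != [::]
}.

Definition subst_word (A : finType) (phi : A -> seq A) (w : seq A) : seq A :=
  flatten (map phi w).

Definition subst_matrix (A : finType) (phi : A -> seq A) : 'M[nat]_#|A| :=
  \matrix_(i, j) count_mem (enum_val i) (phi (enum_val j)).

Definition biseq (A : finType) := {ptws int -> discrete_topology A}.
HB.instance Definition _ (A : finType) := Topological.on (biseq A).

Definition bishift (A : finType) (n : int) (T : biseq A) : biseq A :=
  fun i => T (i + n).

Definition biword (A : finType) (T : biseq A) (i : int) (n : nat) : seq A :=
  mkseq (fun j => T (i + j%:Z) : A) n.

(* The letter of index n >= 0 of the image lies in phi(T_0) .. phi(T_n), and
   that of index -(n + 1) in phi(T_(-n-1)) .. phi(T_(-1)), as the images of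
   letters are nonempty. *)
Definition subst_biseq (A : finType) (phi : A -> seq A) (T : biseq A) :
    biseq A :=
  fun i => match i with
  | Posz n => nth (T 0 : A) (subst_word phi (biword T 0 n.+1)) n
  | Negz n => nth (T 0 : A) (rev (subst_word phi (biword T (Negz n) n.+1))) n
  end.

Section SubstBiseq.
Variables (A : finType) (phi : substitution A).

Lemma size_subst_word w : (size w <= size (subst_word phi w))%N.
Proof.
elim: w => //= a w IH; rewrite /subst_word/= size_cat -add1n leq_add//.
by rewrite lt0n size_eq0 subst_nonempty.
Qed.

Lemma subst_word_cat v w :
  subst_word phi (v ++ w) = subst_word phi v ++ subst_word phi w.
Proof. by rewrite /subst_word map_cat flatten_cat. Qed.

Lemma size_biword (T : biseq A) i n : size (biword T i n) = n.
Proof. exact: size_mkseq. Qed.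

Lemma biword_cat (T : biseq A) i m n :
  biword T i (m + n) = biword T i m ++ biword T (i + m%:Z) n.
Proof.
rewrite /biword /mkseq iotaD map_cat add0n; congr (_ ++ _).
rewrite -[in LHS](addn0 m) iotaDl -map_comp; apply: eq_map => j /=.
by rewrite PoszD addrA.
Qed.

Lemma subst_biseq_nth (T : biseq A) (m j : nat) :
  let N := subst_word phi (biword T (Negz m) m.+1) in
  (size N <= j + m)%N -> (j <= size N + m)%N ->
  subst_biseq phi T (j%:Z - (size N)%:Z) =
  nth (T 0 : A) (subst_word phi (biword T (Negz m) (m.+1 + m.+1))) j.
Proof.
move=> N jlo jhi.
have -> : subst_word phi (biword T (Negz m) (m.+1 + m.+1)) =
    N ++ subst_word phi (biword T 0 m.+1).
  rewrite biword_cat subst_word_cat; congr (_ ++ subst_word _ (biword _ _ _)).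
  by rewrite NegzE addNr.
rewrite nth_cat; case: ltnP => [jN|Nj].
  have [n hn] : exists n, (j + n.+1)%N = size N by exists (size N - j.+1)%N; lia.
  have -> : j%:Z - (size N)%:Z = Negz n by rewrite -hn NegzE; lia.
  have nm : (n < m.+1)%N by lia.
  have eN : N = subst_word phi (biword T (Negz m) (m - n)) ++
                subst_word phi (biword T (Negz n) n.+1).
    rewrite -subst_word_cat /N; congr subst_word.
    have -> : Negz n = Negz m + (m - n)%:Z by rewrite !NegzE; lia.
    by rewrite -biword_cat; congr biword; lia.
  have sz := size_subst_word (biword T (Negz n) n.+1).
  rewrite size_biword in sz.
  rewrite /= nth_rev ?(leq_trans _ sz)//.
  move: hn; rewrite eN nth_cat size_cat; set a := size _; set b := size _ => hn.
  by case: ltnP => [|_]; [lia|congr nth; lia].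
have [n hn] : exists n, j = (size N + n)%N by exists (j - size N)%N; lia.
have -> : j%:Z - (size N)%:Z = n%:Z by rewrite hn; lia.
have -> : (j - size N)%N = n by lia.
have eP : subst_word phi (biword T 0 m.+1) = subst_word phi (biword T 0 n.+1) ++
    subst_word phi (biword T (0 + n.+1%:Z) (m - n)).
  by rewrite -subst_word_cat -biword_cat; congr (subst_word _ (biword _ _ _)); lia.
have sz := size_subst_word (biword T 0 n.+1); rewrite size_biword in sz.
by rewrite eP nth_cat sz.
Qed.

Lemma subst_biseq_infix (T : biseq A) (i : int) (n : nat) :
  exists i' n', infix (biword (subst_biseq phi T) i n)
                      (subst_word phi (biword T i' n')).
Proof.
pose m := (absz i + n)%N; exists (Negz m), (m.+1 + m.+1)%N.
set N := subst_word phi (biword T (Negz m) m.+1).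
have sN : (m.+1 <= size N)%N.
  by have := size_subst_word (biword T (Negz m) m.+1); rewrite size_biword.
set W := subst_word _ _.
have sW : (size N + m.+1 <= size W)%N.
  rewrite /W biword_cat subst_word_cat size_cat leq_add2l.
  by apply: leq_trans (size_subst_word _); rewrite size_biword.
pose j := absz (i + (size N)%:Z).
have ej : j%:Z = i + (size N)%:Z by rewrite /j /m in sN *; lia.
suff -> : biword (subst_biseq phi T) i n = take n (drop j W).
  by apply/infixP; exists (take j W), (drop n (drop j W)); rewrite !cat_take_drop.
have jn : (j + n <= size W)%N by rewrite /m in sW sN; lia.
apply: (@eq_from_nth A (T 0)) => [|r].
  by rewrite size_biword size_take size_drop; case: ltnP => //; lia.
rewrite size_biword => rn; rewrite nth_mkseq// nth_take// nth_drop.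
rewrite -subst_biseq_nth -/N.
- by congr subst_biseq; lia.
- by rewrite /m; lia.
- by rewrite /m; lia.
Qed.

End SubstBiseq.

Section MixedSystem.
Variables (A : finType) (k : nat) (F : 'I_k.+1 -> substitution A).
Implicit Type s : nat -> 'I_k.+1.

Definition seq_shift (i : nat) s : nat -> 'I_k.+1 := fun n => s (i + n)%N.

(* phi_{s_m} o ... o phi_{s_n}: the rightmost substitution acts first. *)
Definition phi_seg s (m n : nat) (a : A) : seq A :=
  foldr (fun j => subst_word (F (s j))) [:: a] (index_iota m n.+1).

Definition primitive_system s : Prop :=
  forall n, exists2 l, (1 <= l)%N &
    forall i j, (0 < subst_matrix (phi_seg s n (n + l)%N) i j)%N.

Definition admissible s (T : biseq A) : Prop :=
  forall i m, exists n a, infix (biword T i m) (phi_seg s 0 n a).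

Definition admissible_space s : set (biseq A) := [set T | admissible s T].

Definition two_letter_words s : set (A * A) :=
  [set ab | exists2 T, admissible_space s T &
    exists i : int, T i = ab.1 /\ T (i + 1) = ab.2].

Definition self_correcting s : Prop :=
  forall i, exists2 N, (1 <= N)%N & forall a b : A,
    two_letter_words (seq_shift i s)
      (last a (phi_seg s i (i + N)%N a), head b (phi_seg s i (i + N)%N b)).

Lemma admissible_bishift s n T : admissible s T -> admissible s (bishift n T).
Proof.
move=> adm i m; have [l [a h]] := adm (i + n) m; exists l, a.
by congr (infix _ _): h; apply: eq_map => j; rewrite /bishift addrAC.
Qed.

Lemma phi_seg_shift s i n a :
  phi_seg (seq_shift i s) 0 n.+1 a =
  subst_word (F (s i)) (phi_seg (seq_shift i.+1 s) 0 n a).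
Proof.
have h r : foldr (fun j => subst_word (F (seq_shift i s j))) [:: a]
      (map (addn 1) r) =
    foldr (fun j => subst_word (F (seq_shift i.+1 s j))) [:: a] r.
  elim: r => //= j r ->; congr (subst_word (F _) _).
  by rewrite /seq_shift addnA addn1.
rewrite /phi_seg /index_iota !subn0 -h -iotaDl.
by have <- : seq_shift i s 0 = s i by rewrite /seq_shift addn0.
Qed.

Lemma subst_word_infix (phi : A -> seq A) v w :
  infix v w -> infix (subst_word phi v) (subst_word phi w).
Proof.
move=> /infixP[p [q ->]]; rewrite /subst_word !map_cat !flatten_cat.
by apply/infixP; eexists; eexists.
Qed.

Lemma admissible_subst s i T : admissible (seq_shift i.+1 s) T ->
  admissible (seq_shift i s) (subst_biseq (F (s i)) T).
Proof.
move=> adm j m; have [j' [m' h]] := subst_biseq_infix (F (s i)) T j m.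
have [n [a h']] := adm j' m'; exists n.+1, a.
by rewrite phi_seg_shift; apply: infix_trans h _; exact: subst_word_infix.
Qed.

Section TilingSpace.
Variable R : realType.

Definition tiling_pre s : Type :=
  (admissible_space s * `[0%R : R, 1%R]%classic)%type.
HB.instance Definition _ s := Topological.on (tiling_pre s).

Definition tiling_glue s (x y : tiling_pre s) : Prop :=
  [/\ val x.2 = 1, val y.1 = bishift 1 (val x.1) & val y.2 = 0].

Definition tiling_space s := {eq_quot (gen_eqv_rel (@tiling_glue s))}.
HB.instance Definition _ s :=
  Topological.copy (tiling_space s) (quotient_topology (tiling_space s)).
HB.instance Definition _ s := Quotient.on (tiling_space s).

(* The parameter of the result is in [0, 1). *)
Definition tiling_normal s (x : tiling_pre s) : biseq A * R :=
  if val x.2 == 1 then (bishift 1 (val x.1), 0) else (val x.1, val x.2).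

Definition tiling_image (phi : substitution A) (p : biseq A * R) : biseq A * R :=
  let u := (size (phi (p.1 0)))%:R * p.2 in
  (bishift (Num.floor u) (subst_biseq phi p.1), u - (Num.floor u)%:~R).

Lemma tiling_image_subproof1 s i (x : tiling_pre (seq_shift i.+1 s)) :
  (tiling_image (F (s i)) (tiling_normal x)).1
    \in admissible_space (seq_shift i s).
Proof.
apply/mem_set/admissible_bishift/admissible_subst.
by rewrite /tiling_normal; case: ifP => _ /=; [apply: admissible_bishift|];
  case: x => -[T /= /set_mem].
Qed.

Lemma tiling_image_subproof2 s i (x : tiling_pre (seq_shift i.+1 s)) :
  (tiling_image (F (s i)) (tiling_normal x)).2 \in `[0%R : R, 1%R]%classic.
Proof.
rewrite inE /= in_itv /=; set u := _ * _.
have /andP[lo hi] := floor_itv u.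
by rewrite subr_ge0 lo /= lerBlDl ltW// -intrD1.
Qed.

Definition tiling_map s i (x : tiling_space (seq_shift i.+1 s)) :
    tiling_space (seq_shift i s) :=
  \pi_(tiling_space (seq_shift i s))
    (elt (tiling_image_subproof1 (repr x)), elt (tiling_image_subproof2 (repr x))).

Definition recognisable s : Prop := forall i, injective (@tiling_map s i).

End TilingSpace.
End MixedSystem.

Section BargeDiamond.
Variables (R : realType) (A : finType) (k : nat).
Variable F : 'I_k.+1 -> substitution A.

(* The minimum of the 1 / (2 |phi_i(a)|); the neutral value 1 / 2 bounds them
   all and only matters for the empty alphabet. *)
Definition bd_eps : R :=
  \big[Num.min/2^-1]_(p : 'I_k.+1 * A) (2 * (size (F p.1 p.2))%:R)^-1.

Local Notation eps := bd_eps.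

(* [inl a] stands for the edge e_a and [inr (a, b)] for the edge e_ab. *)
Definition bd_edge : Type := (A + A * A)%type.
HB.instance Definition _ := Finite.on bd_edge.

Definition bd_lo (e : bd_edge) : R := if e is inl _ then eps else - eps.
Definition bd_hi (e : bd_edge) : R := if e is inl _ then 1 - eps else eps.

Definition bd_interval (e : bd_edge) : set R := `[bd_lo e, bd_hi e]%classic.

Definition bd_pre : Type := {e : bd_edge & bd_interval e}.
HB.instance Definition _ := Topological.on bd_pre.

Definition bd_coord (x : bd_pre) : R := val (projT2 x).

Definition bd_glue (x y : bd_pre) : Prop := exists a b : A,
  [/\ projT1 x = inl a, bd_coord x = 1 - eps,
      projT1 y = inr (a, b) & bd_coord y = - eps] \/
  [/\ projT1 x = inl a, bd_coord x = eps,
      projT1 y = inr (b, a) & bd_coord y = eps].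

Definition bd_complex := {eq_quot (gen_eqv_rel bd_glue)}.
HB.instance Definition _ :=
  Topological.copy bd_complex (quotient_topology bd_complex).
HB.instance Definition _ := Quotient.on bd_complex.

Lemma bd_eps_ge0 : 0 <= eps.
Proof.
apply: (big_ind (fun x : R => 0 <= x)) => [|x y x0 y0|p _].
- by rewrite invr_ge0.
- by rewrite le_min x0.
- by rewrite invr_ge0 mulr_ge0.
Qed.

Lemma bd_eps_le_half : eps <= 2^-1.
Proof.
rewrite /bd_eps; elim/big_ind: _ => // [x y x0 _|p _].
  by rewrite ge_min x0.
rewrite lef_pV2 ?posrE// ?mulr_gt0// ?ltr0n ?lt0n ?size_eq0 ?subst_nonempty//.
by rewrite ler_peMr// ler1n lt0n size_eq0 subst_nonempty.
Qed.

Lemma bd_eps_le (i : 'I_k.+1) a : eps <= (2 * (size (F i a))%:R)^-1.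
Proof. by rewrite /bd_eps (bigminD1 (i, a))//= ge_min lexx. Qed.

Lemma bd_lo_le_hi e : bd_lo e <= bd_hi e.
Proof.
have e0 := bd_eps_ge0; have e1 := bd_eps_le_half.
by case: e => [a|ab] /=; lra.
Qed.

(* The point of parameter x on the edge e; values of x outside the interval of
   e are never used below, and are sent to the nearest end of e. *)
Definition bd_clamp (e : bd_edge) (x : R) : R :=
  Num.max (bd_lo e) (Num.min x (bd_hi e)).

Lemma bd_clamp_subproof e x : bd_clamp e x \in bd_interval e.
Proof.
rewrite inE /bd_interval /= in_itv /= /bd_clamp le_max lexx /= ge_max bd_lo_le_hi /=.
by rewrite ge_min lexx orbT.
Qed.

Definition bd_point (e : bd_edge) (x : R) : bd_complex :=
  \pi_bd_complex (existT _ e (elt (bd_clamp_subproof e x)) : bd_pre).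

Lemma bd_clampK e x : bd_lo e <= x <= bd_hi e -> bd_clamp e x = x.
Proof. by case/andP=> lx xh; rewrite /bd_clamp (min_l xh) (max_r lx). Qed.

Lemma bd_point_continuous e : continuous (bd_point e).
Proof.
have clamp_cont : continuous (bd_clamp e).
  move=> x; apply: (@continuous_max R R (cst (bd_lo e)) (fun y => Num.min y (bd_hi e))).
    exact: cst_continuous.
  apply: (@continuous_min R R id (cst (bd_hi e))); last exact: cst_continuous.
  exact: cvg_id.
have elt_cont : continuous
    (fun x => elt (bd_clamp_subproof e x) : bd_interval e).
  by apply: continuous_comp_initial; exact: clamp_cont.
move=> x; apply: (@continuous_comp _ bd_pre bd_complex
  (fun x => existT _ e (elt (bd_clamp_subproof e x)) : bd_pre)
  (\pi_bd_complex)); last exact: pi_continuous.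
apply: (@continuous_comp _ (bd_interval e) bd_pre
  (fun x => elt (bd_clamp_subproof e x) : bd_interval e)
  (fun t => existT _ e t : bd_pre)); first exact: elt_cont.
exact: existT_continuous.
Qed.

Lemma bd_point_coord (x : bd_pre) :
  bd_point (projT1 x) (bd_coord x) = \pi_bd_complex x.
Proof.
case: x => e t; rewrite /bd_point /bd_coord /=; congr (\pi_bd_complex _).
congr existT; apply: val_inj => /=; apply: bd_clampK.
by case: t => t /= /set_mem; rewrite /bd_interval /= in_itv.
Qed.

Lemma bd_point_out a b : bd_point (inl a) (1 - eps) = bd_point (inr (a, b)) (- eps).
Proof.
have e0 := bd_eps_ge0; have e1 := bd_eps_le_half.
apply/eqmodP/asboolP/rst_step; exists a, b; left; split=> //;
  by rewrite /bd_coord /= bd_clampK //=; lra.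
Qed.

Lemma bd_point_in a b : bd_point (inl a) eps = bd_point (inr (b, a)) eps.
Proof.
have e0 := bd_eps_ge0; have e1 := bd_eps_le_half.
apply/eqmodP/asboolP/rst_step; exists a, b; right; split=> //;
  by rewrite /bd_coord /= bd_clampK //=; lra.
Qed.

(* The unit-speed edge path e_{a_1}, e_{a_1 a_2}, ..., e_{a_k} for the word
   a_1 ... a_k = a :: w, with parameter in [eps, k - eps]. *)
Fixpoint bd_path (a : A) (w : seq A) (u : R) : bd_complex :=
  match w with
  | [::] => bd_point (inl a) u
  | b :: w' => if u <= 1 - eps then bd_point (inl a) u
               else if u <= 1 + eps then bd_point (inr (a, b)) (u - 1)
               else bd_path b w' (u - 1)
  end.

Lemma continuous_paste (f g : R -> bd_complex) (c : R) :
  continuous f -> continuous g -> f c = g c ->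
  continuous (fun u => if u <= c then f u else g u).
Proof.
move=> cf cg fg; apply/continuous_subspace_setT.
have -> : [set: R] = `]-oo, c]%classic `|` `[c, +oo[%classic.
  by apply/seteqP; split=> // u _ /=; rewrite !in_itv /= andbT;
    apply/orP; exact: le_total.
apply: withinU_continuous; [exact: lray_closed|exact: rray_closed| |].
- apply: (@subspace_eq_continuous _ _ _ f); last exact: continuous_subspaceT.
  by move=> u; rewrite inE /= in_itv /from_subspace /= => h; rewrite h.
- apply: (@subspace_eq_continuous _ _ _ g); last exact: continuous_subspaceT.
  move=> u; rewrite inE /= in_itv /= andbT /from_subspace => cu; case: ifP => // uc.
  by have -> : u = c by apply/le_anti/andP.
Qed.

Lemma bd_path_eps a w : bd_path a w eps = bd_point (inl a) eps.
Proof.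
have e0 := bd_eps_ge0; have e1 := bd_eps_le_half.
by case: w => //= b w; rewrite ifT//; lra.
Qed.

Lemma bd_path_end a w :
  bd_path a w ((size w).+1%:R - eps) = bd_point (inl (last a w)) (1 - eps).
Proof.
have e0 := bd_eps_ge0; have e1 := bd_eps_le_half.
elim: w a => [|b w IH] a; first by [].
rewrite [LHS]/= -IH; have n1 : 1 <= (size w).+1%:R :> R by rewrite ler1n.
have -> : (size w).+2%:R - eps - 1 = (size w).+1%:R - eps.
  by rewrite -[in LHS]natr1; ring.
have n2 : (size w).+2%:R = (size w).+1%:R + 1 :> R by rewrite natr1.
rewrite ifN; last by rewrite n2; lra.
case: ifP => // h; have e2 : 2 * eps = 1 by rewrite n2 in h; lra.
have e3 : (size w).+1%:R = 1 :> R by rewrite n2 in h; lra.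
have -> : w = [::].
  by apply/size0nil/eqP; move/eqP: e3; rewrite -[1]/(1%:R) eqr_nat.
have -> : (size ([::] : seq A)).+1%:R - eps = eps :> R by rewrite /=; lra.
by rewrite [RHS]/= (bd_point_in b a).
Qed.

Lemma bd_path_continuous a w : continuous (bd_path a w).
Proof.
have e0 := bd_eps_ge0; have e1 := bd_eps_le_half.
have sub1 : continuous (fun u : R => u - 1).
  by move=> u; apply: continuousB; [exact: id|exact: cst_continuous].
elim: w a => [|b w IH] a; first exact: bd_point_continuous.
apply: continuous_paste; first exact: bd_point_continuous.
  apply: continuous_paste.
  - move=> u; apply: (@continuous_comp R R _ (fun v => v - 1) (bd_point _)).
      exact: sub1.
    exact: bd_point_continuous.
  - move=> u; apply: (@continuous_comp R R _ (fun v => v - 1) (bd_path b w)).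
      exact: sub1.
    exact: IH.
  - by rewrite -[RHS]/(bd_path b w _) addrAC subrr add0r bd_path_eps (bd_point_in b a).
rewrite ifT; last by lra.
by rewrite addrAC subrr add0r; exact: bd_point_out.
Qed.

(* On e_a, the affine change of parameter takes [eps, 1 - eps] onto
   [eps, |phi(a)| - eps]. *)
Definition bd_pre_map (phi : substitution A) (x : bd_pre) : bd_complex :=
  match projT1 x with
  | inl a =>
      bd_path (head a (phi a)) (behead (phi a))
        (eps + (bd_coord x - eps) *
               (((size (phi a))%:R - 2 * eps) / (1 - 2 * eps)))
  | inr (a, b) =>
      bd_point (inr (last a (phi a), head b (phi b))) (bd_coord x)
  end.

Definition bd_map (phi : substitution A) (x : bd_complex) : bd_complex :=
  bd_pre_map phi (repr x).

Lemma bd_pre_map_continuous phi : continuous (bd_pre_map phi).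
Proof.
have coord_cont e : continuous (fun t : bd_interval e => val t : R).
  exact: initial_continuous.
pose f e : bd_interval e -> bd_complex := fun t => bd_pre_map phi (existT _ e t).
apply: (@sigT_continuous bd_edge bd_interval bd_complex f) => -[a|[a b]] t.
  apply: (@continuous_comp (bd_interval (inl a)) R _ (fun t => val t)
    (fun u => bd_path _ _ (eps + (u - eps) * _))); first exact: coord_cont.
  apply: (@continuous_comp R R _ (fun u => eps + (u - eps) * _) (bd_path _ _)).
    apply: cvgD; first exact: cvg_cst.
    apply: cvgMl; apply: cvgB; [exact: cvg_id|exact: cvg_cst].
  exact: bd_path_continuous.
apply: (@continuous_comp (bd_interval (inr (a, b))) R _ (fun t => val t)
  (bd_point _)); first exact: coord_cont.
exact: bd_point_continuous.
Qed.

Lemma bd_pre_map_glue (i : 'I_k.+1) x y :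
  bd_glue x y -> bd_pre_map (F i) x = bd_pre_map (F i) y.
Proof.
have e0 := bd_eps_ge0; have e1 := bd_eps_le_half.
move=> [a [b []]] [xa xc yab yc]; rewrite /bd_pre_map xa yab xc yc; last first.
  by rewrite subrr mul0r addr0 bd_path_eps; exact: bd_point_in.
have n0 : (0 < size (F i a))%N by rewrite lt0n size_eq0 subst_nonempty.
have -> : eps + (1 - eps - eps) * (((size (F i a))%:R - 2 * eps) / (1 - 2 * eps)) =
    (size (F i a))%:R - eps.
  have [e2|ne2] := eqVneq (1 - 2 * eps) 0; last by field.
  have le1 := bd_eps_le i a.
  have n1 : (size (F i a))%:R <= 1 :> R.
    have eh : eps = 2^-1 by lra.
    by move: le1; rewrite eh lef_pV2 ?posrE ?mulr_gt0 ?ltr0n//; lra.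
  have n2 : 1 <= (size (F i a))%:R :> R by rewrite ler1n.
  have -> : 1 - eps - eps = 0 by lra.
  by lra.
have := bd_path_end (head a (F i a)) (behead (F i a)).
case: (F i a) n0 => //= c w _ ->.
exact: bd_point_out.
Qed.

Lemma bd_pre_map_eqv (i : 'I_k.+1) x y : clos_refl_sym_trans bd_pre bd_glue x y ->
  bd_pre_map (F i) x = bd_pre_map (F i) y.
Proof.
by elim=> [u v /bd_pre_map_glue//|//|u v _ -> //|u v w _ -> _ -> //].
Qed.

Lemma bd_map_continuous (i : 'I_k.+1) : continuous (bd_map (F i)).
Proof.
apply: repr_comp_continuous; first exact: bd_pre_map_continuous.
by move=> x y /eqP/eqmodP/asboolP xy; apply/eqP; exact: bd_pre_map_eqv.
Qed.

HB.instance Definition _ (i : 'I_k.+1) :=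
  @isContinuous.Build _ _ (bd_map (F i)) (@bd_map_continuous i).

Lemma bd_mapE (i : 'I_k.+1) (x : bd_pre) :
  bd_map (F i) (\pi_bd_complex x) = bd_pre_map (F i) x.
Proof.
by have /eqmodP/asboolP := reprK (\pi_bd_complex x); exact: bd_pre_map_eqv.
Qed.

Definition bd_H1 := singular_H1 R bd_complex.

Definition bd_H1_map (i : 'I_k.+1) : {additive bd_H1 -> bd_H1} :=
  @singular_H1_map R bd_complex bd_complex (bd_map (F i)).

Definition bd_system (s : nat -> 'I_k.+1) : direct_system :=
  sequential_system (fun n => bd_H1_map (s n)).

End BargeDiamond.

(* Main.v *)
(* Both groups are compared with functions on admissible sequences.

   Cutting the suspension open along Sigma x {0} and Sigma x {1} trivialises any
   Cech 1-class, because Sigma is a Cantor set and homotopy invariance takes care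
   of the interval; the jump across the glueing is a locally constant f on Sigma,
   well defined modulo u o shift - u. Under this description a substitution acts
   by summing f over the image of the letter at the origin, and recognisability
   makes that action bijective from each level to the next.

   By primitivity, at a deep enough level f is cohomologous to a function
   c(T_0 T_1) of two letters. A singular 1-class z of the Barge-Diamond complex
   also gives such a c: integrate z from the midpoint of e_a to the midpoint of
   e_b through e_ab. Modulo functions v(b) - v(a) this determines the class of z, every
   c arises, and the map induced by a substitution acts on c as it does on f. So the two sides agree as soon
   as a function c which is a coboundary on admissible sequences becomes, at a
   later level, of the form v(b) - v(a) for ALL pairs ab; that is what
   self-correction provides. *)

From HB Require Import structures.
Require Import Defs.
From Stdlib Require Import Relation_Operators.
From mathcomp Require Import all_boot all_order all_algebra.
From mathcomp Require Import generic_quotient.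
From mathcomp Require Import ring lra zify.
From mathcomp Require Import all_classical all_reals all_analysis.

Set Implicit Arguments.
Unset Strict Implicit.
Unset Printing Implicit Defensive.

Import Order.TTheory GRing.Theory Num.Theory.
Import numFieldNormedType.Exports.

Local Open Scope classical_set_scope.
Local Open Scope ring_scope.
Local Open Scope quotient_scope.

(** * Substitutions and locally constant functions on admissible sequences *)

(** None of the comparisons is a map on the nose: a Cech class has many jump functions [f], a
    singular class many edge functions [c], and [f] meets [c] only at a deep level. The isomorphism
    is therefore built as a relation closed under subtraction, total and surjective, with trivial
    kernel on either side; [additive_relation_iso] turns it into a map.

    The tiling spaces of higher levels get no cohomology of their own. A Cech class and its [f] stay
    at level 0 and only the function pulled back along [Phi F s 0 n] moves, so that no inverse limit
    of spaces appears and recognisability enters through sequences only.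

    Cech and singular cocycles meet in the notion of [local_cocycle], a function of pairs of points
    that is additive near the diagonal. A Cech cocycle yields one, whose primitives exist on Cantor
    sets and propagate along homotopies; conversely, one that is concentrated at the midpoints of
    the edges e_ab yields the singular classes with prescribed integrals. *)

Section BiseqTopology.
Variable A : finType.
Implicit Types S T : biseq A.

Definition agree (q : nat) S T := forall i : int, (absz i <= q)%N -> T i = S i.

Lemma agree_trans q S T U : agree q S T -> agree q T U -> agree q S U.
Proof. by move=> h h' i qi; rewrite h' // h. Qed.

Lemma agreeW q r S T : (q <= r)%N -> agree r S T -> agree q S T.
Proof. by move=> qr h i iq; apply: h; exact: leq_trans qr. Qed.

Lemma coord_near S (i : int) : \forall T \near S, T i = S i :> A.
Proof.
have h := @proj_continuous int (fun=> discrete_topology A) i S.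
apply: (h [set S i]); exact: (@discrete_set1 (discrete_topology A)).
Qed.

Lemma agree_near q S : \forall T \near S, agree q S T.
Proof.
elim: q => [|q IH].
  apply: filterS (coord_near S 0) => T T0 i; rewrite leqn0 absz_eq0 => /eqP -> //.
near=> T => i; rewrite leq_eqVlt => /orP[|iq]; last by rewrite (near IH T).
move=> iq; have [->|->] : i = q.+1%:Z \/ i = - q.+1%:Z by lia.
  by rewrite (near (coord_near S q.+1%:Z) T).
by rewrite (near (coord_near S (- q.+1%:Z)) T).
Unshelve. all: by end_near. Qed.

(** The cylinders around [S] generate a filter that converges to [S] in each coordinate, hence in
    the product topology. *)
Lemma nbhs_biseqP S (B : set (biseq A)) :
  nbhs S B <-> exists q, forall T, agree q S T -> B T.
Proof.
split=> [|[q qB]]; last by apply: filterS (agree_near q S).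
pose G : set_system (biseq A) := fun B => exists q, forall T, agree q S T -> B T.
have FG : Filter G.
  split=> [|P Q [q hP] [r hQ]|P Q PQ [q hP]]; first by exists 0%N.
    exists (maxn q r) => T h; split; [apply: hP|apply: hQ];
      by apply: agreeW h; rewrite (leq_maxl,leq_maxr).
  by exists q => T /hP/PQ.
suff: G --> S by exact.
apply/cvg_sup => i; apply/cvg_image.
  by rewrite eqEsubset; split=> // x _; exists (fun=> x).
move=> C; rewrite nbhsE => -[D [oD Di] DC].
exists [set T | C (T i)]; last first.
  rewrite eqEsubset; split=> [_ [T CT <-]//|x Cx].
  by exists (fun=> x).
by exists (absz i) => T h; rewrite /= h//; exact: DC.
Qed.

Lemma biseq_compact : compact [set: biseq A].
Proof.
have h : finite_set [set: discrete_topology A] by exact: (@finite_finset A).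
have := @tychonoff int (fun=> discrete_topology A) (fun=> setT)
  (fun=> finite_compact h).
by congr (compact _); apply/seteqP; split.
Qed.

Lemma biseq_hausdorff : hausdorff_space (biseq A).
Proof.
apply: (@hausdorff_product int (fun=> discrete_topology A)) => _.
exact: discrete_hausdorff.
Qed.

Lemma bishift_cvg n S q : \forall T \near S, agree q (bishift n S) (bishift n T).
Proof.
apply: filterS (agree_near (q + absz n) S) => T h i iq; apply: h.
by rewrite /bishift; lia.
Qed.

Lemma bishiftD m n S : bishift m (bishift n S) = bishift (m + n) S.
Proof. by apply/funext => i; rewrite /bishift addrA. Qed.

Lemma bishift0 S : bishift 0 S = S.
Proof. by apply/funext => i; rewrite /bishift addr0. Qed.

End BiseqTopology.

(** * Substitutions on bi-infinite sequences, Birkhoff sums and their pullback *)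

Section SubstBiseqTheory.
Variable A : finType.
Implicit Types (S T : biseq A) (phi psi : substitution A).

Lemma size_subst_gt0 phi a : (0 < size (phi a))%N.
Proof. by rewrite lt0n size_eq0 subst_nonempty. Qed.

Lemma nth_biword d T i n j : (j < n)%N -> nth d (biword T i n) j = T (i + j%:Z).
Proof. by move=> jn; rewrite nth_mkseq. Qed.

Lemma subst_word1 phi a : subst_word phi [:: a] = phi a.
Proof. by rewrite /subst_word /= cats0. Qed.

Lemma biword1 T i : biword T i 1 = [:: T i : A].
Proof. by rewrite /biword /mkseq /= addr0. Qed.

Lemma biword_bishift k T i n : biword (bishift k T) i n = biword T (i + k) n.
Proof. by apply: eq_map => j; rewrite /bishift addrAC. Qed.

(** The position is first read in the image of a window around the origin that is large enough for
    [subst_biseq_nth]; the window from -a of length n is then the middle one of three consecutive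
    blocks of it. *)
Lemma subst_biseqE phi T d (a n j : nat) : (a <= n)%N ->
  (j < size (subst_word phi (biword T (- a%:Z) n)))%N ->
  subst_biseq phi T (j%:Z - (size (subst_word phi (biword T (- a%:Z) a)))%:Z) =
  nth d (subst_word phi (biword T (- a%:Z) n)) j.
Proof.
move=> an jn; set P := size _; set i := j%:Z - P%:Z.
pose m := (absz i + n)%N.
pose N := subst_word phi (biword T (Negz m) m.+1).
have sN : (m.+1 <= size N)%N.
  by rewrite -[m.+1](size_biword T (Negz m)) size_subst_word.
have eN : N = subst_word phi (biword T (Negz m) (m.+1 - a)) ++
              subst_word phi (biword T (- a%:Z) a).
  rewrite -subst_word_cat /N; congr subst_word.
  have -> : - a%:Z = Negz m + (m.+1 - a)%N%:Z by rewrite NegzE; lia.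
  by rewrite -biword_cat; congr biword; lia.
pose k := absz (i + (size N)%:Z).
have ek : k%:Z = i + (size N)%:Z by rewrite /k; lia.
have -> : i = k%:Z - (size N)%:Z by lia.
rewrite subst_biseq_nth -/N; [|by rewrite /m in sN *; lia..].
have -> : subst_word phi (biword T (Negz m) (m.+1 + m.+1)) =
    subst_word phi (biword T (Negz m) (m.+1 - a)) ++
    subst_word phi (biword T (- a%:Z) n) ++
    subst_word phi (biword T (- a%:Z + n%:Z) (m.+1 + a - n)).
  rewrite -!subst_word_cat; congr subst_word.
  rewrite -biword_cat.
  have -> : - a%:Z = Negz m + (m.+1 - a)%N%:Z by rewrite NegzE; lia.
  by rewrite -biword_cat; congr biword; rewrite /m; lia.
have kj : k = (size (subst_word phi (biword T (Negz m) (m.+1 - a))) + j)%N.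
  by move: ek; rewrite eN size_cat -/P /i; lia.
rewrite nth_cat kj ltnNge leq_addr /= addKn nth_cat jn.
exact: set_nth_default.
Qed.

Lemma biword_subst_biseq phi T (a n : nat) : (a <= n)%N ->
  biword (subst_biseq phi T)
    (- (size (subst_word phi (biword T (- a%:Z) a)))%:Z)
    (size (subst_word phi (biword T (- a%:Z) n))) =
  subst_word phi (biword T (- a%:Z) n).
Proof.
move=> an; apply: (@eq_from_nth _ (T 0)); rewrite size_biword// => j jn.
by rewrite nth_biword// addrC; exact: subst_biseqE.
Qed.

Lemma biword_subst_biseq0 phi T n :
  biword (subst_biseq phi T) 0 (size (subst_word phi (biword T 0 n))) =
  subst_word phi (biword T 0 n).
Proof. by have := @biword_subst_biseq phi T 0 n isT; rewrite oppr0. Qed.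

Lemma biword_subst_letter phi T :
  biword (subst_biseq phi T) 0 (size (phi (T 0))) = phi (T 0).
Proof. by have := biword_subst_biseq0 phi T 1; rewrite biword1 subst_word1. Qed.

Lemma subst_biseq_letter phi T d j : (j < size (phi (T 0)))%N ->
  subst_biseq phi T j = nth d (phi (T 0)) j.
Proof.
move=> jn; by rewrite -[in RHS]biword_subst_letter nth_biword// add0r.
Qed.

(** Both sides read the same word: the window of [T] from -a is the window of its shift from -(a+1),
    and the image of the part before the origin is longer by phi(T_0) in the second reading. *)
Lemma subst_biseq_bishift1 phi T :
  bishift (size (phi (T 0)))%:Z (subst_biseq phi T) = subst_biseq phi (bishift 1 T).
Proof.
apply/funext => i; set L := size _.
pose a := absz i.
pose W n := subst_word phi (biword T (- a%:Z) n).
have W1 : W a.+1 = W a ++ phi (T 0).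
  by rewrite /W -addn1 biword_cat subst_word_cat addNr biword1 subst_word1.
have sW n : (n <= size (W n))%N.
  by rewrite -[leqLHS](size_biword T (- a%:Z)) size_subst_word.
have sWc n m : (size (W n) + m <= size (W (n + m)))%N.
  rewrite /W biword_cat subst_word_cat size_cat leq_add2l.
  by rewrite -[leqLHS](size_biword T (- a%:Z + n%:Z)) size_subst_word.
pose j := absz (i + L%:Z + (size (W a))%:Z).
have ej : j%:Z = i + L%:Z + (size (W a))%:Z by have := sW a; rewrite /j; lia.
have s1 : size (W a.+1) = (size (W a) + L)%N by rewrite W1 size_cat.
have eb n : biword (bishift 1 T) (- a.+1%:Z) n = biword T (- a%:Z) n.
  by rewrite biword_bishift; congr biword; lia.
pose n := (a.+1 + a.+1)%N.
have jn : (j < size (W n))%N by have := sWc a.+1 a.+1; rewrite -/n; lia.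
transitivity (nth (T 0 : A) (W n) j).
  rewrite /bishift; have -> : i + L%:Z = j%:Z - (size (W a))%:Z by lia.
  by apply: subst_biseqE => //; rewrite /n; lia.
rewrite /W -(eb n) -subst_biseqE.
- by congr subst_biseq; rewrite eb -/(W _); lia.
- by rewrite /n; lia.
- by rewrite eb.
Qed.

Lemma subst_biseq_bishift phi T n :
  bishift (size (subst_word phi (biword T 0 n)))%:Z (subst_biseq phi T) =
  subst_biseq phi (bishift n T).
Proof.
elim: n T => [|n IH] T; first by rewrite !bishift0.
have -> : bishift n.+1%:Z T = bishift n%:Z (bishift 1 T).
  by rewrite bishiftD -[n.+1]addn1 PoszD.
rewrite -IH -subst_biseq_bishift1 bishiftD biword_bishift.
rewrite -[n.+1]/(1 + n)%N biword_cat biword1 subst_word_cat size_cat subst_word1.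
by rewrite addnC PoszD.
Qed.

(** Images of letters are nonempty, so those of the [q.+1] letters on each side of the origin cover
    all positions up to distance [q]. *)
Lemma subst_biseq_agree phi S T q :
  agree q.+1 S T -> agree q (subst_biseq phi S) (subst_biseq phi T).
Proof.
move=> h i iq.
have eb : forall n, (n <= q.+1 + q.+1)%N ->
    biword T (- q.+1%:Z) n = biword S (- q.+1%:Z) n.
  by move=> n nq; apply/eq_in_map => j; rewrite mem_iota => jn; apply: h; lia.
have sW n : (n <= size (subst_word phi (biword S (- q.+1%:Z) n)))%N.
  by rewrite -[leqLHS](size_biword S (- q.+1%:Z)) size_subst_word.
pose n := (q.+1 + q.+1)%N.
pose P := size (subst_word phi (biword S (- q.+1%:Z) q.+1)).
have hP := sW q.+1; rewrite -/P in hP.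
have hn : (P + q.+1 <= size (subst_word phi (biword S (- q.+1%:Z) n)))%N.
  rewrite /n biword_cat subst_word_cat size_cat leq_add2l.
  by rewrite -[leqLHS](size_biword S (- q.+1%:Z + q.+1%:Z)) size_subst_word.
pose j := absz (i + P%:Z).
have -> : i = j%:Z - P%:Z by rewrite /j; lia.
have jn : (j < size (subst_word phi (biword S (- q.+1%:Z) n)))%N by rewrite /j; lia.
rewrite [RHS](@subst_biseqE _ _ (S 0) q.+1 n) ?leq_addr//.
by rewrite /P -!eb ?leq_addr// (@subst_biseqE _ _ (S 0) q.+1 n) ?eb ?leq_addr.
Qed.

Definition comp_subst_fun phi psi a := subst_word phi (psi a).

Lemma comp_subst_nonempty phi psi a : comp_subst_fun phi psi a != [::].
Proof.
rewrite -size_eq0 -lt0n; apply: leq_trans (size_subst_word _ _).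
exact: size_subst_gt0.
Qed.

Definition comp_subst phi psi := Substitution (comp_subst_nonempty phi psi).

Lemma subst_word_comp phi psi w :
  subst_word (comp_subst phi psi) w = subst_word phi (subst_word psi w).
Proof.
elim: w => //= a w IH.
rewrite -cat1s (subst_word_cat (comp_subst phi psi)) (subst_word_cat psi).
by rewrite subst_word_cat -IH !subst_word1.
Qed.

Lemma subst_biseq_comp phi psi T :
  subst_biseq (comp_subst phi psi) T = subst_biseq phi (subst_biseq psi T).
Proof.
apply/funext => i; pose a := (absz i).+1; pose n := (a + a)%N.
pose W n := subst_word psi (biword T (- a%:Z) n).
have e (m : nat) : (a <= m)%N ->
    biword (subst_biseq psi T) (- (size (W a))%:Z) (size (W m)) = W m.
  exact: biword_subst_biseq.
pose P := size (subst_word phi (W a)).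
have hP : (a <= P)%N.
  apply: leq_trans (size_subst_word phi _); apply: leq_trans (size_subst_word psi _).
  by rewrite size_biword.
have hn : (P + a <= size (subst_word phi (W n)))%N.
  rewrite /W /n biword_cat 2!subst_word_cat size_cat leq_add2l.
  apply: leq_trans (size_subst_word phi _); apply: leq_trans (size_subst_word psi _).
  by rewrite size_biword.
have an : (a <= n)%N by rewrite /n; lia.
pose j := absz (i + P%:Z).
have -> : i = j%:Z - P%:Z by rewrite /j; lia.
have ji : (j < size (subst_word phi (W n)))%N by rewrite /j; lia.
transitivity (nth (T 0 : A) (subst_word phi (W n)) j).
  by rewrite /P /W -!subst_word_comp; apply: subst_biseqE; rewrite // subst_word_comp.
rewrite -[in LHS](e n)//.
have eP : P%:Z = size (subst_word phi (biword (subst_biseq psi T) (- (size (W a))%:Z) (size (W a)))).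
  by rewrite e.
rewrite [in RHS]eP; symmetry; apply: subst_biseqE; last by rewrite e.
by rewrite /W /n biword_cat subst_word_cat size_cat leq_addr.
Qed.

(** The Birkhoff sum of [f] along the shift. *)
Definition bsum (f : biseq A -> int) n T : int := \sum_(j < n) f (bishift j%:Z T).

Lemma bsum0 f T : bsum f 0 T = 0.
Proof. by rewrite /bsum big_ord0. Qed.

Lemma bsumD f m n T : bsum f (m + n) T = bsum f m T + bsum f n (bishift m%:Z T).
Proof.
rewrite /bsum big_split_ord /=; congr (_ + _); apply: eq_bigr => j _.
by rewrite bishiftD PoszD addrC.
Qed.

Lemma bsum1 f T : bsum f 1 T = f T.
Proof. by rewrite /bsum big_ord1 bishift0. Qed.

Lemma bsumB f g n T : bsum (fun S => f S - g S) n T = bsum f n T - bsum g n T.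
Proof. by rewrite /bsum sumrB. Qed.

Lemma bsum_cob (u : biseq A -> int) n T :
  bsum (fun S => u (bishift 1 S) - u S) n T = u (bishift n T) - u T.
Proof.
elim: n => [|n IH]; first by rewrite bsum0 bishift0 subrr.
rewrite -[in LHS]addn1 bsumD IH bsum1 bishiftD.
have -> : 1 + n%:Z = n.+1%:Z by lia.
by rewrite addrC addrA subrK.
Qed.

Definition pull phi f T := bsum f (size (phi (T 0))) (subst_biseq phi T).

(** Images of consecutive letters are consecutive blocks, so their sums concatenate; this is what
    makes [pull] functorial. *)
Lemma bsum_pull phi f n T :
  bsum (pull phi f) n T = bsum f (size (subst_word phi (biword T 0 n))) (subst_biseq phi T).
Proof.
elim: n => [|n IH]; first by rewrite !bsum0.
rewrite -addn1 bsumD IH bsum1 biword_cat subst_word_cat size_cat bsumD.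
rewrite subst_biseq_bishift biword1 subst_word1 /pull.
by rewrite /bishift !add0r.
Qed.

Lemma pull_comp phi psi f T : pull (comp_subst phi psi) f T = pull psi (pull phi f) T.
Proof.
by rewrite {2}/pull bsum_pull biword_subst_letter /pull subst_biseq_comp.
Qed.

Lemma pullB phi f g T : pull phi (fun S => f S - g S) T = pull phi f T - pull phi g T.
Proof. exact: bsumB. Qed.

Lemma pull_cob phi (u : biseq A -> int) T :
  pull phi (fun S => u (bishift 1 S) - u S) T =
  u (subst_biseq phi (bishift 1 T)) - u (subst_biseq phi T).
Proof. by rewrite /pull bsum_cob subst_biseq_bishift1. Qed.

Fixpoint psum (c : A -> A -> int) x w : int :=
  if w is y :: w' then c x y + psum c y w' else 0.

Definition edge_fun (c : A -> A -> int) T : int := c (T 0) (T 1).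

(** The word is phi(a) followed by the first letter of phi(b): it has one transition starting at
    each letter of phi(a), which matches the number of terms in [pull]. *)
Definition pull_edge phi c a b : int :=
  psum c (head a (phi a)) (rcons (behead (phi a)) (head b (phi b))).

Lemma bsum_edge c n T : bsum (edge_fun c) n T = psum c (T 0) (biword T 1 n).
Proof.
elim: n T => [|n IH] T; first by rewrite bsum0.
rewrite -add1n bsumD bsum1 IH biword_bishift biword_cat biword1 /=.
by rewrite /bishift add0r.
Qed.

Lemma pull_edge_fun phi c T : pull phi (edge_fun c) T = edge_fun (pull_edge phi c) T.
Proof.
rewrite /pull bsum_edge /edge_fun /pull_edge (@subst_biseq_letter _ _ (T 0) 0) ?size_subst_gt0//.
rewrite nth0; congr psum.
have e := biword_subst_letter phi T.
have sz := size_subst_gt0 phi (T 0).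
have -> : head (T 1 : A) (phi (T 1)) = subst_biseq phi T (size (phi (T 0)))%:Z.
  have := subst_biseq_bishift1 phi T => /(congr1 (fun S : biseq A => S 0)).
  rewrite /bishift add0r => ->.
  by rewrite (@subst_biseq_letter _ _ (T 1)) ?nth0 /bishift ?add0r ?size_subst_gt0.
rewrite -{2}e; case: (size (phi (T 0))) sz => // n _.
rewrite -{2}[n.+1]/(1 + n)%N biword_cat biword1 /= -[in LHS](addn1 n) biword_cat biword1 cats1.
by rewrite add0r; congr (rcons _ _); congr subst_biseq; lia.
Qed.

End SubstBiseqTheory.

(** * Locally constant functions and their finite windows *)

Section LocallyConstant.
Variable A : finType.
Implicit Types (S T : biseq A) (X Y : set (biseq A)).

(** Functions are total on [biseq A], but only their values on [X] are constrained. *)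
Definition loc_const X (f : biseq A -> int) :=
  forall S, X S -> \forall T \near S, X T -> f T = f S.

Lemma loc_const_window X f : compact X -> loc_const X f ->
  exists q, forall S T, X S -> X T -> agree q S T -> f T = f S.
Proof.
move=> /compact_near_coveringP cX lf.
have : \forall q \near \oo, X `<=` (fun S => forall T, X S -> X T -> agree q S T -> f T = f S).
  apply: cX => S XS; have /nbhs_biseqP[q0 hq0] := lf S XS.
  near=> S' q => T XS' XT h.
  have hS : agree q0 S S' by near: S'; exact: agree_near.
  have qq0 : (q0 <= q)%N by near: q; exact: nbhs_infty_ge.
  by rewrite (hq0 S' hS XS') (hq0 T)//; apply: agree_trans hS (agreeW qq0 h).
by move=> [q _ /(_ q (leqnn q)) h]; exists q => S T XS; exact: h.
Unshelve. all: by end_near. Qed.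

Lemma loc_const_cst X (n : int) : loc_const X (fun=> n).
Proof. by move=> S _; exact: filterE. Qed.

Lemma loc_constB X f g : loc_const X f -> loc_const X g ->
  loc_const X (fun S => f S - g S).
Proof.
move=> lf lg S XS; near=> T => XT.
by congr (_ - _); [apply: (near (lf S XS) T)|apply: (near (lg S XS) T)].
Unshelve. all: by end_near. Qed.

Lemma loc_constN X f : loc_const X f -> loc_const X (fun S => - f S).
Proof. by move=> lf S XS; apply: filterS (lf S XS) => T h /h ->. Qed.

Lemma loc_constD X f g : loc_const X f -> loc_const X g ->
  loc_const X (fun S => f S + g S).
Proof.
move=> lf lg S XS; near=> T => XT.
by congr (_ + _); [apply: (near (lf S XS) T)|apply: (near (lg S XS) T)].
Unshelve. all: by end_near. Qed.

Lemma loc_const_coord X (v : A -> int) : loc_const X (fun S => v (S 0)).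
Proof. by move=> S _; apply: filterS (coord_near S 0) => T ->. Qed.

Lemma loc_const_comp X Y (h : biseq A -> biseq A) f :
  (forall S, X S -> Y (h S)) -> (forall S q, \forall T \near S, agree q (h S) (h T)) ->
  loc_const Y f -> loc_const X (f \o h).
Proof.
move=> XY ch lf S XS; have /nbhs_biseqP[q hq] := lf _ (XY _ XS).
by apply: filterS (ch S q) => T hT XT; apply: hq => //; exact: XY.
Qed.

Lemma loc_const_bishift X f n : (forall S, X S -> X (bishift n S)) ->
  loc_const X f -> loc_const X (fun S => f (bishift n S)).
Proof. by move=> Xs; apply: (loc_const_comp Xs) => S q; exact: bishift_cvg. Qed.

Lemma loc_const_bsum X f n : (forall m S, X S -> X (bishift m S)) ->
  loc_const X f -> loc_const X (bsum f n).
Proof.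
move=> Xs lf; elim: n => [|n IH] S XS.
  by apply: filterE => T _; rewrite !bsum0.
have h := loc_const_bishift (Xs n%:Z) lf.
near=> T => XT; rewrite -addn1 !bsumD !bsum1.
by congr (_ + _); [apply: (near (IH S XS) T)|apply: (near (h S XS) T)].
Unshelve. all: by end_near. Qed.

Lemma subst_biseq_near (phi : substitution A) S q :
  \forall T \near S, agree q (subst_biseq phi S) (subst_biseq phi T).
Proof. by apply: filterS (agree_near q.+1 S) => T; exact: subst_biseq_agree. Qed.

Lemma agree_continuous (h : biseq A -> biseq A) :
  (forall S q, \forall T \near S, agree q (h S) (h T)) -> continuous h.
Proof. by move=> ch S B /nbhs_biseqP[q hq]; apply: filterS (ch S q) => T /hq. Qed.

End LocallyConstant.

(** * Primitivity, reduction to edge functions, and self-correction *)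

Section MixedDynamics.
Variables (A : finType) (k : nat) (F : 'I_k.+1 -> substitution A) (s : nat -> 'I_k.+1).
Implicit Types S T : biseq A.

Definition Adm i : set (biseq A) := admissible_space F (seq_shift i s).

Lemma Adm_closed i : closed (Adm i).
Proof.
move=> S clS x m.
have /clS[T [TA hT]] := agree_near (absz x + m)%N S.
have [n [a h]] := TA x m; exists n, a; congr (infix _ _): h.
by apply/eq_in_map => j; rewrite mem_iota => jm; apply: hT; lia.
Qed.

Lemma Adm_compact i : compact (Adm i).
Proof. exact: subclosed_compact (@Adm_closed i) (@biseq_compact A) _. Qed.

Lemma Adm_bishift i n S : Adm i S -> Adm i (bishift n S).
Proof. exact: admissible_bishift. Qed.

Lemma id_subst_nonempty (a : A) : [:: a] != [::].
Proof. by []. Qed.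
Definition id_subst := Substitution id_subst_nonempty.

Lemma subst_word_id w : subst_word id_subst w = w.
Proof. by elim: w => //= a w; rewrite /subst_word /= => ->. Qed.

Lemma subst_biseq_id S : subst_biseq id_subst S = S.
Proof.
apply/funext => i; pose a := absz i; pose j := absz (i + a%:Z).
have e := @subst_biseqE A id_subst S (S 0) a (a + a).+1 j.
rewrite !subst_word_id !size_biword in e.
have -> : i = j%:Z - a%:Z by rewrite /j /a; lia.
rewrite e ?nth_biword; rewrite ?/j ?/a; try lia.
by congr (S _); lia.
Qed.

Lemma pull_id f S : pull id_subst f S = f S.
Proof. by rewrite /pull bsum1 subst_biseq_id. Qed.

(** [n] counts the factors, so that [Phi i 0] is the identity, whereas the bounds of [phi_seg] are
    inclusive; hence the [n.+1] in [Phi_seg]. *)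
Fixpoint Phi i n : substitution A :=
  if n is n'.+1 then comp_subst (Phi i n') (F (s (i + n'))) else id_subst.

Lemma Phi_seg i n a : phi_seg F s i (i + n)%N a = Phi i n.+1 a.
Proof.
rewrite /phi_seg /index_iota; have -> : ((i + n).+1 - i = n.+1)%N by lia.
rewrite -[RHS](subst_word1 (Phi i n.+1)).
move: [:: a] => w; elim: (n.+1) w => [|m IH] w; first by rewrite subst_word_id.
by rewrite -addn1 iotaD foldr_cat /= IH addn1 /= subst_word_comp.
Qed.

Lemma PhiD i n m w :
  subst_word (Phi i (n + m)) w = subst_word (Phi i n) (subst_word (Phi (i + n) m) w).
Proof.
elim: m w => [|m IH] w; first by rewrite addn0 subst_word_id.
by rewrite addnS /= !subst_word_comp IH addnA.
Qed.

Lemma Adm_Phi i n S : Adm (i + n) S -> Adm i (subst_biseq (Phi i n) S).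
Proof.
elim: n S => [|n IH] S; first by rewrite subst_biseq_id addn0.
rewrite addnS => AS; rewrite /= subst_biseq_comp; apply: IH.
exact: admissible_subst AS.
Qed.

Lemma size_subst_word_ge (phi : substitution A) q w :
  (forall a, q <= size (phi a))%N -> (q * size w <= size (subst_word phi w))%N.
Proof.
move=> h; elim: w => [|a w IH]; first by rewrite muln0.
rewrite -[a :: w]/([:: a] ++ w) subst_word_cat subst_word1 !size_cat mulnDr.
by apply: leq_add => //; rewrite muln1.
Qed.

Hypothesis prim : primitive_system F s.

Lemma primitive_letters i : exists n, forall a b, a \in Phi i n b.
Proof.
have [l _ h] := prim i; exists l.+1 => a b.
have := h (enum_rank a) (enum_rank b).
by rewrite mxE !enum_rankK Phi_seg -has_count has_pred1.
Qed.

(** After a primitive block every image contains every letter, hence at least two letters, so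
    composing with such a block at least doubles the bound [q]. Doubling does not help when [q] is
    0, where nonemptiness is enough. *)
Lemma size_Phi_growth i q : (1 < #|A|)%N -> exists n, forall a, (q <= size (Phi i n a))%N.
Proof.
move=> A1; elim: q => [|q [n hn]]; first by exists 0%N.
have [l hl] := primitive_letters (i + n); exists (n + l)%N => a.
have h2 : (1 < size (Phi (i + n) l a))%N.
  apply: leq_trans A1 _; rewrite cardE; apply: uniq_leq_size; first exact: enum_uniq.
  by move=> b _; exact: hl.
rewrite -subst_word1 PhiD subst_word1.
have [->|q0] := posnP q.
  by apply: leq_trans (size_subst_word _ _); exact: ltnW.
by apply: leq_trans (size_subst_word_ge _ hn); nia.
Qed.

(** Over a one-letter alphabet images need not grow, but there [biseq A] has at most one point and
    the window 0 works with no substitution at all. *)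
Lemma window_growth i f : loc_const (Adm i) f -> exists q n,
  (forall S T, Adm i S -> Adm i T -> agree q S T -> f T = f S) /\
  forall a, (q + q < size (Phi i n a))%N.
Proof.
move=> lf; have [A1|A1] := ltnP 1 #|A|.
  have [q hq] := loc_const_window (@Adm_compact i) lf.
  by have [n hn] := size_Phi_growth i (q + q).+1 A1; exists q, n.
exists 0%N, 0%N; split=> // S T _ _ _; congr f; apply/funext => x.
by apply/(card_le1_eqP A1).
Qed.

Lemma subst_biseq_prefix (phi : substitution A) S T n :
  biword S 0 n = biword T 0 n ->
  forall j, (j < size (subst_word phi (biword S 0 n)))%N ->
  subst_biseq phi S j%:Z = subst_biseq phi T j%:Z.
Proof.
move=> e j jn; have jn' := jn; rewrite e in jn'.
have eS := biword_subst_biseq0 phi S n; have eT := biword_subst_biseq0 phi T n.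
have := nth_biword (S 0) (subst_biseq phi S) 0 jn.
have := nth_biword (S 0) (subst_biseq phi T) 0 jn'.
by rewrite eS eT e !add0r => -> ->.
Qed.

(* Once the images of letters are longer than the window of f, the value of f at a
   position of Phi(T) only depends on the two supertiles meeting the window. *)
Lemma eventually_edge f : loc_const (Adm 0) f -> exists n c u,
  loc_const (Adm n) u /\
  forall T, Adm n T -> pull (Phi 0 n) f T = edge_fun c T + (u (bishift 1 T) - u T).
Proof.
move=> lf; have [q [n [hq hn]]] := window_growth lf.
set phi := Phi 0 n.
(* Recentring moves the window from [-q, q] to [0, 2q]: placed at a position of phi(T_0), it then
   meets only phi(T_0) and phi(T_1). The difference of [f'] and [f] telescopes to the coboundary of
   the Birkhoff sum of length [q], which supplies [u]. *)
pose f' S := f (bishift q S).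
have key S T : Adm n S -> Adm n T -> S 0 = T 0 -> S 1 = T 1 ->
    pull phi f' T = pull phi f' S.
  move=> AS AT e0 e1; rewrite /pull -e0; apply: eq_bigr => j _; apply: hq.
  - by do 2 apply: Adm_bishift; apply: Adm_Phi.
  - by do 2 apply: Adm_bishift; apply: Adm_Phi.
  move=> x xq; rewrite /bishift.
  pose r := absz (x + q%:Z + j%:Z).
  have ex : x + q%:Z + j%:Z = r%:Z by rewrite /r; lia.
  rewrite ex; symmetry; apply: (@subst_biseq_prefix _ _ _ 2).
    by rewrite /biword /mkseq /= !add0r e0 e1.
  rewrite -[2%N]/(1 + 1)%N biword_cat !biword1 subst_word_cat !subst_word1 size_cat.
  have h1 : (j < size (phi (S 0)))%N := ltn_ord j.
  have h2 : (q + q < size (phi (S (0 + 1%N%:Z)%R)))%N := hn _.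
  have aux (m x1 x2 : nat) (y : int) : (m < x1)%N -> (q + q < x2)%N ->
      (absz y <= q)%N -> (absz (y + q%:Z + m%:Z)%R < x1 + x2)%N by lia.
  exact: aux h1 h2 xq.
have /choice[c hc] : forall ab : A * A, exists z : int, forall T, Adm n T -> T 0 = ab.1 ->
    T 1 = ab.2 -> pull phi f' T = z.
  move=> [a b] /=; have [[S [AS [Sa Sb]]]|nS] := pselect (exists S, Adm n S /\ S 0 = a /\ S 1 = b).
    by exists (pull phi f' S) => T AT Ta Tb; apply: key; rewrite ?Ta ?Tb.
  by exists 0 => T AT Ta Tb; case: nS; exists T.
exists n, (fun a b => c (a, b)), (fun T => - bsum f q (subst_biseq phi T)); split.
  apply: loc_constN; apply: (@loc_const_comp _ _ (Adm 0) (subst_biseq phi)).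
  - by move=> S AS; exact: Adm_Phi.
  - by move=> S r; exact: subst_biseq_near.
  - by apply: loc_const_bsum => // m S; exact: Adm_bishift.
have ef : f = fun S => f' S - (bsum f q (bishift 1 S) - bsum f q S).
  apply/funext => S; have := bsumD f 1 q S; rewrite addnC bsumD !bsum1 /f' => h.
  by rewrite opprB addrC addrAC h addrK.
move=> T AT; rewrite /edge_fun -(hc (T 0, T 1) T)// {1}ef pullB pull_cob.
by rewrite opprK [- _ + _]addrC opprB.
Qed.

(** An identity about words, read off at the origin of some sequence with letters [a], [b] at
    positions 0 and 1, where it becomes [pull_comp]. *)
Lemma pull_edge_comp (phi psi : substitution A) c a b :
  pull_edge (comp_subst phi psi) c a b = pull_edge psi (pull_edge phi c) a b.
Proof.
pose T : biseq A := fun i => if i == 0 then a else b.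
rewrite -[LHS]/(edge_fun (pull_edge (comp_subst phi psi) c) T).
rewrite -pull_edge_fun pull_comp.
transitivity (pull psi (edge_fun (pull_edge phi c)) T); last exact: pull_edge_fun.
by congr bsum; apply/funext => S; exact: pull_edge_fun.
Qed.

Lemma pull_edge_id (c : A -> A -> int) a b : pull_edge id_subst c a b = c a b.
Proof. by rewrite /pull_edge /= addr0. Qed.

Lemma psum_cob (c : A -> A -> int) v x w :
  path (fun a b => c a b == v b - v a) x w -> psum c x w = v (last x w) - v x.
Proof.
elim: w x => [|y w IH] x /=; first by rewrite subrr.
by move=> /andP[/eqP -> /IH ->]; rewrite addrC addrA subrK.
Qed.

Lemma pull_edge_cob (phi : substitution A) (v : A -> int) a b :
  pull_edge phi (fun a b => v b - v a) a b = v (head b (phi b)) - v (head a (phi a)).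
Proof.
rewrite /pull_edge (@psum_cob _ v) ?last_rcons//.
by move: (rcons _ _) (head a _) => w; elim: w => //= y w IH x; rewrite eqxx IH.
Qed.

Lemma path_biword (e : rel A) (S : biseq A) n :
  (forall i, e (S i) (S (i + 1))) -> forall i, path e (S i) (biword S (i + 1) n).
Proof.
move=> h; elim: n => [//|n IH] i.
by rewrite -add1n biword_cat biword1 /= h IH.
Qed.

Hypothesis sc : self_correcting F s.

(** Self-correction supplies some admissible sequence at a deeper level; by primitivity the image of
    its letter at the origin contains every letter. *)
Lemma Adm_letter i a : exists2 T, Adm i T & T 0 = a.
Proof.
have [n hn] := primitive_letters i.
have [N _ h] := sc (i + n); have [S AS _] := h a a.
have AP := Adm_Phi AS; set P := subst_biseq _ _ in AP.
have /(nthP (S 0 : A))[j jn <-] := hn a (S 0).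
exists (bishift j P); first exact: Adm_bishift.
by rewrite /bishift add0r /P (subst_biseq_letter (S 0)).
Qed.

(* u only depends on the letter at the origin of the desubstituted sequence, which
   gives v on admissible pairs; self-correction makes every pair admissible after
   finitely many further substitutions. *)
Lemma edge_cob_eventually i c u : loc_const (Adm i) u ->
  (forall T, Adm i T -> edge_fun c T = u (bishift 1 T) - u T) ->
  exists n v, forall a b, pull_edge (Phi i n) c a b = v b - v a.
Proof.
move=> lu hc; have [q [n [hq hn]]] := window_growth lu.
have [v hv] : exists v : A -> int, forall T, Adm (i + n) T ->
    u (subst_biseq (Phi i n) T) = v (T 0).
  suff /choice[v hv] : forall a, exists z, forall T, Adm (i + n) T -> T 0 = a ->
      u (subst_biseq (Phi i n) T) = z by exists v => T /hv; exact.
  move=> a; have [S AS Sa] := Adm_letter (i + n) a.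
  exists (u (subst_biseq (Phi i n) S)) => T AT Ta.
  have [AP AQ] := (Adm_Phi AS, Adm_Phi AT).
  set P := subst_biseq _ S in AP *; set Q := subst_biseq _ T in AQ *.
  (* Both sequences start with the image of [a], so they agree on [0, 2q]. The values of [u] are
     compared after a shift by [q], which brings its window into that range, and carried back to the
     origin by the Birkhoff sum of [c], which only sees positions 0 to [q]. *)
  have PQ (j : nat) : (j <= q + q)%N -> Q j = P j.
    move=> jq; symmetry; apply: (@subst_biseq_prefix _ _ _ 1).
      by rewrite !biword1 Sa Ta.
    by rewrite biword1 subst_word1; exact: leq_ltn_trans (hn _).
  have cobE m R : Adm i R -> bsum (edge_fun c) m R = u (bishift m R) - u R.
    move=> AR; rewrite -bsum_cob; apply: eq_bigr => j _; apply: hc.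
    exact: Adm_bishift.
  have := cobE q P AP; have := cobE q Q AQ.
  have -> : bsum (edge_fun c) q Q = bsum (edge_fun c) q P.
    rewrite !bsum_edge (PQ 0%N)//; congr psum; apply/eq_in_map => j.
    by rewrite mem_iota => jq; rewrite -PoszD; apply: PQ; lia.
  have -> : u (bishift q Q) = u (bishift q P).
    apply: hq; [exact: Adm_bishift|exact: Adm_bishift|move=> x xq].
    have ex : x + q%:Z = (absz (x + q%:Z)%R)%:Z by lia.
    by rewrite /bishift ex; apply: PQ; lia.
  by move=> -> /eqP; rewrite (inj_eq (addrI _)) eqr_opp => /eqP.
set c' := pull_edge (Phi i n) c.
have hc' T : Adm (i + n) T -> c' (T 0) (T 1) = v (T 1) - v (T 0).
  move=> AT; rewrite -[c' _ _]/(edge_fun c' T) -pull_edge_fun.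
  have -> : v (T 1) = v (bishift 1 T 0) by rewrite /bishift add0r.
  rewrite -!hv//; last exact: Adm_bishift.
  rewrite -pull_cob; apply: eq_bigr => j _; apply: hc; apply: Adm_bishift.
  exact: Adm_Phi.
have hc2 ab : two_letter_words F (seq_shift (i + n) s) ab ->
    c' ab.1 ab.2 = v ab.2 - v ab.1.
  move=> [T AT [x [<- <-]]]; have := hc' _ (Adm_bishift x AT).
  by rewrite /bishift !add0r [1 + x]addrC.
have [N _ hN] := sc (i + n).
set psi := Phi (i + n) N.+1.
(* The transitions inside psi(a) are admissible because [a] occurs in an admissible sequence, and
   the one from psi(a) to psi(b) is admissible by self-correction. Along all of them [c'] is the
   increment of [v], so the sum telescopes from the first letter of psi(a) to that of psi(b). *)
exists (n + N.+1)%N, (fun a => v (head a (psi a))) => a b.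
have -> : pull_edge (Phi i (n + N.+1)) c a b = pull_edge psi c' a b.
  rewrite -pull_edge_comp.
  have e x : Phi i (n + N.+1) x = comp_subst (Phi i n) psi x.
    by rewrite -[LHS]subst_word1 PhiD subst_word1.
  by rewrite /pull_edge !e.
rewrite /pull_edge (@psum_cob _ v) ?last_rcons// rcons_path; apply/andP; split.
  have [T AT Ta] := Adm_letter (i + n + N.+1) a.
  have AP := Adm_Phi AT.
  have := @path_biword (fun a b => c' a b == v b - v a) _ (size (psi a)).-1 _ 0.
  move=> /(_ (subst_biseq psi T)); rewrite (subst_biseq_letter a) ?size_subst_gt0// nth0 Ta.
  have := biword_subst_letter psi T; rewrite Ta.
  case: (psi a) (size_subst_gt0 psi a) => // x w _ e; rewrite /= add0r => h.
  have e2 : biword (subst_biseq psi T) 1 (size w) = w.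
    by move: e; rewrite /= -add1n biword_cat biword1 => -[].
  rewrite -[X in path _ _ X]e2; apply: h => j; apply/eqP.
  have := hc2 (subst_biseq psi T j, subst_biseq psi T (j + 1)); apply.
  by exists (subst_biseq psi T) => //; exists j.
have := hc2 _ (hN a b); rewrite !Phi_seg -/psi /fst /snd => h.
by move: h; case: (psi a) (size_subst_gt0 psi a) => //= x w _ ->.
Qed.

End MixedDynamics.

(** * Desubstitution, and bijectivity of the pullback modulo coboundaries *)

Section Desubstitution.
Variables (A : finType) (k : nat) (F : 'I_k.+1 -> substitution A) (s : nat -> 'I_k.+1).
Implicit Types S T : biseq A.
Local Notation Adm := (Adm F s).

Lemma prefix_position (phi : substitution A) v J : (J < size (subst_word phi v))%N ->
  exists t j d, [/\ (t < size v)%N, (j < size (phi (nth d v t)))%N &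
    J = (size (subst_word phi (take t v)) + j)%N].
Proof.
elim: v J => [//|a v IH] J; rewrite -[a :: v]/([:: a] ++ v) subst_word_cat subst_word1 size_cat.
have [Ja|aJ] := ltnP J (size (phi a)); first by exists 0%N, J, a.
move=> h; have [|t [j [d [tv jt e]]]] := IH (J - size (phi a))%N; first by lia.
exists t.+1, j, d; split => //.
rewrite /= -[a :: take t v]/([:: a] ++ take t v) subst_word_cat subst_word1 size_cat.
by rewrite -addnA -e; lia.
Qed.

Lemma subst_size_bound : exists L, forall i a, (size (F i a) <= L)%N.
Proof.
exists (\max_(p : 'I_k.+1 * A) size (F p.1 p.2)) => i a.
by rewrite (leq_bigmax (i, a)).
Qed.

Lemma size_subst_word_le (phi : substitution A) L w :
  (forall a, size (phi a) <= L)%N -> (size (subst_word phi w) <= L * size w)%N.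
Proof.
move=> h; elim: w => [|a w IH]; first by rewrite muln0.
rewrite -[a :: w]/([:: a] ++ w) subst_word_cat subst_word1 !size_cat mulnDr.
by apply: leq_add => //; rewrite muln1.
Qed.

(** A long central word of [S] lies in some phi(v); the origin falls at offset [j] in the image of
    the [t]-th letter of [v], and [T] is [v] recentred at that letter. *)
Lemma approx_desubst i S R : Adm i S -> exists T j,
  [/\ (j < size (F (s i) (T 0%R)))%N,
      agree R S (bishift j%:Z (subst_biseq (F (s i)) T)) &
      exists n a, infix (biword T (- R%:Z) (R + R).+1)
                        (phi_seg F (seq_shift i.+1 s) 0 n a)].
Proof.
move=> AS; set phi := F (s i).
have [L hL'] := subst_size_bound; have hL : forall a, (size (phi a) <= L)%N by move=> a; exact: hL'.
(* Each letter of [v] accounts for at most [L] letters of the image, so a central word of radius [m]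
   forces [v] to extend more than [R] letters to either side of the letter over the origin. The
   summand [R] gives [R <= m]. *)
pose m := (L * R.+2 + R)%N.
have Rm : (R <= m)%N by exact: leq_addl.
have [n [a]] := AS (- m%:Z) (m + m).+1.
have L0 : (0 < L)%N by apply: leq_trans (hL a); rewrite size_subst_gt0.
(* With a single substitution the word would lie in the image of one letter, of length at most [L],
   which is too short for [m + m + 1] letters. *)
case: n => [|n].
  rewrite /phi_seg /index_iota /= subst_word1 => /size_infix.
  rewrite size_biword => h; exfalso.
  have hh := leq_trans h (hL' (seq_shift i s 0) a).
  have := leq_pmulr L (ltn0Sn R.+1); move: hh; rewrite /m; lia.
rewrite phi_seg_shift -/phi; set v := phi_seg _ _ _ _ _ => /infixP[p [r hv]].
have szv : size (subst_word phi v) = (size p + (m + m).+1 + size r)%N.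
  by rewrite hv !size_cat size_biword addnA.
have [|t [j [d [tv jt e]]]] := @prefix_position phi v (size p + m)%N; first by lia.
(* The letters to the left of position -t and beyond the end of [v] are an arbitrary filling; the
   window used below is exactly [v]. *)
pose T : biseq A := fun x => nth d v (absz (x + t%:Z)).
have T0 : T 0 = nth d v t by rewrite /T add0r.
have eT (x n' : nat) : (x + n' <= size v)%N ->
    biword T (x%:Z - t%:Z) n' = take n' (drop x v).
  move=> xn; apply: (@eq_from_nth _ d); rewrite size_biword ?size_takel ?size_drop//; first by lia.
  move=> y yn; rewrite nth_biword// nth_take// nth_drop /T.
  by congr nth; lia.
have eTt : biword T (- t%:Z) t = take t v.
  by have := eT 0%N t; rewrite drop0 sub0r; apply; lia.
have eTv : biword T (- t%:Z) (size v) = v.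
  by have := eT 0%N (size v); rewrite drop0 sub0r take_size; apply.
have s1 := size_subst_word_le (take t v) hL.
have s2 := size_subst_word_le (drop t v) hL.
have s3 : size (subst_word phi v) =
    (size (subst_word phi (take t v)) + size (subst_word phi (drop t v)))%N.
  by rewrite -size_cat -subst_word_cat cat_take_drop.
rewrite size_takel in s1; last exact: ltnW.
rewrite size_drop in s2.
have jL := leq_trans jt (hL _).
have tR : (R < t)%N.
  by rewrite -(ltn_pmul2l L0); rewrite /m in e; nia.
have vR : (R < size v - t)%N.
  by rewrite -(ltn_pmul2l L0); rewrite /m in e szv; nia.
exists T, j; split; first by rewrite T0.
  move=> x xR; rewrite /bishift.
  pose J := absz ((size p)%:Z + m%:Z + x).
  have -> : x + j%:Z = J%:Z - (size (subst_word phi (biword T (- t%:Z) t)))%:Z.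
    by rewrite eTt /J /m; move: xR; rewrite /m in e; lia.
  rewrite (@subst_biseqE _ phi T d t (size v)); rewrite ?eTv; last 2 first.
  - exact: ltnW.
  - by rewrite szv /J; lia.
  have aux (b c : nat) : (absz x <= c)%N ->
      [/\ absz (b%:Z + c%:Z + x)%R = (b + absz (c%:Z + x)%R)%N,
          (absz (c%:Z + x)%R < (c + c).+1)%N &
          - c%:Z + (absz (c%:Z + x)%R)%:Z = x] by move=> xc; split; lia.
  have [eJ ym ex] := aux (size p) m (leq_trans xR Rm).
  rewrite hv /J eJ nth_cat ltnNge leq_addr addKn -[~~ true]/false nth_cat size_biword ym.
  by rewrite nth_biword// ex.
exists n, a; rewrite -/v.
have := eT (t - R)%N (R + R).+1; have -> : (t - R)%N%:Z - t%:Z = - R%:Z by lia.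
move=> ->; last by lia.
by apply/infixP; exists (take (t - R) v), (drop (R + R).+1 (drop (t - R) v)); rewrite !cat_take_drop.
Qed.

Lemma sub_biword_infix T (x y : int) (n m : nat) : x <= y -> y + n%:Z <= x + m%:Z ->
  infix (biword T y n) (biword T x m).
Proof.
move=> xy yx; pose a := absz (y - x); pose b := absz (x + m%:Z - y - n%:Z)%R.
have -> : m = (a + (n + b))%N by rewrite /a /b; lia.
apply/infixP; exists (biword T x a), (biword T (y + n%:Z) b).
have e : y = x + a%:Z by rewrite /a; lia.
by rewrite !biword_cat -e.
Qed.

(* Compactness turns the desubstitutions of the central words of S into one of S. *)
Lemma desubst i S : Adm i S -> exists T j,
  [/\ Adm i.+1 T, (j < size (F (s i) (T 0%R)))%N &
      S = bishift j%:Z (subst_biseq (F (s i)) T)].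
Proof.
move=> AS; set phi := F (s i).
have /choice[TT hTT] := fun R => approx_desubst R AS.
have /choice[jj hj] := hTT.
have [L hL] := subst_size_bound.
have [T _ clT] : exists2 T, [set: biseq A] T & cluster (TT @ \oo) T.
  by have [|T [_ h]] := @biseq_compact A (TT @ \oo); [exact: filterT|exists T].
have cl N : exists2 R, (N <= R)%N & agree N T (TT R).
  have : [set S | exists2 R, (N <= R)%N & S = TT R] `&` [set S | agree N T S] !=set0.
    apply: clT; last exact: agree_near.
    by exists N => // R NR; exists R.
  by move=> [_ [[R NR ->] h]]; exists R.
(* Pigeonhole: the offsets [jj R] are all below [L], so one of them recurs for arbitrarily large [R]
   along terms approaching [T]. Otherwise each offset fails beyond some threshold, and a term beyond
   the largest of these thresholds is a contradiction. *)
have [j hjj] : exists j, forall N, exists R, [/\ (N <= R)%N, agree N T (TT R) & jj R = j].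
  apply: contrapT => nj.
  have /choice[N hN] : forall j, exists N, forall R, ~ [/\ (N <= R)%N, agree N T (TT R) & jj R = j].
    move=> j; apply: contrapT => h; apply: nj; exists j => N.
    by apply: contrapT => h'; apply: h; exists N => R h2; apply: h'; exists R.
  have [R NR hR] := cl (\max_(j < L) N j).
  have [jR _ _] := hj R; have jL := leq_trans jR (hL _ _).
  apply: (hN (jj R) R); split=> //.
    by apply: leq_trans NR; apply: (leq_bigmax (Ordinal jL)).
  by apply: agreeW hR; apply: (leq_bigmax (Ordinal jL)).
exists T, j; split.
- move=> x m; have [R [NR hR ejR]] := hjj (absz x + m)%N.
  have [_ _ [n [a h]]] := hj R; exists n, a; apply: infix_trans h.
  have -> : biword T x m = biword (TT R) x m.
    by apply/eq_in_map => y; rewrite mem_iota => ym; symmetry; apply: hR; lia.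
  by apply: sub_biword_infix; lia.
- by have [R [NR hR <-]] := hjj 0%N; have [+ _ _] := hj R; rewrite hR.
- apply/funext => y; have [R [NR hR ejR]] := hjj (absz y + j).+1.
  have [_ h _] := hj R; rewrite -h; last by lia.
  by rewrite /bishift ejR (subst_biseq_agree phi hR)//; lia.
Qed.

(** This stands in for the continuity of desubstitution: functions at level i will be prescribed by
    the supertile [T] and the offset [j] in it. *)
Lemma subst_orbit_loc_const i (G : nat -> biseq A -> int) g :
  (forall j, loc_const (Adm i.+1) (G j)) ->
  (forall T j, Adm i.+1 T -> (j < size (F (s i) (T 0%R)))%N ->
    g (bishift j%:Z (subst_biseq (F (s i)) T)) = G j T) ->
  loc_const (Adm i) g.
Proof.
move=> lG gG S AS; set n := g S; set phi := F (s i) in gG *.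
have [L hL] := subst_size_bound.
pose K j := [set T | [/\ Adm i.+1 T, (j < size (phi (T 0%R)))%N & G j T <> n]].
(* The points of Adm i where g differs from g S lie in the sets h j @` K j: finitely
   many compact sets missing S. *)
pose h j T := bishift j%:Z (subst_biseq phi T).
have Kclosed j : closed (K j).
  move=> T clT; have AT : Adm i.+1 T.
    by apply: Adm_closed => B /clT[T' [[A' _ _] BT']]; exists T'.
  have [T' [[AT' jT' GT'] [T0 GT]]] :
      K j `&` [set T' | T' 0 = T 0 :> A /\ (Adm i.+1 T' -> G j T' = G j T)] !=set0.
    by apply: clT; apply: filterI; [exact: coord_near|exact: lG].
  by split=> //; [rewrite -T0|rewrite -GT].
have hK j : closed (h j @` K j).
  apply: (compact_closed (@biseq_hausdorff A)).
  apply: continuous_compact.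
    apply: continuous_subspaceT; apply: agree_continuous => T q.
    apply: filterS (agree_near (q + j).+1 T) => T' /subst_biseq_agree hT x xq.
    by rewrite /h /bishift hT//; lia.
  exact: subclosed_compact (Kclosed j) (@biseq_compact A) _.
have : \forall T \near S, forall j, (j < L)%N -> ~ (h j @` K j) T.
  have aux (M : nat) : \forall T \near S, forall j, (j < M)%N -> ~ (h j @` K j) T.
    elim: M => [|M IH]; first exact: filterE.
    have oK : open (~` (h M @` K M)) by rewrite openC.
    have : nbhs S (~` (h M @` K M)).
      apply: open_nbhs_nbhs; split=> // -[T [AT jT GT] hT]; apply: GT.
      by rewrite -gG// -/(h M T) hT.
    apply: filterS2 IH => T h1 h2 j; rewrite ltnS leq_eqVlt => /orP[/eqP->//|].
    exact: h1.
  exact: aux.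
apply: filterS => T hT AT; have [T' [j [AT' jT' eT]]] := desubst AT.
apply: contrapT => gT; apply: (hT j); first exact: leq_trans jT' (hL _ _).
by exists T' => //; split=> //; rewrite -gG// -eT.
Qed.

Hypothesis rec : forall i T T' j j', Adm i.+1 T -> Adm i.+1 T' ->
  (j < size (F (s i) (T 0%R)))%N -> (j' < size (F (s i) (T' 0%R)))%N ->
  bishift j%:Z (subst_biseq (F (s i)) T) = bishift j'%:Z (subst_biseq (F (s i)) T') ->
  T = T' /\ j = j'.

(** By recognisability a sequence determines the pair (T, j), so the prescription is consistent;
    sequences without such a pair get the value 0. *)
Lemma rec_function i (G : nat -> biseq A -> int) : exists g : biseq A -> int,
  forall T j, Adm i.+1 T -> (j < size (F (s i) (T 0%R)))%N ->
    g (bishift j%:Z (subst_biseq (F (s i)) T)) = G j T.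
Proof.
suff /choice[g hg] : forall S, exists z, forall T j, Adm i.+1 T ->
    (j < size (F (s i) (T 0%R)))%N ->
    bishift j%:Z (subst_biseq (F (s i)) T) = S -> G j T = z.
  by exists g => T j AT jT; rewrite -(hg _ T j AT jT erefl).
move=> S; have [[T [j [AT jT e]]]|nS] := pselect (exists T j,
    [/\ Adm i.+1 T, (j < size (F (s i) (T 0%R)))%N &
       bishift j%:Z (subst_biseq (F (s i)) T) = S]).
  exists (G j T) => T' j' AT' jT' e'.
  by have [-> ->] := rec AT' AT jT' jT (etrans e' (esym e)).
by exists 0 => T j AT jT e; case: nS; exists T, j.
Qed.

(** The whole weight [f1 T] is put on the first letter of phi(T_0), and 0 on the others. *)
Lemma pull_surj i f1 : loc_const (Adm i.+1) f1 -> exists2 f0, loc_const (Adm i) f0 &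
  forall T, Adm i.+1 T -> pull (F (s i)) f0 T = f1 T.
Proof.
move=> lf; pose G j T := if j == 0%N then f1 T else 0.
have [g hg] := rec_function i G; exists g.
  apply: subst_orbit_loc_const hg => -[|j] //; exact: loc_const_cst.
move=> T AT; rewrite /pull /bsum (bigD1 (Ordinal (size_subst_gt0 (F (s i)) (T 0))))//=.
rewrite (hg T 0%N)// ?size_subst_gt0// big1 ?addr0// => j j0.
rewrite hg// /G ifF//; apply/negbTE; apply: contra j0 => /eqP j0.
by apply/eqP/val_inj.
Qed.

(** The primitive starts at [u1 T] on the first letter of phi(T_0) and grows by the partial sums of
    [f0]. On leaving the last letter it must reach [u1 (bishift 1 T)], the starting value of the
    next supertile, and that is the hypothesis on [pull]. *)
Lemma pull_inj i f0 u1 : loc_const (Adm i) f0 -> loc_const (Adm i.+1) u1 ->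
  (forall T, Adm i.+1 T -> pull (F (s i)) f0 T = u1 (bishift 1 T) - u1 T) ->
  exists2 u0, loc_const (Adm i) u0 &
    forall T, Adm i T -> f0 T = u0 (bishift 1 T) - u0 T.
Proof.
move=> lf lu hu; pose phi := F (s i).
pose G j T := u1 T + bsum f0 j (subst_biseq phi T).
have [g hg] := rec_function i G; exists g.
  apply: subst_orbit_loc_const hg => j; apply: loc_constD => //.
  apply: (@loc_const_comp _ _ (Adm i) (subst_biseq phi)).
  - by move=> S; exact: admissible_subst.
  - exact: subst_biseq_near.
  - by apply: loc_const_bsum => // m S; exact: Adm_bishift.
move=> S AS; have [T [j [AT jT ->]]] := desubst AS.
rewrite (hg T j)// bishiftD; have -> : 1 + j%:Z = j.+1%:Z by lia.
have e : bsum f0 j.+1 (subst_biseq phi T) = bsum f0 j (subst_biseq phi T) +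
    f0 (bishift j%:Z (subst_biseq phi T)) by rewrite -addn1 bsumD bsum1.
suff -> : g (bishift j.+1%:Z (subst_biseq (F (s i)) T)) = G j.+1 T.
  by rewrite /G e; ring.
move: jT; rewrite leq_eqVlt => /orP[/eqP jT|]; last exact: hg.
have AT1 := Adm_bishift 1 AT.
rewrite jT subst_biseq_bishift1 -[X in g X]bishift0 (hg _ 0%N)// ?size_subst_gt0//.
rewrite /G bsum0 addr0 -/phi.
by have := hu T AT; rewrite /pull -/phi => ->; rewrite addrC subrK.
Qed.

Lemma pull_Phi_surj n f1 : loc_const (Adm n) f1 -> exists2 f0, loc_const (Adm 0) f0 &
  forall T, Adm n T -> pull (Phi F s 0 n) f0 T = f1 T.
Proof.
elim: n f1 => [|n IH] f1 l1; first by exists f1 => // T _; rewrite pull_id.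
have [f2 l2 h2] := pull_surj l1; have [f0 l0 h0] := IH f2 l2.
exists f0 => // T AT; rewrite /= add0n pull_comp -h2//.
apply: eq_bigr => j _; apply: h0; apply: Adm_bishift.
exact: admissible_subst AT.
Qed.

Lemma pull_Phi_inj n f0 u1 : loc_const (Adm 0) f0 -> loc_const (Adm n) u1 ->
  (forall T, Adm n T -> pull (Phi F s 0 n) f0 T = u1 (bishift 1 T) - u1 T) ->
  exists2 u0, loc_const (Adm 0) u0 &
    forall T, Adm 0 T -> f0 T = u0 (bishift 1 T) - u0 T.
Proof.
move=> l0; elim: n u1 => [|n IH] u1 lu1 h.
  by exists u1 => // T AT; rewrite -h// pull_id.
have la : loc_const (Adm n) (pull (Phi F s 0 n) f0).
  move=> S AS; pose g := bsum f0 (size (Phi F s 0 n (S 0))).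
  have lg : loc_const (Adm 0) g.
    by apply: loc_const_bsum l0 => m T; exact: Adm_bishift.
  have lh := loc_const_comp (fun T => @Adm_Phi _ _ F s 0 n T)
    (fun T q => subst_biseq_near (Phi F s 0 n) T q) lg.
  apply: filterS2 (coord_near S 0) (lh S AS) => T T0 h1 AT.
  by rewrite /pull T0; exact: h1.
have hb T : Adm n.+1 T -> pull (F (s n)) (pull (Phi F s 0 n) f0) T = u1 (bishift 1 T) - u1 T.
  by move=> AT; rewrite -pull_comp -(h T AT).
by have [u0 lu0 hu0] := pull_inj la lu1 hb; exact: IH lu0 hu0.
Qed.

End Desubstitution.

(** * Local cocycles and Cech classes of the tiling space *)

Section LocalCocycles.
Variable R : realType.

(** Connectedness of the line. It takes the place of subdividing paths and homotopies into small
    pieces. *)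
Lemma real_clopen (P : R -> Prop) : (forall t, \forall t' \near t, P t' <-> P t) ->
  forall a b, P a -> P b.
Proof.
move=> hP a b Pa.
have oP : open [set t | P t].
  by rewrite openE => t Pt; rewrite /interior; apply: filterS (hP t) => t' [_]; apply.
have cP : closed [set t | P t].
  rewrite -openC openE => t Pt; rewrite /interior.
  by apply: filterS (hP t) => t' [h _] /h.
have cR : connected [set: R].
  by apply/connected_intervalP.
suff h : [set t | P t] = [set: R] by rewrite -[P b]/([set t | P t] b) h.
apply: cR; first by exists a.
- by exists [set t | P t]; rewrite ?setTI.
- by exists [set t | P t]; rewrite ?setTI.
Qed.

Variable X : topologicalType.

(* Alexander-Spanier cocycles: only the values near the diagonal matter. *)
Definition local_cocycle (psi : X -> X -> int) := forall x : X, exists U : set X,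
  nbhs x U /\ forall a b c, U a -> U b -> U c -> psi a b + psi b c = psi a c.

(** A primitive of the pullback of [psi] by [g], determined up to a locally constant function. *)
Definition potential (Z : topologicalType) (psi : X -> X -> int) (g : Z -> X) (u : Z -> int) :=
  forall z, \forall z' \near z, u z' - u z = psi (g z) (g z').

(* For t close to t0, correcting by psi (G t0 z) (G t z) turns a potential along G t0
   into one along G t, and conversely. *)
Lemma homotopy_potential (Z : topologicalType) (psi : X -> X -> int) (G : R -> Z -> X) u0 :
  compact [set: Z] -> continuous (fun p : R * Z => G p.1 p.2) -> local_cocycle psi ->
  potential psi (G 0) u0 -> exists u1, potential psi (G 1) u1.
Proof.
move=> /compact_near_coveringP cZ cG lpsi pu0.
pose P t := exists u, potential psi (G t) u.
apply: (@real_clopen P _ 0 1); last by exists u0.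
move=> t0.
pose good t z := \forall z' \near z,
  psi (G t0 z) (G t0 z') + psi (G t0 z') (G t z') =
  psi (G t0 z) (G t z) + psi (G t z) (G t z').
have : \forall t \near t0, [set: Z] `<=` good t.
  apply: (cZ R (nbhs t0) good (nbhs_filter t0)) => z _; have [U [nU hU]] := lpsi (G t0 z).
  pose W := [set p : R * Z | U° (G p.1 p.2)].
  have oW : open W by apply: open_comp; [move=> p _; exact: cG|exact: open_interior].
  have nW : nbhs (t0, z) W.
    by apply: open_nbhs_nbhs; split=> //; rewrite /W /= /interior.
  have hz t z' : W (t, z') -> \forall z'' \near z', W (t, z'').
    move=> Wt; have : nbhs (t, z') W by exact: open_nbhs_nbhs.
    by move=> [[B C] /= [nB nC] BC]; apply: filterS nC => y Cy; apply: BC; split=> //; exact: nbhs_singleton.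
  have [[B C] /= [nB nC] BC] := nW.
  exists (C, B) => //= -[z' t] /= [Cz Bt].
  have W1 : W (t, z') by exact: BC.
  have W2 : W (t0, z') by apply: BC; split=> //=; exact: nbhs_singleton.
  rewrite /good; near=> z''.
  have V1 : W (t, z'') by near: z''; exact: hz.
  have V2 : W (t0, z'') by near: z''; exact: hz.
  have sub p : W p -> U (G p.1 p.2) by exact: interior_subset.
  rewrite (hU _ _ _ (sub _ W2) (sub _ V2) (sub _ V1)).
  by rewrite (hU _ _ _ (sub _ W2) (sub _ W1) (sub _ V1)).
apply: filterS => t hgood; split=> -[u hu].
  exists (fun z => u z - psi (G t0 z) (G t z)) => z.
  by apply: filterS2 (hu z) (hgood z I) => z' h1 h2; lia.
exists (fun z => u z + psi (G t0 z) (G t z)) => z.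
by apply: filterS2 (hu z) (hgood z I) => z' h1 h2; lia.
Unshelve. all: by end_near. Qed.

Lemma potential_comp (Y Z : topologicalType) psi (g : Z -> X) u (h : Y -> Z) :
  continuous h -> potential psi g u -> potential psi (g \o h) (u \o h).
Proof. by move=> ch pu y; exact: ch (pu (h y)). Qed.

Lemma potential_unique_real psi (g : R -> X) u v : potential psi g u -> potential psi g v ->
  forall a b, u b - u a = v b - v a.
Proof.
move=> pu pv a b; pose P t := u t - v t = u a - v a.
have : P b; last by rewrite /P; lia.
apply: (@real_clopen P _ a b) => // t.
by apply: filterS2 (pu t) (pv t) => t'; rewrite /P; lia.
Qed.

End LocalCocycles.

(** * From Cech cocycles to local cocycles *)

Section CechPotentials.
Variable X : topologicalType.
Implicit Types U V : open_cover X.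
Local Notation simplex U n := (@nerve_simplex X U n%N).

(* z is the coboundary of m on each point separately; m A a only makes sense for
   a in A, and is not locally constant in a. *)
Definition cover_potential U (z : cocycle (nerve U)) (m : set X -> X -> int) :=
  forall (t : simplex U 1) a, val t ord0 a -> val t ord_max a ->
    val z t = m (val t ord_max) a - m (val t ord0) a.

Lemma cover_simplex1 U A B a : U A -> U B -> A a -> B a ->
  exists t : simplex U 1, val t = (fun i : 'I_2 => nth set0 [:: A; B] i).
Proof.
move=> UA UB Aa Ba.
have h : (fun i : 'I_2 => nth set0 [:: A; B] i) \in simplex U 1.
  by apply: pair_subproof => //; exists a.
by exists (elt h).
Qed.

Lemma cover_choice U : exists kap : X -> set X, forall a, U (kap a) /\ kap a a.
Proof.
suff /choice[kap h] : forall a : X, exists A : set X, U A /\ A a by exists kap.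
move=> a.
have [A UA Aa] : (\bigcup_(A in cover_sets U) A) a by rewrite cover_full.
by exists A.
Qed.

(** The members containing a point [a] all meet there, so they span a cone with apex any chosen one
    of them, [kap a]; the primitive at [a] is the value of [z] on the edge from the apex. *)
Lemma cover_potential_exists U (z : cocycle (nerve U)) : exists m, cover_potential z m.
Proof.
have [kap hk] := cover_choice U.
pose pr A B : 'I_2 -> set X := fun i => nth set0 [:: A; B] i.
pose m A a := if pselect (pr (kap a) A \in simplex U 1) is left h
              then val z (elt h) else 0.
exists m => t a ta tb; have [Uk ka] := hk a.
have Ut i : U (val t i) by case: t {ta tb} => t /= /set_mem[].
have mE A (h : pr (kap a) A \in simplex U 1) : m A a = val z (elt h).
  rewrite /m; case: pselect => // h'; congr (val z _); exact: val_inj.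
have h0 : pr (kap a) (val t ord0) \in simplex U 1 by apply: pair_subproof => //; exists a.
have h1 : pr (kap a) (val t ord_max) \in simplex U 1 by apply: pair_subproof => //; exists a.
have ht : pr (val t ord0) (val t ord_max) \in simplex U 1.
  by apply: pair_subproof => //; exists a.
rewrite (mE _ h0) (mE _ h1) (nerve_cocycle z h0 ht h1); last by exists a.
rewrite addrC addKr; congr (val z _); apply/val_inj/funext => -[[|[|//]] i2] /=;
  by congr (val t _); exact: val_inj.
Qed.

(** The cocycle is evaluated at an arbitrary common point of the two members; the hypothesis makes
    the choice immaterial. *)
Lemma potential_cocycle U (m : set X -> X -> int) :
  (forall A B a b, U A -> U B -> A a -> B a -> A b -> B b -> m B a - m A a = m B b - m A b) ->
  exists z : cocycle (nerve U), cover_potential z m.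
Proof.
move=> hm.
have /choice[pt hpt] : forall t : simplex U 1, exists a, val t ord0 a /\ val t ord_max a.
  by move=> [t /= tP]; have [_ [a ta]] := set_mem tP; exists a; split; exact: ta.
pose c (t : simp (nerve U) 1) : int := m (val t ord_max) (pt t) - m (val t ord0) (pt t).
have hc (t : simplex U 1) a : val t ord0 a -> val t ord_max a ->
    c t = m (val t ord_max) a - m (val t ord0) a.
  move=> ta tb; have [t0 t1] := hpt t; apply: hm => //;
  by case: t {ta tb t0 t1} => t /= /set_mem[].
have cP : c \in @is_cocycle (nerve U).
  rewrite unfold_in; apply/eqP/funext => t.
  have [Ut [a ta]] : (forall i, U (val t i)) /\ \bigcap_i val t i !=set0.
    by case: t => t /= /set_mem.
  rewrite /coboundary_map !big_ord_recr big_ord0 /= add0r.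
  rewrite !(hc _ a); try exact: ta.
  rewrite expr0 expr1 expr2 mulrNN !mul1r mulN1r /=.
  set x0 := lift _ _; set x1 := lift _ _; set x2 := lift _ _; set x3 := lift _ _.
  set x4 := lift _ _; set x5 := lift _ _.
  have -> : x0 = x2 by exact: val_inj.
  have -> : x1 = x4 by exact: val_inj.
  have -> : x3 = x5 by exact: val_inj.
  by rewrite -[RHS]/(0 : int); ring.
by exists (Cocycle cP) => t a ta tb; exact: hc.
Qed.

(** On the overlap of [A] and [B] the difference of [m B] and [m A] is a constant, namely a value of
    [z], so the increment between two common points is the same for both members. *)
Lemma cover_local_cocycle U (z : cocycle (nerve U)) m : cover_potential z m ->
  exists psi, local_cocycle psi /\
    forall A a b, U A -> A a -> A b -> psi a b = m A b - m A a.
Proof.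
move=> hm.
have /choice[psi hpsi] : forall ab : X * X, exists n : int, forall A, U A -> A ab.1 ->
    A ab.2 -> n = m A ab.2 - m A ab.1.
  move=> [a b] /=; have [[A [UA [Aa Ab]]]|nA] := pselect (exists A, U A /\ A a /\ A b).
    exists (m A b - m A a) => B UB Ba Bb.
    have [t te] := cover_simplex1 UA UB Aa Ba.
    have := hm t a; have := hm t b; rewrite te /= => /(_ Ab Bb) -> /(_ Aa Ba).
    by lia.
  by exists 0 => A UA Aa Ab; case: nA; exists A.
exists (fun a b => psi (a, b)); split=> [x|A a b UA Aa Ab]; last exact: hpsi.
have [kap hk] := cover_choice U; have [Uk kx] := hk x.
exists (kap x); split; first by apply: open_nbhs_nbhs; split=> //; exact: cover_open Uk.
by move=> a b c ka kb kc; rewrite !(hpsi _ (kap x))//=; lia.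
Qed.

End CechPotentials.

Section SubtypeTopology.
Variables (T : topologicalType) (A : set T).

Lemma near_subtypeP (x : A) (P : A -> Prop) :
  (\forall y \near x, P y) <->
  \forall y \near (val x : T), forall Ay : y \in A, P (elt Ay).
Proof.
split=> h.
  have [B [[C oC <-] Cx] BP] : exists2 B, open_nbhs x B & B `<=` P.
    by have : nbhs x P by []; rewrite nbhsE.
  apply: (@filterS _ _ _ C); last by apply: open_nbhs_nbhs.
  by move=> y Cy Ay; exact: BP.
have h2 : \forall y \near x, forall Ay : val y \in A, P (elt Ay).
  exact: (@initial_continuous A T set_val x _ h).
apply: filterS h2 => y /(_ (valP y)); rewrite (_ : elt _ = y)//; exact: val_inj.
Qed.

Lemma near_val (x : A) (P : T -> Prop) :
  (\forall y \near (val x : T), P y) -> \forall y \near x, P (val y).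
Proof. by move=> h; apply/near_subtypeP; apply: filterS h. Qed.

Lemma compact_set_type : compact A -> compact [set: A].
Proof.
move=> /compact_near_coveringP/near_covering_withinP cA.
apply/compact_near_coveringP => J F P FF h.
pose Q i (y : T) := forall Ay : y \in A, P i (elt Ay).
have : \forall i \near F, A `<=` Q i.
  apply: (cA J F Q FF) => x Ax; have /= [[B C] /= [nB FC] BC] := h (elt (mem_set Ax)) I.
  move/near_subtypeP : nB => /= nB.
  exists ([set y | forall Ay : y \in A, B (elt Ay)], C) => //=.
  by move=> [y i] /= [hy Ci] Ay Ay'; apply: (BC (elt Ay', i)); split=> //=; exact: hy.
by apply: filterS => i hi [y Ay] _; exact: (hi y (set_mem Ay) Ay).
Qed.

End SubtypeTopology.

(** * The suspension and potentials on its Cantor slices *)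

Section TilingCech.
Variables (R : realType) (A : finType) (k : nat) (F : 'I_k.+1 -> substitution A).
Variable s : nat -> 'I_k.+1.
Local Notation Sigma := (admissible_space F s).
Local Notation pre := (tiling_pre F R s).
Local Notation Omega := (tiling_space F R s).
Local Notation q := (\pi_Omega : pre -> Omega).

Lemma q_continuous : continuous q.
Proof. exact: pi_continuous. Qed.

Lemma unit_interval_mem (t : R) : 0 <= t <= 1 -> t \in `[0%R : R, 1%R]%classic.
Proof. by move=> h; rewrite inE /= in_itv. Qed.

(** Retracting the line onto [0, 1] lets homotopies be parametrised by all of [R], where
    [real_clopen] applies. *)
Definition clamp01 (t : R) : R := Num.max 0 (Num.min t 1).

Lemma clamp01_mem t : clamp01 t \in `[0%R : R, 1%R]%classic.
Proof. by apply: unit_interval_mem; rewrite /clamp01 le_max lexx ge_max ler01 ge_min lexx orbT. Qed.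

Lemma clamp01_id t : 0 <= t <= 1 -> clamp01 t = t.
Proof. by move=> /andP[t0 t1]; rewrite /clamp01 (min_l t1) (max_r t0). Qed.

Lemma clamp01_continuous : continuous clamp01.
Proof.
move=> x; apply: (@continuous_max R R (cst 0) (fun y => Num.min y 1)).
  exact: cst_continuous.
apply: (@continuous_min R R id (cst 1)); last exact: cst_continuous.
exact: cvg_id.
Qed.

Definition ipt (t : R) : `[0%R : R, 1%R]%classic := elt (clamp01_mem t).

Lemma ipt_continuous : continuous ipt.
Proof. by apply: continuous_comp_initial; exact: clamp01_continuous. Qed.

Lemma ipt_val (x : `[0%R : R, 1%R]%classic) : ipt (val x) = x.
Proof.
apply: val_inj; apply: clamp01_id; case: x => t /=; by rewrite inE /= in_itv.
Qed.

Lemma pre_compact : compact [set: pre].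
Proof.
have -> : [set: pre] = [set: Sigma] `*` [set: `[0%R : R, 1%R]%classic].
  by apply/seteqP; split.
apply: compact_setX; apply: compact_set_type; last exact: segment_compact.
exact: (@Adm_compact A k F s 0).
Qed.

Lemma glue_eq (p p' : pre) : tiling_glue p p' -> q p = q p'.
Proof. by move=> h; apply/eqmodP/asboolP/rst_step. Qed.

Lemma glue_invariant (B : Type) (h : pre -> B) :
  (forall p p', tiling_glue p p' -> h p = h p') -> forall p, h (repr (q p)) = h p.
Proof.
move=> hg p; have /eqmodP/asboolP := reprK (q p).
by move: (repr (q p)) => z; elim=> [x y /hg|x|x y _ ->|x y w _ -> _ ->].
Qed.

Lemma quotient_open (D : set Omega) :
  (forall p, D (q p) -> \forall p' \near p, D (q p')) -> open D.
Proof.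
move=> h; have : open (q @^-1` D); last by [].
by rewrite openE => p /h.
Qed.

Lemma Sigma_near (T : Sigma) n : \forall T' \near T, agree n (val T) (val T').
Proof. by apply: (@near_val _ _ T (agree n (val T))); exact: agree_near. Qed.

Lemma Sigma_cont (f : biseq A -> int) (T : Sigma) : loc_const Sigma f ->
  \forall T' \near T, f (val T') = f (val T).
Proof.
move=> lf; have := lf (val T) (set_mem (valP T)).
move=> /(@near_val _ _ T); apply: filterS => T'; apply; exact: set_mem (valP T').
Qed.

(* A partition of Sigma into finitely many cylinders refines the cover on which psi
   is a coboundary. *)
Lemma cantor_potential (X : topologicalType) psi (g : Sigma -> X) :
  continuous g -> local_cocycle psi -> exists h, potential psi g h.
Proof.
move=> cg lpsi.
have /compact_near_coveringP cS : compact [set: Sigma].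
  by apply: compact_set_type; exact: (@Adm_compact A k F s 0).
pose P n (T : Sigma) := exists U : set X,
  (forall a b c, U a -> U b -> U c -> psi a b + psi b c = psi a c) /\
  forall T', agree n (val T) (val T') -> U (g T').
have [n _ hn] : \forall n \near \oo, [set: Sigma] `<=` P n.
  apply: cS => T _; have [U [nU hU]] := lpsi (g T).
  have /near_subtypeP/nbhs_biseqP[n0 hn0] : \forall T' \near T, U (g T') by exact: cg.
  have nn : \forall n \near \oo, (n0 <= n)%N by exists n0.
  near=> T' n; exists U; split => // T'' h''.
  have h1 : agree n0 (val T) (val T') by near: T'; exact: Sigma_near.
  have h2 : (n0 <= n)%N by near: n.
  have := hn0 (val T'') (agree_trans h1 (agreeW h2 h'')) (valP T'').
  by rewrite (_ : elt _ = T'')//; exact: val_inj.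
have {}hn : forall T, P n T by move=> T; exact: (hn n (leqnn n)).
pose word (T : Sigma) := biword (val T) (- n%:Z) (n + n).+1.
have word_agree T T' : word T' = word T <-> agree n (val T) (val T').
  split=> [e x xn|h].
    have := congr1 (fun v => nth (val T 0 : A) v (absz (x + n%:Z)%R)) e.
    rewrite !nth_biword; [|lia..].
    by have -> : - n%:Z + (absz (x + n%:Z)%R)%:Z = x by lia.
  by apply/eq_in_map => j; rewrite mem_iota => jn; apply: h; lia.
have /choice[H hH] : forall w : seq A, exists H : Sigma -> int, forall T T',
    word T = w -> word T' = w -> H T' - H T = psi (g T) (g T').
  move=> w; have [[S hS]|nS] := pselect (exists S : Sigma, word S = w); last first.
    by exists (fun=> 0) => T T' hT; case: nS; exists T.
  exists (fun T => psi (g S) (g T)) => T T' hT hT'; have [U [hU UT]] := hn S.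
  have US : U (g S) by exact: UT.
  have {}hT : U (g T) by apply: UT; apply/word_agree; rewrite hT.
  have {}hT' : U (g T') by apply: UT; apply/word_agree; rewrite hT'.
  by rewrite -(hU _ _ _ US hT hT') addrC addKr.
exists (fun T => H (word T) T) => T.
by apply: filterS (Sigma_near T n) => T' /word_agree eT; rewrite eT; exact: hH.
Unshelve. all: by end_near. Qed.

End TilingCech.

Section ProductContinuity.
Variables X Y Z : topologicalType.

Lemma continuous_pair (f : X -> Y) (g : X -> Z) : continuous f -> continuous g ->
  continuous (fun x => (f x, g x)).
Proof. by move=> cf cg x; apply: cvg_pair; [exact: cf|exact: cg]. Qed.

Lemma continuous_fst : continuous (@fst X Y).
Proof. by move=> [x y]; exact: cvg_fst. Qed.

Lemma continuous_snd : continuous (@snd X Y).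
Proof. by move=> [x y]; exact: cvg_snd. Qed.

Lemma continuousT_comp (f : X -> Y) (g : Y -> Z) : continuous f -> continuous g ->
  continuous (g \o f).
Proof. by move=> cf cg x; apply: continuous_comp; [exact: cf|exact: cg]. Qed.

End ProductContinuity.

(** * The jump function of a Cech class *)

Section TilingClass.
Variables (R : realType) (A : finType) (k : nat) (F : 'I_k.+1 -> substitution A).
Variable s : nat -> 'I_k.+1.
Local Notation Sigma := (admissible_space F s).
Local Notation pre := (tiling_pre F R s).
Local Notation Omega := (tiling_space F R s).
Local Notation q := (\pi_Omega : pre -> Omega).

Definition cech_class (U : open_cover Omega) (z : cocycle (nerve U)) : cech_H1 Omega :=
  @dlim_in (cech_system Omega) U (H1_class z).

(* m and the primitive u differ by a locally constant function on each member. *)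
Definition linked (U : open_cover Omega) (m : set Omega -> Omega -> int) (u : pre -> int) :=
  forall V, U V -> forall p, V (q p) ->
    \forall p' \near p, m V (q p') - m V (q p) = u p' - u p.

Definition jump (u : pre -> int) (f : biseq A -> int) :=
  forall p p', tiling_glue p p' -> f (val p.1) = u p - u p'.

Definition tiling_rel (x : cech_H1 Omega) (f : biseq A -> int) :=
  exists U (z : cocycle (nerve U)) m u,
    [/\ x = cech_class z, cover_potential z m, linked U m u & jump u f].

Lemma cech_class_exists (x : cech_H1 Omega) : exists U (z : cocycle (nerve U)), x = cech_class z.
Proof.
have [U [y ->]] := dlim_elim x; exists U, (repr y).
by rewrite /cech_class H1_reprK.
Qed.

Lemma cover_potential_pull (U V : open_cover Omega) p (hp : refining U V p)
    (z : cocycle (nerve U)) m : cover_potential z m ->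
  cover_potential (pull_cocycle (nerve_map hp) z) (fun B => m (p B)).
Proof.
move=> hm t a ta tb.
have Vt i : V (val t i) by case: t {ta tb} => t /= /set_mem[].
have h1 : val (nerve_map hp 1%N t) ord0 a by have [_] := hp _ (Vt ord0); apply.
have h2 : val (nerve_map hp 1%N t) ord_max a by have [_] := hp _ (Vt ord_max); apply.
by have := hm (nerve_map hp 1%N t) a h1 h2.
Qed.

Lemma linked_refine (U V : open_cover Omega) p m u : refining U V p ->
  linked U m u -> linked V (fun B => m (p B)) u.
Proof. by move=> hp hl B VB x Bx; have [UB sB] := hp B VB; apply: hl => //; exact: sB. Qed.

Lemma cech_class_refine (U V : open_cover Omega) (h : cover_le U V) p (hp : refining U V p)
  (z : cocycle (nerve U)) : cech_class (pull_cocycle (nerve_map hp) z) = cech_class z.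
Proof.
rewrite /cech_class -(@dlim_in_map (cech_system Omega) U V h) /=.
by rewrite (refining_mapE h hp).
Qed.

Lemma cech_classB U (z w : cocycle (nerve U)) :
  cech_class (z - w) = cech_class z - cech_class w.
Proof.
rewrite /cech_class H1_classB.
rewrite -[RHS]/(dlim_add _ (dlim_opp _)) dlim_inN dlim_inD.
by [].
Qed.

Lemma tiling_relB x f x' f' : tiling_rel x f -> tiling_rel x' f' ->
  tiling_rel (x - x') (fun T => f T - f' T).
Proof.
move=> [U [z [m [u [-> hm hl hj]]]]] [U' [z' [m' [u' [-> hm' hl' hj']]]]].
have [W [h h']] := cover_directed U U'.
have [p hp] := refining_exists h; have [p' hp'] := refining_exists h'.
rewrite -(cech_class_refine h hp) -(cech_class_refine h' hp') -cech_classB.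
have {}hm := cover_potential_pull hp hm; have {}hm' := cover_potential_pull hp' hm'.
have {}hl := linked_refine hp hl; have {}hl' := linked_refine hp' hl'.
exists W; eexists; exists (fun B a => m (p B) a - m' (p' B) a), (fun x => u x - u' x).
split; first by [].
- move=> t a ta tb; have e1 := hm t a ta tb; have e2 := hm' t a ta tb.
  rewrite -[LHS]/(val (pull_cocycle (nerve_map hp) z) t - val (pull_cocycle (nerve_map hp') z') t).
  by rewrite e1 e2; lia.
- by move=> B WB o Bo; apply: filterS2 (hl B WB o Bo) (hl' B WB o Bo) => y; lia.
- by move=> o y oy; rewrite (hj o y oy) (hj' o y oy); lia.
Qed.

Lemma linked_potential U (z : cocycle (nerve U)) m psi u : cover_potential z m ->
  (forall B a b, U B -> B a -> B b -> psi a b = m B b - m B a) ->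
  potential psi q u -> linked U m u.
Proof.
move=> hm hpsi pu B UB p Bp.
have nB : \forall p' \near p, B (q p').
  apply: (@q_continuous R A k F s p); apply: open_nbhs_nbhs; split=> //.
  exact: cover_open UB.
by apply: filterS2 nB (pu p) => p' Bp' ->; rewrite (hpsi B).
Qed.

Lemma Sigma_bishift (T : Sigma) : bishift 1 (val T) \in Sigma.
Proof. by apply/mem_set/admissible_bishift; exact: set_mem (valP T). Qed.

Definition shiftS (T : Sigma) : Sigma := elt (Sigma_bishift T).

Lemma shiftS_continuous : continuous shiftS.
Proof.
apply: continuous_comp_initial => T.
apply: (@continuous_comp Sigma (biseq A) (biseq A) set_val (bishift 1)).
  exact: initial_continuous.
by apply: agree_continuous => S n; exact: bishift_cvg.
Qed.

Lemma glueP (p p' : pre) : tiling_glue p p' <-> [/\ p = (p.1, ipt (1 : R)) & p' = (shiftS p.1, ipt (0 : R))].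
Proof.
have c0 : clamp01 (0 : R) = 0 by rewrite clamp01_id// lexx ler01.
have c1 : clamp01 (1 : R) = 1 by rewrite clamp01_id// lexx ler01.
split=> [[e1 e2 e3]|[-> ->]]; last by split=> //=.
split.
- case: p e1 {e2} => T t /= e; congr pair; apply: val_inj; rewrite /= c1; exact: e.
- case: p' e2 e3 => T t /= e2 e3; congr pair; apply: val_inj => //=; rewrite c0; exact: e3.
Qed.

Lemma slice_continuous (t : R) : continuous (fun T : Sigma => (T, ipt t) : pre).
Proof.
have ci : continuous (id : Sigma -> Sigma) by move=> T; exact: cvg_id.
have cc : continuous (cst (ipt t) : Sigma -> `[0%R : R, 1%R]%classic) by exact: cst_continuous.
exact: (continuous_pair ci cc).
Qed.

Lemma tiling_rel_total (x : cech_H1 Omega) : exists2 f, loc_const Sigma f & tiling_rel x f.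
Proof.
have [U [z ->]] := cech_class_exists x.
have [m hm] := cover_potential_exists z.
have [psi [lpsi hpsi]] := cover_local_cocycle hm.
(* The interval is contracted to its left end: at time 0 the map factors through the slice Sigma x
   {0}, where [cantor_potential] applies, and at time 1 it is [q]. *)
pose G (t : R) (p : pre) : Omega := q (p.1, ipt (clamp01 t * val p.2)).
have cG : continuous (fun p : R * pre => G p.1 p.2).
  have c1 : continuous (fun p : R * pre => p.2.1 : Sigma).
    by apply: (continuousT_comp (@continuous_snd R pre)); exact: continuous_fst.
  have c2 : continuous (fun p : R * pre => val p.2.2 : R).
    have c : continuous (fun p : R * pre => p.2.2 : `[0%R : R, 1%R]%classic).
      exact: (continuousT_comp (@continuous_snd R pre) (@continuous_snd Sigma _)).
    exact: (continuousT_comp c (@initial_continuous _ _ set_val)).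
  have c3 : continuous (fun p : R * pre => clamp01 p.1 * val p.2.2).
    move=> p; apply: cvgM; last exact: c2.
    exact: (continuousT_comp (@continuous_fst R pre) (@clamp01_continuous R)).
  have c4 := continuous_pair c1 (continuousT_comp c3 (@ipt_continuous R)).
  exact: (continuousT_comp c4 (@q_continuous R A k F s)).
have c0 : clamp01 (0 : R) = 0 by rewrite clamp01_id// lexx ler01.
have c1 : clamp01 (1 : R) = 1 by rewrite clamp01_id// lexx ler01.
have G1 : G 1 = q.
  by apply/funext => -[T t]; rewrite /G /= c1 mul1r ipt_val.
have cg t : continuous (fun T : Sigma => q (T, ipt t)).
  exact: (continuousT_comp (@slice_continuous t) (@q_continuous R A k F s)).
have [h hh] := cantor_potential (cg 0) lpsi.
have pot0 : potential psi (G 0) (fun p => h p.1).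
  have -> : G 0 = (fun T : Sigma => q (T, ipt (0 : R))) \o fst.
    by apply/funext => p; rewrite /G /= c0 mul0r.
  by apply: (potential_comp _ hh); exact: continuous_fst.
have [u] := homotopy_potential (@pre_compact R A k F s) cG lpsi pot0.
rewrite G1 => pu.
have /choice[f hf] : forall S : biseq A, exists n : int, forall T : Sigma, val T = S ->
    n = u (T, ipt (1 : R)) - u (shiftS T, ipt (0 : R)).
  move=> S; have [SS|nS] := pselect (S \in Sigma).
    exists (u (elt SS, ipt (1 : R)) - u (shiftS (elt SS), ipt (0 : R))) => T eT.
    by have -> : elt SS = T by apply: val_inj.
  by exists 0 => T eT; case: nS; rewrite -eT; exact: valP.
have glue1 T : q (T, ipt (1 : R)) = q (shiftS T, ipt (0 : R)) by apply/glue_eq/glueP.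
exists f.
  move=> S SS; pose T : Sigma := elt (mem_set SS).
  (* The restrictions of [u] to the slice at 1 and to the shifted slice at 0 are potentials along
     the same map into [Omega], because the slices are glued; so they differ by a locally constant
     function. *)
  have : \forall T' \near T, f (val T') = f (val T).
    have h1 : \forall T' \near T, u (T', ipt (1 : R)) - u (T, ipt (1 : R)) = psi (q (T, ipt (1 : R))) (q (T', ipt (1 : R))).
      exact: (potential_comp (@slice_continuous 1) pu).
    have h2 : \forall T' \near T, u (shiftS T', ipt (0 : R)) - u (shiftS T, ipt (0 : R)) =
        psi (q (shiftS T, ipt (0 : R))) (q (shiftS T', ipt (0 : R))).
      exact: (potential_comp shiftS_continuous (potential_comp (@slice_continuous 0) pu)).
    apply: filterS2 h1 h2 => T'; rewrite (hf _ T erefl) (hf _ T' erefl).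
    by rewrite !glue1; lia.
  move/near_subtypeP; apply: filterS => S' hS' SS'.
  exact: (hS' (mem_set SS')).
exists U, z, m, u; split=> //; first exact: linked_potential hm hpsi pu.
by move=> p p' /glueP[-> ->]; rewrite /= (hf _ p.1 erefl).
Qed.

End TilingClass.

(** * Jump functions modulo coboundaries classify Cech classes *)

Section TilingClassIso.
Variables (R : realType) (A : finType) (k : nat) (F : 'I_k.+1 -> substitution A).
Variable s : nat -> 'I_k.+1.
Local Notation Sigma := (admissible_space F s).
Local Notation pre := (tiling_pre F R s).
Local Notation Omega := (tiling_space F R s).
Local Notation q := (\pi_Omega : pre -> Omega).

Lemma fst_near (p : pre) (P : Sigma -> Prop) :
  (\forall T \near p.1, P T) -> \forall p' \near p, P p'.1.
Proof. by move=> h; exact: (@continuous_fst Sigma _ p _ h). Qed.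

Lemma snd_near (p : pre) (P : R -> Prop) :
  (\forall t \near (val p.2 : R), P t) -> \forall p' \near p, P (val p'.2).
Proof. by move=> /near_val h; exact: (@continuous_snd Sigma _ p _ h). Qed.

Lemma qK (x : Omega) : q (repr x) = x. Proof. exact: reprK. Qed.

(** Adding [w] to [u] cancels the jump, so the sum descends to a function [v] on [Omega]. On each
    member [V] the difference of [m V] and [v] is locally constant; on the refinement by its level
    sets, [z] is the coboundary of the levels. *)
Lemma tiling_rel_inj (x : cech_H1 Omega) f w : loc_const Sigma w ->
  (forall T, Sigma T -> f T = w (bishift 1 T) - w T) -> tiling_rel x f -> x = 0.
Proof.
move=> lw fw [U [z [m [u [-> hm hl hj]]]]].
pose u' (p : pre) := u p + w (val p.1).
pose v (x : Omega) := u' (repr x).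
have vq p : v (q p) = u' p.
  apply: glue_invariant => p1 p2 h; have := hj _ _ h.
  rewrite fw; last exact: set_mem (valP p1.1).
  by case: h => _ <- _; rewrite /u'; lia.
pose D V n : set Omega := [set x | V x /\ m V x - v x = n].
have oD V n : U V -> open (D V n).
  move=> UV; apply: quotient_open => p [Vp en].
  have nV : \forall p' \near p, V (q p').
    apply: q_continuous; apply: open_nbhs_nbhs; split=> //; exact: cover_open UV.
  near=> p'; split; first by near: p'.
  have h1 : m V (q p') - m V (q p) = u p' - u p by near: p'; exact: hl.
  have h2 : w (val p'.1) = w (val p.1).
    by near: p'; apply: (fst_near (Sigma_cont p.1 lw)).
  by rewrite -en !vq /u' h2; lia.
have oc B : [set B | exists V n, U V /\ B = D V n] B -> open B.
  by move=> [V [n [UV ->]]]; exact: oD.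
have fc : \bigcup_(B in [set B | exists V n, U V /\ B = D V n]) B = [set: Omega].
  apply/seteqP; split=> // o _.
  have [V UV Vo] : (\bigcup_(V in cover_sets U) V) o by rewrite cover_full.
  by exists (D V (m V o - v o)) => //; exists V, (m V o - v o).
pose W := OpenCover oc fc.
(* A member of [W] is a bare set and may be a level set in several ways, so one pair (V, n) is
   chosen for each. *)
have /choice[pn hpn] : forall B, exists Vn : set Omega * int, W B -> U Vn.1 /\ B = D Vn.1 Vn.2.
  move=> B; have [[V [n [UV ->]]]|nB] := pselect (W B); first by exists (V, n).
  by exists (setT, 0).
have hp : refining U W (fun B => (pn B).1).
  by move=> B WB; have [UV eB] := hpn B WB; split=> // o; rewrite {1}eB => -[].
have hUW : cover_le U W by move=> B /hp[UB sB]; exists (pn B).1.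
rewrite -(cech_class_refine hUW hp).
have {}hm := cover_potential_pull hp hm.
rewrite /cech_class.
suff -> : H1_class (pull_cocycle (nerve_map hp) z) = 0 by exact: dlim_in0.
have -> : 0 = H1_class (0 : cocycle (nerve W)) by rewrite -(subrr (0 : cocycle (nerve W))) H1_classB subrr.
apply/H1_classE; exists (fun t : simp (nerve W) 0 => (pn (val t ord0)).2).
apply/funext => t.
have [Wt [ o ot]] : (forall i, W (val t i)) /\ \bigcap_i val t i !=set0.
  by case: t => t /= /set_mem.
have hD i : m (pn (val t i)).1 o - v o = (pn (val t i)).2.
  by have [_ eB] := hpn _ (Wt i); have := ot i I; rewrite [X in X o]eB => -[].
rewrite /coboundary_map !big_ord_recr big_ord0 /= add0r expr0 expr1 mul1r mulN1r.
rewrite -[LHS]/(val (pull_cocycle (nerve_map hp) z) t - 0) subr0.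
rewrite (hm t o (ot _ I) (ot _ I)) /=.
set i0 := lift _ _; set i1 := lift _ _.
have -> : i0 = ord_max by exact: val_inj.
have -> : i1 = ord0 by exact: val_inj.
have e0 : m (pn (sval t ord0)).1 o - v o = (pn (sval t ord0)).2 := hD ord0.
have e1 : m (pn (sval t ord_max)).1 o - v o = (pn (sval t ord_max)).2 := hD ord_max.
by rewrite -e0 -e1 opprB addrA subrK.
Unshelve. all: by end_near. Qed.

(** Once [z] is a coboundary on a refinement, correcting [m] by the 0-cochain gives one function [M]
    on all of [Omega]. Its lift minus [u] is locally constant, hence constant along the interval and
    a function [w] of the sequence; as [M] has no jump, that of [u] is the coboundary of [w]. *)
Lemma tiling_rel0 f : tiling_rel (0 : cech_H1 Omega) f -> exists2 w, loc_const Sigma w &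
  forall T, Sigma T -> f T = w (bishift 1 T) - w T.
Proof.
move=> [U [z [m [u [e hm hl hj]]]]].
have [W [h [h0 eW]]] : exists W (hx : cover_le U W) (hy : cover_le (trivial_cover Omega) W),
    refining_map hx (H1_class z) = refining_map hy 0.
  by apply/(@dlim_inE (cech_system Omega)); rewrite -/(cech_class z) -e.
have [p hp] := refining_exists h.
move: eW; rewrite raddf0 (refining_mapE h hp).
have -> : 0 = H1_class (0 : cocycle (nerve W)) by rewrite -(subrr (0 : cocycle (nerve W))) H1_classB subrr.
move=> /H1_classE[f0 ef0].
have {}hm := cover_potential_pull hp hm; have {}hl := linked_refine hp hl.
pose g B : int := if pselect ((fun _ : 'I_1 => B) \in @nerve_simplex Omega W 0) is left hB
  then f0 (elt hB) else 0.
have gE B1 B2 o : W B1 -> W B2 -> B1 o -> B2 o ->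
    m (p B2) o - m (p B1) o = g B2 - g B1.
  move=> W1 W2 o1 o2; have [t et] := cover_simplex1 W1 W2 o1 o2.
  have hmt : val (pull_cocycle (nerve_map hp) z) t = m (p B2) o - m (p B1) o.
    by have := hm t o; rewrite et; apply.
  have {}ef0 : val (pull_cocycle (nerve_map hp) z) t = coboundary_map f0 t.
    by rewrite -ef0 -[RHS]/(val (pull_cocycle (nerve_map hp) z) t - 0) subr0.
  rewrite -hmt ef0.
  rewrite /coboundary_map !big_ord_recr big_ord0 /= add0r expr0 expr1 mul1r mulN1r.
  have gF B (x : simp (nerve W) 0) : W B -> B o -> (forall i, val x i = B) -> f0 x = g B.
    move=> WB Bo ex; rewrite /g; case: pselect => [hB|nB].
      by congr f0; apply/val_inj/funext => i; rewrite ex.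
    by case: nB; apply/mem_set; split=> //; exists o.
  congr (_ - _); apply: gF => // i; rewrite /= et /=; case: i => -[|//] i0 //=.
have M_exists : forall o, exists n, forall B, W B -> B o -> n = m (p B) o - g B.
  move=> o; have [B1 W1 o1] : (\bigcup_(B in cover_sets W) B) o by rewrite cover_full.
  by exists (m (p B1) o - g B1) => B2 W2 o2; have := gE _ _ _ W1 W2 o1 o2; lia.
have /choice[M hM] := M_exists.
pose d (o : pre) := M (q o) - u o.
have dnear o : \forall o' \near o, d o' = d o.
  have [B WB Bo] : (\bigcup_(B in cover_sets W) B) (q o) by rewrite cover_full.
  have nB : \forall o' \near o, B (q o').
    apply: q_continuous; apply: open_nbhs_nbhs; split=> //; exact: cover_open WB.
  apply: filterS2 nB (hl B WB o Bo) => o' Bo'; rewrite /d !(hM _ B)//; lia.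
have dcst (T : Sigma) a b : d (T, ipt a) = d (T, ipt b).
  apply: (@real_clopen R (fun t => d (T, ipt t) = d (T, ipt b)) _ b a) => // t.
  have ct : continuous (fun t : R => (T, ipt t) : pre).
    exact: (@continuous_pair R Sigma _ (cst T) (@ipt R) (fun x => @cst_continuous _ _ T x) (@ipt_continuous R)).
  have hn : \forall t' \near t, d (T, ipt t') = d (T, ipt t) := ct t _ (dnear (T, ipt t)).
  by apply: filterS hn => t' ->.
have /choice[w hw] : forall S : biseq A, exists n : int, forall T : Sigma, val T = S ->
    n = d (T, ipt (0 : R)).
  move=> S; have [SS|nS] := pselect (S \in Sigma).
    by exists (d (elt SS, ipt 0)) => T eT; have -> : elt SS = T by apply: val_inj.
  by exists 0 => T eT; case: nS; rewrite -eT; exact: valP.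
exists w.
  move=> S SS; pose T : Sigma := elt (mem_set SS).
  have : \forall T' \near T, w (val T') = w (val T).
    have hn : \forall T' \near T, d (T', ipt (0 : R)) = d (T, ipt (0 : R)).
      exact: (@slice_continuous R A k F s 0 T _ (dnear (T, ipt 0))).
    by apply: filterS hn => T'; rewrite (hw _ T erefl) (hw _ T' erefl).
  by move/near_subtypeP; apply: filterS => S' hS' SS'; exact: (hS' (mem_set SS')).
move=> S SS; pose T : Sigma := elt (mem_set SS).
have g1 : tiling_glue (T, ipt (1 : R)) (shiftS T, ipt (0 : R)) by apply/glueP.
rewrite (hw S T)// (hw _ (shiftS T))// -(dcst T 1).
have hS : f S = u (T, ipt (1 : R)) - u (shiftS T, ipt (0 : R)) := hj _ _ g1.
by rewrite hS /d (glue_eq g1); lia.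
Qed.

(** The class is carried by the passage through the glueing. [Q2] surrounds the glued slice, [Q1]
    lies after it, and before it the region is split into the level sets [Q3 n] of [f], so that the
    transition from [Q2] to each of them is a constant. *)
Lemma tiling_rel_surj f : loc_const Sigma f -> exists x : cech_H1 Omega, tiling_rel x f.
Proof.
move=> lf.
pose Q1 (p : pre) := 0 < (val p.2 : R) < 2/3.
pose Q2 (p : pre) := (val p.2 : R) < 1/3 \/ 2/3 < (val p.2 : R).
pose Q3 n (p : pre) := 1/3 < (val p.2 : R) < 1 /\ f (val p.1) = n.
pose u (p : pre) : int := if 1/2 < (val p.2 : R) then f (val p.1) else 0.
(* [u] is 0 at the left end and [f] at the right end, so it does not descend to [Omega]; resetting
   it to 0 at the right end makes it descend without changing it on [Q1] and [Q3]. *)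
pose u' (p : pre) : int := if (val p.2 : R) == 1 then 0 else u p.
have fnear (p : pre) : \forall p' \near p, f (val p'.1) = f (val p.1).
  exact: (fst_near (Sigma_cont p.1 lf)).
pose S (Q : pre -> Prop) : set Omega := [set x | Q (repr x)].
have SE Q : (forall p p', tiling_glue p p' -> Q p = Q p') -> forall p, S Q (q p) = Q p.
  by move=> hQ p; rewrite /S /=; exact: glue_invariant.
have S1 : forall p, S Q1 (q p) = Q1 p.
  apply: SE => p p' [e1 _ e0]; rewrite /Q1 e1 e0 ltxx.
  by apply/propext; split=> // /andP[_]; rewrite ltr_pdivlMr; lra.
have S2 : forall p, S Q2 (q p) = Q2 p.
  apply: SE => p p' [e1 _ e0]; rewrite /Q2 e1 e0.
  by apply/propext; split=> _; [left|right]; lra.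
have third : ((1/3 : R) < 0) = false by apply/negbTE; rewrite -leNgt; lra.
have S3 n : forall p, S (Q3 n) (q p) = Q3 n p.
  apply: SE => p p' [e1 _ e0]; rewrite /Q3 e1 e0.
  by apply/propext; split=> -[/andP[h1 h2] _]; exfalso; lra.
have u'E p : u' (repr (q p)) = u' p.
  apply: glue_invariant => p1 p2 [e1 _ e0].
  have h0 : ((0 : R) == 1) = false by rewrite eq_sym oner_eq0.
  by rewrite /u' e1 e0 eqxx h0 /u e0 ifF//; apply/negbTE; rewrite -leNgt; lra.
have lt_near (a : R) (p : pre) : val p.2 < a -> \forall p' \near p, val p'.2 < a.
  by move=> h; apply: (@snd_near p (fun t => t < a)); exact: lt_nbhsl.
have gt_near (a : R) (p : pre) : a < val p.2 -> \forall p' \near p, a < val p'.2.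
  by move=> h; apply: (@snd_near p (fun t => a < t)); exact: lt_nbhsr.
pose W0 : set (set Omega) := [set B | [\/ B = S Q1, B = S Q2 | exists n, B = S (Q3 n)]].
have oc B : W0 B -> open B.
  case=> [->|->|[n ->]]; apply: quotient_open => p.
  - rewrite S1 => /andP[h1 h2]; near=> p'; rewrite S1 /Q1; apply/andP; split; near: p'.
      exact: gt_near.
    exact: lt_near.
  - rewrite S2 => -[h|h]; near=> p'; rewrite S2; [left|right]; near: p'.
      exact: lt_near.
    exact: gt_near.
  - rewrite S3 => -[/andP[h1 h2] <-]; near=> p'; rewrite S3; split.
      by apply/andP; split; near: p'; [exact: gt_near|exact: lt_near].
    by near: p'; exact: fnear.
have fc : \bigcup_(B in W0) B = [set: Omega].
  apply/seteqP; split=> // x _; rewrite -(qK x); set p := repr x.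
  have [h1|h1] := ltP (val p.2 : R) (1/3).
    by exists (S Q2); [constructor 2|rewrite S2; left].
  have [h2|h2] := ltP (2/3 : R) (val p.2).
    by exists (S Q2); [constructor 2|rewrite S2; right].
  have [h3|h3] := ltP (val p.2 : R) (2/3).
    by exists (S Q1); [constructor 1|rewrite S1 /Q1 h3 andbT; lra].
  exists (S (Q3 (f (val p.1)))); first by constructor 3; exists (f (val p.1)).
  by rewrite S3; split=> //; lra.
pose W := OpenCover oc fc.
(* A member is given as a set without its index; among the three kinds only [S Q2] contains points
   of the glued slice, and it gets the zero function. *)
pose m (B : set Omega) (x : Omega) : int :=
  if pselect (exists p : pre, val p.2 = 0 :> R /\ B (q p)) then 0 else u' (repr x).
have m1 x : m (S Q1) x = u' (repr x).
  rewrite /m; case: pselect => // h; exfalso; case: h => p [p0]; rewrite S1 /Q1 p0 ltxx//.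
have m3 n x : m (S (Q3 n)) x = u' (repr x).
  by rewrite /m; case: pselect => // h; exfalso; case: h => p [p0]; rewrite S3 /Q3 p0 third => -[].
have m2 x : m (S Q2) x = 0.
  rewrite /m; case: pselect => // -[]; exists ((repr x).1, ipt 0).
  have e : val (ipt (0 : R)) = 0 by rewrite /= clamp01_id// lexx ler01.
  by rewrite S2 /Q2 e; split=> //; left; lra.
have u'1 p : Q1 p -> Q2 p -> u' p = 0.
  move=> /andP[h1 h2] [h|h]; last by exfalso; lra.
  by rewrite /u' /u !ifF//; apply/negbTE; [rewrite -leNgt|apply/eqP]; move: h1 h2 h; clear; lra.
have u'3 n p : Q3 n p -> Q2 p -> u' p = n.
  move=> [/andP[h1 h2] <-] [h|h]; first by exfalso; lra.
  by rewrite /u' ifF ?/u ?ifT//; [|apply/negbTE/eqP]; move: h1 h2 h; clear; lra.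
have [|z hz] := @potential_cocycle Omega W m.
  move=> B1 B2 a b; rewrite -(qK a) -(qK b).
  case=> [->|->|[n ->]] [->|->|[n' ->]]; rewrite ?S1 ?S2 ?S3 ?m1 ?m2 ?m3 ?u'E => h1 h2 h3 h4;
    rewrite ?subrr//.
  - by rewrite !u'1.
  - by rewrite !u'1.
  - by rewrite (u'3 n') // (u'3 n').
  - by rewrite (u'3 n) // (u'3 n).
exists (cech_class z), W, z, m, u; split=> //.
  move=> B [->|->|[n ->]] p; rewrite ?S1 ?S2 ?S3 => hp.
  - move/andP: hp => [h1 h2]; have h3 : (val p.2 : R) < 1 by lra.
    near=> p'; rewrite !m1 !u'E.
    have lt1 : (val p'.2 : R) < 1 by near: p'; exact: lt_near.
    by rewrite /u' !lt_eqF.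
  - suff : \forall p' \near p, u p' = u p.
      by apply: filterS => p' ->; rewrite !m2 !subrr.
    case: hp => h.
      apply: filterS (lt_near _ _ h) => p' h'.
      by rewrite /u !ifF//; apply/negbTE; rewrite -leNgt; move: h h'; clear; lra.
    apply: filterS2 (gt_near _ _ h) (fnear p) => p' h' e.
    by rewrite /u !ifT ?e//; move: h h'; clear; lra.
  - move: hp => [/andP[h1 h2] _].
    near=> p'; rewrite !m3 !u'E.
    have lt1 : (val p'.2 : R) < 1 by near: p'; exact: lt_near.
    by rewrite /u' !lt_eqF.
move=> p p' [e1 e e0]; rewrite /u e1 e0 ifT; last by lra.
by rewrite ifF ?subr0//; apply/negbTE; rewrite -leNgt; lra.
Unshelve. all: by end_near. Qed.

End TilingClassIso.

(** * Recognisability read on sequences *)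

Section Recognisability.
Variables (R : realType) (A : finType) (k : nat) (F : 'I_k.+1 -> substitution A).
Variable s : nat -> 'I_k.+1.

Lemma tiling_normal_repr s' (p : tiling_pre F R s') :
  tiling_normal (repr (\pi_(tiling_space F R s') p)) = tiling_normal p.
Proof.
apply: glue_invariant => p1 p2 [e1 e e0].
by rewrite /tiling_normal e1 e0 eqxx -e ifF// eq_sym oner_eq0.
Qed.

(** The parameter j / |phi(T_0)| is sent exactly to the start of the letter at offset [j] of the
    image. Two equal shifted images thus give two points with the same image under [tiling_map], and
    [tiling_normal] recovers the sequence and the parameter from a point. *)
Lemma recognisable_biseq : recognisable F R s -> forall i (T T' : biseq A) j j',
  Adm F s i.+1 T -> Adm F s i.+1 T' ->
  (j < size (F (s i) (T 0%R)))%N -> (j' < size (F (s i) (T' 0%R)))%N ->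
  bishift j%:Z (subst_biseq (F (s i)) T) = bishift j'%:Z (subst_biseq (F (s i)) T') ->
  T = T' /\ j = j'.
Proof.
move=> rec i T T' j j' AT AT' jT jT' e.
pose tt (S : biseq A) (l : nat) : R := l%:R / (size (F (s i) (S 0)))%:R.
have n0 (S : biseq A) : (0 : R) < (size (F (s i) (S 0)))%:R.
  by rewrite ltr0n size_subst_gt0.
have tt_itv (S : biseq A) l : (l < size (F (s i) (S 0%R)))%N -> 0 <= tt S l < 1.
  move=> lS; rewrite /tt divr_ge0//= ltr_pdivrMr// mul1r ltr_nat//.
pose p (S : biseq A) (AS : Adm F s i.+1 S) l : tiling_pre F R (seq_shift i.+1 s) :=
  (elt (mem_set AS) : admissible_space F (seq_shift i.+1 s), ipt (tt S l)).
have pn S (AS : Adm F s i.+1 S) l : (l < size (F (s i) (S 0%R)))%N ->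
    tiling_normal (p S AS l) = (S, tt S l).
  move=> lS; have /andP[t0 t1] := tt_itv S l lS.
  by rewrite /tiling_normal /= clamp01_id ?t0 ?(ltW t1)// lt_eqF.
have im S l : (l < size (F (s i) (S 0%R)))%N ->
    tiling_image (F (s i)) (S, tt S l) = (bishift l%:Z (subst_biseq (F (s i)) S), 0).
  move=> lS; rewrite /tiling_image /= /tt mulrCA mulfV ?gt_eqF// mulr1.
  by rewrite -[l%:R]/(l%:Z%:~R) intrKfloor subrr.
pose x S (AS : Adm F s i.+1 S) l := \pi_(tiling_space F R (seq_shift i.+1 s)) (p S AS l).
have im2 S AS l : (l < size (F (s i) (S 0%R)))%N ->
    tiling_image (F (s i)) (tiling_normal (repr (x S AS l))) =
    (bishift l%:Z (subst_biseq (F (s i)) S), 0).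
  by move=> lS; rewrite tiling_normal_repr pn// im.
have E := etrans (im2 T AT j jT) (etrans (congr1 (fun S : biseq A => (S, 0 : R)) e)
  (esym (im2 T' AT' j' jT'))).
have xx : x T AT j = x T' AT' j'.
  apply: (rec i); rewrite /tiling_map; congr (\pi_(tiling_space F R (seq_shift i s)) _).
  by congr pair; apply: val_inj; [exact: (congr1 fst E)|exact: (congr1 snd E)].
have := congr1 (fun y => tiling_normal (repr y)) xx.
rewrite !tiling_normal_repr !pn// => -[eT]; subst T' => /(congr1 (fun y => y * (size (F (s i) (T 0)))%:R)).
by rewrite /tt !divfK ?gt_eqF// => /eqP; rewrite eqr_nat => /eqP.
Qed.

End Recognisability.

(** * Integrals of singular cocycles along paths *)

Definition mkC (X Y : topologicalType) (f : X -> Y) (cf : continuous f) : continuousType X Y :=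
  HB.pack f (@isContinuous.Build X Y f cf).

Section AffineSimplices.
Variable R : realType.
Local Notation Delta n := (@std_simplex R n).

Lemma continuous_sumr (T : topologicalType) (I : Type) (r : seq I) (f : I -> T -> R) :
  (forall i, continuous (f i)) -> continuous (fun x => \sum_(i <- r) f i x).
Proof.
move=> cf; elim: r => [|i r IH].
  have -> : (fun x => \sum_(i <- [::]) f i x) = cst 0 by apply/funext => x; rewrite big_nil.
  exact: cst_continuous.
have -> : (fun x => \sum_(j <- i :: r) f j x) = (fun x => f i x + \sum_(j <- r) f j x).
  by apply/funext => x; rewrite big_cons.
by move=> x; apply: cvgD; [exact: cf|exact: IH].
Qed.

Definition bary n (v : 'I_n.+1 -> R) (t : Delta n) : R := \sum_i val t 0 i * v i.

Lemma bary_continuous n v : continuous (@bary n v).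
Proof.
apply: continuous_sumr => i.
have c : continuous (fun t : Delta n => val t 0 i : R).
  exact: (continuousT_comp (@initial_continuous _ _ set_val) (@coord_continuous _ 1 n.+1 0 i)).
by move=> t; exact: (cvgM (c t) (cvg_cst (v i))).
Qed.

Lemma bary_face n (v : 'I_n.+2 -> R) i t : bary v (face_incl i t) = bary (v \o lift i) t.
Proof.
rewrite /bary (bigD1_ord i)//= mxE unlift_none mul0r add0r.
by apply: eq_bigr => j _; rewrite mxE liftK.
Qed.

Variable X : topologicalType.
Implicit Types (G H : continuousType (R * R)%type X) (g : continuousType R X).

(** An affine simplex of the plane followed by [G]. The family is closed under faces; the plane
    serves for the squares swept out by homotopies of paths. *)
Definition affine_simplex G n (v w : 'I_n.+1 -> R) : simp (singular R X) n :=
  mkC (continuousT_comp (continuous_pair (@bary_continuous n v) (@bary_continuous n w))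
    (@cts_fun _ _ G)).

Lemma face_affine G n (v w : 'I_n.+2 -> R) i :
  face i (affine_simplex G v w) = affine_simplex G (v \o lift i) (w \o lift i).
Proof. by apply/continuousEP => t; rewrite /= !bary_face. Qed.

Definition pts1 (x y : R) : 'I_2 -> R := fun i => nth 0 [:: x; y] i.
Definition pts2 (x y w : R) : 'I_3 -> R := fun i => nth 0 [:: x; y; w] i.

Variable z : cocycle (singular R X).

Definition integral2 G (p q : R * R) : int :=
  val z (affine_simplex G (pts1 p.1 q.1) (pts1 p.2 q.2)).

Lemma cocycle2 (t : simp (singular R X) 2) :
  val z (face ord0 t) + val z (face ord_max t) = val z (face (inord 1) t).
Proof.
case: z => c /= /eqP/(congr1 (fun h => h t)).
rewrite /coboundary_map !big_ord_recr big_ord0 /= add0r expr0 expr1 expr2 mulrNN !mul1r mulN1r.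
set a := c _; set b := c _; set d := c _ => h.
have -> : c (t \o face_incl ord0) = a by rewrite /a; congr (c (_ \o face_incl _)); exact: val_inj.
have -> : c (t \o face_incl (inord 1)) = b.
  by rewrite /b; congr (c (_ \o face_incl _)); apply: val_inj; rewrite /= inordK.
have h' : a - b + d = 0 :> int by exact: h.
by lia.
Qed.

Lemma integral2D G p q r : integral2 G p q + integral2 G q r = integral2 G p r.
Proof.
have := cocycle2 (affine_simplex G (pts2 p.1 q.1 r.1) (pts2 p.2 q.2 r.2)).
rewrite !face_affine.
have e0 x y w : pts2 x y w \o lift ord0 = pts1 y w by apply/funext => -[[|[|//]] ?].
have e2 x y w : pts2 x y w \o lift ord_max = pts1 x y by apply/funext => -[[|[|//]] ?].
have e1 x y w : pts2 x y w \o lift (inord 1) = pts1 x w.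
  by apply/funext => -[[|[|//]] ?]; rewrite /pts2 /pts1 /= /bump inordK.
by rewrite !e0 !e1 !e2 => h; rewrite addrC; exact: h.
Qed.

Lemma integral2_eq G H p q p' q' :
  (forall t, 0 <= t <= 1 -> G (p.1 + t * (q.1 - p.1), p.2 + t * (q.2 - p.2)) =
     H (p'.1 + t * (q'.1 - p'.1), p'.2 + t * (q'.2 - p'.2))) ->
  integral2 G p q = integral2 H p' q'.
Proof.
move=> h; congr (val z _); apply/continuousEP => -[t /= tP].
have /set_mem[t0] := tP; rewrite !big_ord_recr big_ord0 /= add0r => t1.
have eb x y : bary (pts1 x y) (elt tP) = x + t 0 ord_max * (y - x).
  rewrite /bary !big_ord_recr big_ord0 /= add0r /pts1 /=.
  set u := t 0 (widen_ord _ _) in t1 *; set v := t 0 ord_max in t1 *.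
  have -> : u = 1 - v by rewrite -t1 addrK.
  by ring.
rewrite /= -/(elt tP) !eb; apply: h; rewrite t0 /=.
rewrite -t1 lerDr; exact: t0.
Qed.

Lemma integral2_refl G p : integral2 G p p = 0.
Proof. have := integral2D G p p p; lia. Qed.

Lemma integral2_cst G p q x : (forall t, 0 <= t <= 1 ->
  G (p.1 + t * (q.1 - p.1), p.2 + t * (q.2 - p.2)) = x) -> integral2 G p q = 0.
Proof.
move=> h; rewrite -(integral2_refl G p); apply: integral2_eq => t t01.
rewrite h//; have := h 0; rewrite !mul0r !addr0 => h0.
by rewrite !subrr !mulr0 !addr0 h0// lexx ler01.
Qed.

Definition of_path g : continuousType (R * R)%type X :=
  mkC (continuousT_comp (@continuous_fst R R) (@cts_fun _ _ g)).

Definition integral g (x y : R) := integral2 (of_path g) (x, 0) (y, 0).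

Lemma integralD g x y w : integral g x y + integral g y w = integral g x w.
Proof. exact: integral2D. Qed.

Lemma integral_refl g x : integral g x x = 0.
Proof. exact: integral2_refl. Qed.

Lemma integralN g x y : integral g y x = - integral g x y.
Proof. have := integralD g x y x; rewrite integral_refl; lia. Qed.

Lemma integral_eq g (h : continuousType R X) x y x' y' :
  (forall t, 0 <= t <= 1 -> g (x + t * (y - x)) = h (x' + t * (y' - x'))) ->
  integral g x y = integral h x' y'.
Proof. by move=> e; apply: integral2_eq => t t01 /=; exact: e. Qed.

Lemma integral2_path G p q g x y :
  (forall t, 0 <= t <= 1 -> G (p.1 + t * (q.1 - p.1), p.2 + t * (q.2 - p.2)) =
     g (x + t * (y - x))) -> integral2 G p q = integral g x y.
Proof. by move=> e; apply: integral2_eq => t t01 /=; exact: e. Qed.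

End AffineSimplices.

(** * Singular cocycles from local cocycles *)

Section SimplexPotentials.
Variable R : realType.
Local Notation Delta n := (@std_simplex R n).

Lemma std_simplex_compact n : compact (Delta n).
Proof.
apply: (@subclosed_compact _ _ [set v : 'rV[R]_n.+1 | forall i, `[0, 1]%classic (v ord0 i)]).
- have cc i : continuous (fun t : 'rV[R]_n.+1 => t 0 i) by exact: coord_continuous.
  have -> : Delta n = (\bigcap_(i in [set: 'I_n.+1]) (fun t : 'rV[R]_n.+1 => t 0 i) @^-1` `[0, +oo[%classic)
      `&` (fun t : 'rV[R]_n.+1 => \sum_i t 0 i) @^-1` [set 1].
    apply/seteqP; split=> [t [t0 t1]|t [t0 t1]]; split=> // i.
      by rewrite /= in_itv /= t0.
    by have := t0 i I; rewrite /= in_itv /= andbT.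
  apply: closedI.
    apply: closed_bigI => i _; apply: closed_comp => [t _|]; [exact: cc|exact: rray_closed].
  apply: closed_comp => [t _|]; last exact: closed_eq.
  by apply: continuous_sumr => i; exact: cc.
- exact: (@rV_compact R n.+1 (fun=> `[0, 1]%classic) (fun=> @segment_compact R 0 1)).
- move=> t [t0 t1] i; rewrite /= in_itv /= t0 /= -t1 (bigD1 i)//= lerDl.
  by apply: sumr_ge0 => j _; exact: t0.
Qed.

Lemma segment_subproof n (a b : Delta n) (t : R) :
  (1 - clamp01 t) *: val a + clamp01 t *: val b \in Delta n.
Proof.
have := clamp01_mem t; rewrite inE /= in_itv /=; set c := clamp01 t => /andP[c0 c1].
case: a b => [a /= /set_mem[a0 a1]] [b /= /set_mem[b0 b1]]; apply/mem_set; split=> [i|].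
  by rewrite !mxE addr_ge0// mulr_ge0// subr_ge0.
under eq_bigr do rewrite !mxE.
by rewrite big_split /= -!mulr_sumr a1 b1 !mulr1 subrK.
Qed.

Definition segment_pt n (a b : Delta n) t : Delta n := elt (segment_subproof a b t).

Lemma segment_pt_continuous n (a : Delta n) :
  continuous (fun p : R * Delta n => segment_pt a p.2 p.1).
Proof.
apply: continuous_comp_initial.
have c1 : continuous (fun p : R * Delta n => clamp01 p.1).
  exact: (continuousT_comp (@continuous_fst R (Delta n)) (@clamp01_continuous R)).
have c2 : continuous (fun p : R * Delta n => val p.2 : 'rV[R]_n.+1).
  exact: (continuousT_comp (@continuous_snd R (Delta n)) (@initial_continuous _ _ set_val)).
move=> p; apply: cvgD; last exact: (cvgZ (c1 p) (c2 p)).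
exact: (cvgZ (cvgB (cvg_cst (1 : R)) (c1 p)) (cvg_cst (val a))).
Qed.

Lemma clamp010 : clamp01 (0 : R) = 0.
Proof. by rewrite clamp01_id// lexx ler01. Qed.

Lemma clamp011 : clamp01 (1 : R) = 1.
Proof. by rewrite clamp01_id// lexx ler01. Qed.

Lemma segment_pt0 n (a b : Delta n) : segment_pt a b 0 = a.
Proof. by apply: val_inj; rewrite /= clamp010 subr0 scale1r scale0r addr0. Qed.

Lemma segment_pt1 n (a b : Delta n) : segment_pt a b 1 = b.
Proof. by apply: val_inj; rewrite /= clamp011 subrr scale1r scale0r add0r. Qed.

Lemma vertex_subproof n (i : 'I_n.+1) : delta_mx 0 i \in Delta n.
Proof.
apply/mem_set; split=> [j|]; first by rewrite mxE ler0n.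
by rewrite (bigD1 i)//= mxE !eqxx big1 ?addr0// => j ji; rewrite mxE (negbTE ji) andbF.
Qed.

Definition vertex n (i : 'I_n.+1) : Delta n := elt (vertex_subproof i).

Lemma face_vertex n (i : 'I_n.+2) j : face_incl i (vertex j) = vertex (lift i j).
Proof.
apply: val_inj; apply/rowP => l; rewrite /= !mxE /=.
case: unliftP => [m ->|->]; first by rewrite mxE /= (inj_eq lift_inj).
by rewrite (negbTE (neq_lift i j)).
Qed.

Lemma bary_vertex n (v : 'I_n.+1 -> R) i : bary v (vertex i) = v i.
Proof.
rewrite /bary (bigD1 i)//= mxE !eqxx mul1r big1 ?addr0// => j ji.
by rewrite mxE (negbTE ji) andbF mul0r.
Qed.

Variables (X : topologicalType) (psi : X -> X -> int).
Hypothesis lpsi : local_cocycle psi.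

Lemma local_cocycle_refl x : psi x x = 0.
Proof.
by have [U [nU hU]] := lpsi x; have Ux := nbhs_singleton nU; have := hU x x x Ux Ux Ux; lia.
Qed.

Lemma simplex_potential n (g : continuousType (Delta n) X) : exists u, potential psi g u.
Proof.
pose a := vertex (@ord0 n); pose G t y := g (segment_pt a y t).
have cG : continuous (fun p : R * Delta n => G p.1 p.2).
  exact: (continuousT_comp (@segment_pt_continuous n a) (@cts_fun _ _ g)).
have cD : compact [set: Delta n] by apply: compact_set_type; exact: std_simplex_compact.
have p0 : potential psi (G 0) (fun=> 0).
  by move=> y; apply: filterE => y'; rewrite /G !segment_pt0 local_cocycle_refl subrr.
have [u pu] := homotopy_potential cD cG lpsi p0.
by exists u; have <- : G 1 = g by apply/funext => y; rewrite /G segment_pt1.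
Qed.

Lemma simplex_potential_unique n (g : continuousType (Delta n) X) u v :
  potential psi g u -> potential psi g v -> forall a b, u b - u a = v b - v a.
Proof.
move=> pu pv a b.
have ch : continuous (segment_pt a b).
  have cc : continuous (cst b : R -> Delta n) by exact: cst_continuous.
  have ci : continuous (id : R -> R) by move=> x; exact: cvg_id.
  exact: (continuousT_comp (continuous_pair ci cc) (@segment_pt_continuous n a)).
have := potential_unique_real (potential_comp ch pu) (potential_comp ch pv) 0 1.
by rewrite /= segment_pt0 segment_pt1.
Qed.

(* The value on a simplex is the increment of a potential, which exists and is unique
   because simplices are contractible. *)
Lemma singular_of_local : exists z : cocycle (singular R X),
  forall (g : continuousType (Delta 1) X) u, potential psi g u ->
    val z g = u (vertex ord_max) - u (vertex ord0).
Proof.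
have /choice[U hU] := @simplex_potential 1.
pose c (g : simp (singular R X) 1) : int := U g (vertex ord_max) - U g (vertex ord0).
have hc (g : continuousType (Delta 1) X) u : potential psi g u -> c g = u (vertex ord_max) - u (vertex ord0).
  by move=> pu; exact: simplex_potential_unique (hU g) pu _ _.
have cP : c \in @is_cocycle (singular R X).
  rewrite unfold_in; apply/eqP/funext => t; have [u pu] := simplex_potential t.
  rewrite /coboundary_map !big_ord_recr big_ord0 /= add0r.
  rewrite expr0 expr1 expr2 mulrNN !mul1r mulN1r.
  have hf i : c (t \o face_incl i) = u (vertex (lift i ord_max)) - u (vertex (lift i ord0)).
    rewrite -!face_vertex; apply: (hc _ (u \o face_incl i)).
    exact: (potential_comp (@face_incl_continuous R 1 i) pu).
  rewrite !hf.
  set x0 := lift _ _; set x1 := lift _ _; set x2 := lift _ _; set x3 := lift _ _.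
  set x4 := lift _ _; set x5 := lift _ _.
  have -> : x0 = x2 by exact: val_inj.
  have -> : x1 = x4 by exact: val_inj.
  have -> : x3 = x5 by exact: val_inj.
  by rewrite -[RHS]/(0 : int); ring.
by exists (Cocycle cP).
Qed.

Lemma integral_potential (z : cocycle (singular R X)) (g : continuousType R X) u :
  (forall (h : continuousType (Delta 1) X) u, potential psi h u ->
    val z h = u (vertex ord_max) - u (vertex ord0)) ->
  potential psi g u -> forall x y, integral z g x y = u y - u x.
Proof.
move=> hz pu x y; rewrite /integral /integral2 (hz _ (u \o bary (pts1 x y))).
  by rewrite /= !bary_vertex.
exact: (potential_comp (@bary_continuous R 1 (pts1 x y)) pu).
Qed.

End SimplexPotentials.

(** * The first cohomology of the Barge-Diamond complex *)

Section BargeDiamondPaths.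
Variables (R : realType) (A : finType) (k : nat) (F : 'I_k.+1 -> substitution A).
Local Notation eps := (bd_eps R F).
Local Notation K := (bd_complex R F).
Local Notation pre := (bd_pre R F).
Local Notation lo := (bd_lo R F).
Local Notation hi := (bd_hi R F).
Local Notation piK := (\pi_K : pre -> K).

Lemma bd_eps_gt0 : 0 < eps.
Proof.
apply: (big_ind (fun x : R => 0 < x)) => [|x y x0 y0|p _].
- by rewrite invr_gt0.
- by rewrite lt_min x0.
- by rewrite invr_gt0 mulr_gt0// ltr0n size_subst_gt0.
Qed.

Lemma bd_quotient_open (D : set K) :
  (forall p, D (piK p) -> \forall p' \near p, D (piK p')) -> open D.
Proof.
move=> h; have : open (piK @^-1` D); last by [].
by rewrite openE => p /h.
Qed.

Lemma bd_invariant (B : Type) (h : pre -> B) :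
  (forall p p', bd_glue p p' -> h p = h p') -> forall p, h (repr (piK p)) = h p.
Proof.
move=> hg p; have /eqmodP/asboolP := reprK (piK p).
by move: (repr (piK p)) => z; elim=> [x y /hg|x|x y _ ->|x y w _ -> _ ->].
Qed.

Lemma bd_pre_near (p : pre) (P : pre -> Prop) :
  (\forall x \near (bd_coord p : R), forall p' : pre, projT1 p' = projT1 p -> bd_coord p' = x -> P p') ->
  \forall p' \near p, P p'.
Proof.
case: p => e t /= h.
have h2 : \forall t' \near t, P (existT _ e t').
  apply/near_subtypeP; apply: filterS h => x hx Ax; exact: hx.
exact: h2.
Qed.

Lemma bd_coord_itv (p : pre) : lo (projT1 p) <= bd_coord p <= hi (projT1 p).
Proof. by case: p => e [t tP] /=; have := set_mem tP; rewrite /bd_interval /= in_itv. Qed.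

Lemma bd_point_surj (x : K) : exists e y, lo e <= y <= hi e /\ x = bd_point F e y.
Proof.
exists (projT1 (repr x)), (bd_coord (repr x)); split; first exact: bd_coord_itv.
by rewrite bd_point_coord reprK.
Qed.

Definition bd_elt e (y : R) : pre := existT _ e (elt (bd_clamp_subproof F e y)).

Lemma bd_elt_coord e y : lo e <= y <= hi e -> bd_coord (bd_elt e y) = y.
Proof. exact: bd_clampK. Qed.

Definition word_path a w : continuousType R K := mkC (@bd_path_continuous R A k F a w).
Definition edge_path e : continuousType R K := mkC (@bd_point_continuous R A k F e).

Lemma bd_path_initial a w u : u <= 1 - eps -> bd_path F a w u = bd_point F (inl a) u.
Proof. by case: w => //= b w ->. Qed.

Lemma bd_path_middle a b w u : 1 - eps <= u <= 1 + eps ->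
  bd_path F a (b :: w) u = bd_point F (inr (a, b)) (u - 1).
Proof.
move=> /andP[u1 u2] /=; case: ifP => [u3|_]; last by rewrite u2.
have -> : u = 1 - eps by apply/le_anti/andP.
by rewrite (bd_point_out _ _ a b) addrAC subrr add0r.
Qed.

Lemma bd_path_shift a b w u : 1 + eps <= u -> bd_path F a (b :: w) u = bd_path F b w (u - 1).
Proof.
have e0 := bd_eps_gt0; have e1 := bd_eps_le_half R F.
move=> u1; have [e|ne] := eqVneq u (1 + eps).
  rewrite bd_path_middle; last by rewrite e; lra.
  have -> : u - 1 = eps by rewrite e; ring.
  by rewrite bd_path_eps (bd_point_in _ _ b a).
have u2 : 1 + eps < u by rewrite lt_neqAle eq_sym ne.
by rewrite /= !ifN// -ltNge//; lra.
Qed.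

(** The coordinate on the open edges e_ab only: their ends are excluded, which makes the function
    compatible with the glueing. *)
Definition bd_info (p : pre) : option (A * A * R) :=
  match projT1 p with
  | inl _ => None
  | inr ab => if - eps < bd_coord p < eps then Some (ab, bd_coord p) else None
  end.

Lemma bd_info_glue p p' : bd_glue p p' -> bd_info p = bd_info p'.
Proof.
have e0 := bd_eps_gt0.
by move=> [a [b [[e1 e2 e3 e4]|[e1 e2 e3 e4]]]]; rewrite /bd_info e1 e3 e4 ltxx ?andbF.
Qed.

Definition edge_info (x : K) := bd_info (repr x).

Lemma edge_infoE p : edge_info (piK p) = bd_info p.
Proof. exact: bd_invariant bd_info_glue p. Qed.

Lemma edge_info_point e y : lo e <= y <= hi e -> edge_info (bd_point F e y) =
  if e is inr ab then if - eps < y < eps then Some (ab, y) else None else None.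
Proof.
move=> ye; rewrite -[bd_point _ _ _]/(piK (bd_elt e y)) edge_infoE /bd_info bd_elt_coord//.
Qed.

Definition heaviside (x : R) : int := if 0 <= x then 1 else 0.

Variable c : A -> A -> int.

(* Counts the signed crossings of the midpoint of e_ab with weight c a b. *)
Definition jump_cocycle (x y : K) : int :=
  match edge_info x, edge_info y with
  | Some (ab, u), Some (cd, v) =>
      if (ab == cd) && (- (eps / 2) < u - v < eps / 2) then c ab.1 ab.2 * (heaviside v - heaviside u) else 0
  | _, _ => 0
  end.

(** Within eps/4 of an interior point of e_ab the cut-off at eps/2 always holds and the values are
    increments of one step function. Any other point has a neighbourhood meeting the e_ab only at
    coordinates beyond eps/2 in absolute value: there, two points on opposite sides of a midpoint
    are more than eps apart, and the cut-off gives 0. *)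
Lemma jump_cocycle_local : local_cocycle jump_cocycle.
Proof.
have e0 := bd_eps_gt0; have e1 := bd_eps_le_half R F.
move=> x; case ex: (edge_info x) => [[ab u]|].
  pose U : set K := [set y | exists v, edge_info y = Some (ab, v) /\ u - eps / 4 < v < u + eps / 4].
  have oU : open U.
    apply: bd_quotient_open => p; rewrite /U /= => -[v [ev vu]].
    move: ev; rewrite edge_infoE /bd_info; case ep: (projT1 p) => [//|cd].
    case: ifP => // /andP[v1 v2] [ecd ev]; subst cd v.
    move/andP: vu => [w1 w2].
    apply: bd_pre_near; near=> t => p' ep' et; exists t; rewrite edge_infoE /bd_info ep' ep et.
    rewrite ifT; first split=> //; apply/andP; split; near: t;
      by [exact: lt_nbhsr|exact: lt_nbhsl].
  exists U; split.
    by apply: open_nbhs_nbhs; split=> //; exists u; rewrite ex; split=> //; lra.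
  move=> y1 y2 y3 [v1 [i1 h1]] [v2 [i2 h2]] [v3 [i3 h3]].
  rewrite /jump_cocycle i1 i2 i3 eqxx /=.
  by rewrite !ifT; [lia|lra..].
pose U : set K := [set y | match edge_info y with Some (_, v) => v < - (eps / 2) \/ eps / 2 < v | None => True end].
have oU : open U.
  apply: bd_quotient_open => p; rewrite /U /= edge_infoE => hp.
  apply: bd_pre_near; case ep: (projT1 p) => [a|ab].
    by apply: filterE => t p' ep' et; rewrite edge_infoE /bd_info ep'.
  have hv : bd_coord p < - (eps / 2) \/ eps / 2 < bd_coord p.
    move: hp; rewrite /bd_info ep; case: ifP => // /negbT; rewrite negb_and -!leNgt => h _.
    by case/orP: h => h; [left|right]; lra.
  case: hv => hv.
    apply: filterS (lt_nbhsl hv) => t ht p' ep' et; rewrite edge_infoE /bd_info ep'.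
    by case: ifP => // _; left; rewrite et.
  apply: filterS (lt_nbhsr hv) => t ht p' ep' et; rewrite edge_infoE /bd_info ep'.
  by case: ifP => // _; right; rewrite et.
exists U; split; first by apply: open_nbhs_nbhs; split=> //; rewrite /U /= ex.
suff h0 y y' : U y -> U y' -> jump_cocycle y y' = 0.
  by move=> y1 y2 y3 u1 u2 u3; rewrite !h0.
rewrite /U /= /jump_cocycle; case: (edge_info y) => [[ab u]|//]; case: (edge_info y') => [[cd v]|//].
move=> hu hv; case: ifP => // /andP[_ huv].
have -> : heaviside v = heaviside u; last by rewrite subrr mulr0.
by rewrite /heaviside; case: ifP => hv0; case: ifP => hu0 //; exfalso; lra.
Unshelve. all: by end_near. Qed.

Lemma word_path_info a b y : edge_info (word_path a [:: b] y) =
  if 1 - eps < y < 1 + eps then Some ((a, b), y - 1) else None.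
Proof.
have e0 := bd_eps_gt0; have e1 := bd_eps_le_half R F.
have aux d x : edge_info (bd_point F (inl d) x) = None.
  by rewrite -[bd_point _ _ _]/(piK (bd_elt (inl d) x)) edge_infoE.
rewrite -[word_path _ _ _]/(bd_path F a [:: b] y).
case: ifP => [/andP[y1 y2]|h].
  rewrite bd_path_middle ?(ltW y1) ?(ltW y2)// edge_info_point ?ifT//=; lra.
have [y1|y1] := leP y (1 - eps); first by rewrite bd_path_initial.
have y2 : 1 + eps <= y by rewrite leNgt; apply/negP => y2; move: h; rewrite y1 y2.
by rewrite bd_path_shift// /= aux.
Qed.

Lemma jump_potential a b :
  potential jump_cocycle (word_path a [:: b]) (fun y => c a b * heaviside (y - 1)).
Proof.
have e0 := bd_eps_gt0; have e1 := bd_eps_le_half R F.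
move=> y; have [/andP[y1 y2]|h] := boolP (1 - eps < y < 1 + eps).
  near=> y'; rewrite /jump_cocycle !word_path_info y1 y2.
  have z1 : 1 - eps < y' by near: y'; exact: lt_nbhsr.
  have z2 : y' < 1 + eps by near: y'; exact: lt_nbhsl.
  have z3 : y - eps / 2 < y' by near: y'; apply: lt_nbhsr; lra.
  have z4 : y' < y + eps / 2 by near: y'; apply: lt_nbhsl; lra.
  by rewrite z1 z2 /= eqxx ifT; [ring|lra].
suff : \forall y' \near y, heaviside (y' - 1) = heaviside (y - 1).
  apply: filterS => y' ->; rewrite subrr /jump_cocycle word_path_info (negbTE h).
  by [].
move: h; rewrite negb_and -!leNgt => /orP[h|h].
  near=> y'; have z : y' < 1 by near: y'; apply: lt_nbhsl; lra.
  by rewrite /heaviside !ifF//; apply/negbTE; rewrite -ltNge; lra.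
near=> y'; have z : 1 < y' by near: y'; apply: lt_nbhsr; lra.
by rewrite /heaviside !ifT//; lra.
Unshelve. all: by end_near. Qed.

Lemma edge_cocycle_exists : exists z : cocycle (singular R K),
  forall a b, integral z (word_path a [:: b]) (1/2) (3/2) = c a b.
Proof.
have [z hz] := singular_of_local R jump_cocycle_local; exists z => a b.
rewrite (integral_potential hz (@jump_potential a b)).
by rewrite /heaviside ifT ?ifF ?mulr1 ?mulr0 ?subr0//; [apply/negbTE; rewrite -ltNge|]; lra.
Qed.

End BargeDiamondPaths.

(** * Primitives of singular cocycles on star-shaped neighbourhoods *)

Section LocalContraction.
Variables (R : realType) (X : topologicalType) (z : cocycle (singular R X)).

(* W is contracted to x0 along finitely many rays beta i; the cocycle condition on the
   square (s, t) |-> beta (b (g s)) (y0 + t (Y (g s) - y0)) computes the integral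
   over its fourth side. *)
Lemma contraction_potential (I : finType) (W : set X) (beta : I -> continuousType R X)
    (b : X -> I) (Y : X -> R) (y0 : R) (x0 : X) (kap : int) (U : X -> int) :
  (forall x, W x -> {for x, continuous Y}) ->
  (forall x, W x -> \forall x' \near x, forall t, 0 <= t <= 1 ->
     beta (b x') (y0 + t * (Y x - y0)) = beta (b x) (y0 + t * (Y x - y0))) ->
  (forall i, beta i y0 = x0) ->
  (forall x, W x -> x = beta (b x) (Y x)) ->
  (forall x, W x -> U x = kap + integral z (beta (b x)) y0 (Y x)) ->
  forall (g : continuousType R X), (forall s, W (g s)) ->
  forall a c, integral z g a c = U (g c) - U (g a).
Proof.
move=> cY hb h0 hx hU g Wg a c.
pose G (p : R * R) := beta (b (g p.1)) (y0 + clamp01 p.2 * (Y (g p.1) - y0)).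
have cl01 t : 0 <= clamp01 (t : R) <= 1.
  by have := clamp01_mem t; rewrite inE /= in_itv.
have cg : continuous g by exact: cts_fun.
have cG : continuous G.
  move=> [s t] O; rewrite /G /= => nO.
  set y := y0 + clamp01 t * (Y (g s) - y0) in nO.
  have cy : {for (s, t), continuous (fun p : R * R => y0 + clamp01 p.2 * (Y (g p.1) - y0))}.
    have c2 : {for (s, t), continuous (fun p : R * R => clamp01 p.2)}.
      exact: (continuousT_comp (@continuous_snd R R) (@clamp01_continuous R)).
    have c3 : {for (s, t), continuous (fun p : R * R => Y (g p.1))}.
      apply: (@continuous_comp _ R R (fun p : R * R => p.1) (Y \o g)).
        exact: continuous_fst.
      by apply: continuous_comp; [exact: cg|exact: cY].
    exact: (cvgD (cvg_cst y0) (cvgM c2 (cvgB c3 (cvg_cst y0)))).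
  (* The branch index may jump along [g], so continuity is proved at once for the finitely many
     branches that pass through the same point at [y]; by [hb] the branches at nearby times are
     among them. *)
  have nN : \forall y' \near y, forall i, beta i y = beta (b (g s)) y -> O (beta i y').
    pose P i y' := beta i y = beta (b (g s)) y -> O (beta i y').
    suff nP i : nbhs y (P i) by exact: (@filter_forall R I P (nbhs y) (nbhs_filter y) nP).
    rewrite /P; have [e|ne] := pselect (beta i y = beta (b (g s)) y).
      have ci : continuous (beta i) by exact: cts_fun.
      rewrite -e in nO; have n : \forall y' \near y, O (beta i y') by exact: (ci y O nO).
      by apply: filterS n => y' Oy' _.
    by apply: filterE => y' /ne.
  have n1 : \forall p \near (s, t), forall i, beta i y = beta (b (g s)) y ->
      O (beta i (y0 + clamp01 p.2 * (Y (g p.1) - y0))) by exact: (cy _ nN).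
  have n2 : \forall p \near (s, t), beta (b (g p.1)) y = beta (b (g s)) y.
    have n3 : \forall s' \near s, beta (b (g s')) y = beta (b (g s)) y.
      have n : \forall s' \near s, forall t, 0 <= t <= 1 ->
          beta (b (g s')) (y0 + t * (Y (g s) - y0)) = beta (b (g s)) (y0 + t * (Y (g s) - y0)).
        exact: (cg s _ (hb _ (Wg s))).
      by apply: filterS n => s'; apply; exact: cl01.
    exact: (@continuous_fst R R (s, t) _ n3).
  by apply: filterS2 n1 n2 => p h /h.
pose H : continuousType (R * R)%type X := mkC cG.
have c1 : clamp01 (1 : R) = 1 by rewrite clamp01_id// lexx ler01.
have c0 : clamp01 (0 : R) = 0 by rewrite clamp01_id// lexx ler01.
have e1 : integral2 z H (a, 1) (c, 1) = integral z g a c.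
  apply: integral2_path => t _ /=; rewrite subrr mulr0 addr0 /G /= c1 mul1r.
  by rewrite subrKC -hx.
have e2 : integral2 z H (a, 0) (c, 0) = 0.
  apply: (integral2_cst z (x := x0)) => t _ /=.
  by rewrite /G /= subrr mulr0 addr0 c0 mul0r addr0 h0.
have e3 s : integral2 z H (s, 0) (s, 1) = U (g s) - kap.
  rewrite hU//; transitivity (integral z (beta (b (g s))) y0 (Y (g s))); last by lia.
  apply: integral2_path => t t01 /=; rewrite /G /= subrr mulr0 addr0 subr0 mulr1 add0r.
  by rewrite clamp01_id.
have := integral2D z H (a, 0) (a, 1) (c, 1); have := integral2D z H (a, 0) (c, 0) (c, 1).
by rewrite e1 e2 !e3; lia.
Qed.

Lemma local_potential_path (U : X -> int) :
  (forall x : X, exists W : set X, nbhs x W /\ forall g : continuousType R X, (forall s, W (g s)) ->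
    forall a c, integral z g a c = U (g c) - U (g a)) ->
  forall (g : continuousType R X) a c, integral z g a c = U (g c) - U (g a).
Proof.
move=> hW g a b.
apply: (@real_clopen R (fun c => integral z g a c = U (g c) - U (g a)) _ a b); last first.
  by rewrite integral_refl subrr.
move=> t; have [W [nW hg]] := hW (g t).
have cg : continuous g by exact: cts_fun.
have [e e0 he] : exists2 e : R, 0 < e & forall t', `|t - t'| < e -> W (g t').
  by have /nbhs_ballP[e /= e0 he] := cg t W nW; exists e.
near=> t'.
have te : `|t - t'| < e by near: t'; apply/nbhs_ballP; exists e.
suff h : integral z g t t' = U (g t') - U (g t).
  by rewrite -(integralD z g a t t') h; split; lia.
(* Reparametrised to stay between [t] and [t'], the whole line is mapped into [W], as the local
   hypothesis demands. *)
pose h (s : R) := t + clamp01 s * (t' - t).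
have ch : continuous h.
  move=> s; apply: cvgD; first exact: cvg_cst.
  by apply: cvgM; [exact: clamp01_continuous|exact: cvg_cst].
pose g' : continuousType R X := mkC (continuousT_comp ch cg).
have Wg' s : W (g' s).
  apply: he; rewrite /h.
  have -> : t - (t + clamp01 s * (t' - t)) = clamp01 s * (t - t') by ring.
  have := clamp01_mem s; rewrite inE /= in_itv /= => /andP[c0 c1].
  rewrite normrM (ger0_norm c0); apply: le_lt_trans te.
  by rewrite ler_piMl.
have := hg g' Wg' 0 1.
have -> : integral z g' 0 1 = integral z g t t'.
  by apply: integral_eq => u u01 /=; rewrite /h subr0 mulr1 add0r clamp01_id.
rewrite /= /h !clamp01_id ?lexx ?ler01// mul0r addr0 mul1r.
by have -> : t + (t' - t) = t' by ring.
Unshelve. all: by end_near. Qed.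

Lemma path_potential_coboundary (U : X -> int) :
  (forall (g : continuousType R X) a c, integral z g a c = U (g c) - U (g a)) ->
  H1_class z = 0.
Proof.
move=> hU.
have -> : 0 = H1_class (0 : cocycle (singular R X)).
  by rewrite -(subrr (0 : cocycle (singular R X))) H1_classB subrr.
apply/H1_classE; exists (fun p : simp (singular R X) 0 => U (p (vertex R ord0))).
apply/funext => t.
rewrite -[LHS]/(val z t - 0) subr0.
rewrite /coboundary_map !big_ord_recr big_ord0 /= add0r expr0 expr1 mul1r mulN1r.
rewrite !face_vertex.
have ci : continuous (id : R -> R) by move=> x; exact: cvg_id.
have cc : continuous (cst (vertex R (@ord_max 1)) : R -> @std_simplex R 1) by exact: cst_continuous.
have cs := continuousT_comp (continuous_pair ci cc) (@segment_pt_continuous R 1 (vertex R ord0)).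
pose g : continuousType R X := mkC (continuousT_comp cs (@cts_fun _ _ t)).
have := hU g 0 1; rewrite /= segment_pt0 segment_pt1.
have -> : integral z g 0 1 = val z t.
  congr (val z _); apply/continuousEP => -[x xP] /=; congr (t _).
  have /set_mem[x0] := xP; rewrite !big_ord_recr big_ord0 /= add0r => x1.
  apply: val_inj; apply/rowP => j; rewrite /= !mxE /=.
  rewrite /bary !big_ord_recr big_ord0 /= add0r mulr0 add0r mulr1.
  set u := x 0 (widen_ord _ _) in x1 *; set v := x 0 ord_max in x1 *.
  have v0 : 0 <= v by exact: x0.
  have u0 : 0 <= u by exact: x0.
  rewrite clamp01_id; last by apply/andP; split=> //; lra.
  have [->|->] : j = ord_max \/ j = widen_ord (leqnSn 1) ord_max.
    by case: j => -[|[|//]] ji; [right|left]; exact: val_inj.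
  - by rewrite -/v /=; lra.
  - by rewrite -/u /=; lra.
by move=> ->; congr (U (t (vertex R _)) - U (t (vertex R _))); exact: val_inj.
Qed.

End LocalContraction.

(** * Vanishing of a class whose edge integrals are increments *)

Section BargeDiamondInjective.
Variables (R : realType) (A : finType) (k : nat) (F : 'I_k.+1 -> substitution A).
Local Notation eps := (bd_eps R F).
Local Notation K := (bd_complex R F).
Local Notation pre := (bd_pre R F).
Local Notation lo := (bd_lo R F).
Local Notation hi := (bd_hi R F).
Local Notation piK := (\pi_K : pre -> K).

Variable z : cocycle (singular R K).
Variable v : A -> int.
Hypothesis hv : forall a b, integral z (word_path R F a [:: b]) (1/2) (3/2) = v b - v a.

Let e0 : 0 < eps. Proof. exact: bd_eps_gt0. Qed.
Let e1 : eps <= 2^-1. Proof. exact: bd_eps_le_half. Qed.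

(** The primitive with value [v a] at the midpoint of e_a, computed on e_ab by entering from e_a;
    [hv] makes the value at the other end agree with the one computed in e_b. *)
Definition pre_primitive (p : pre) : int :=
  match projT1 p with
  | inl a => v a + integral z (edge_path R F (inl a)) (1/2) (bd_coord p)
  | inr (a, b) => v a + integral z (word_path R F a [:: b]) (1/2) (1 + bd_coord p)
  end.

Lemma word_edge_initial a b y : y <= 1 - eps ->
  word_path R F a [:: b] y = edge_path R F (inl a) y.
Proof. exact: bd_path_initial. Qed.

Lemma word_edge_middle a b y : 1 - eps <= y <= 1 + eps ->
  word_path R F a [:: b] y = edge_path R F (inr (a, b)) (y - 1).
Proof. exact: bd_path_middle. Qed.

Lemma word_edge_final a b y : 1 + eps <= y ->
  word_path R F a [:: b] y = edge_path R F (inl b) (y - 1).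
Proof. exact: bd_path_shift. Qed.

Lemma segment_ge (x y c t : R) : c <= x -> c <= y -> 0 <= t <= 1 -> c <= x + t * (y - x).
Proof. by move=> h1 h2 /andP[t0 t1]; nra. Qed.

Lemma segment_le (x y c t : R) : x <= c -> y <= c -> 0 <= t <= 1 -> x + t * (y - x) <= c.
Proof. by move=> h1 h2 /andP[t0 t1]; nra. Qed.

Lemma pre_primitive_glue p p' : bd_glue p p' -> pre_primitive p = pre_primitive p'.
Proof.
have E0 := e0; have E1 := e1.
move=> [a [b [[h1 h2 h3 h4]|[h1 h2 h3 h4]]]]; rewrite /pre_primitive h1 h2 h3 h4.
  congr (_ + _); apply: integral_eq => t t01.
  by rewrite word_edge_initial //; apply: segment_le => //; lra.
have e : integral z (edge_path R F (inl a)) eps (1/2) =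
    integral z (word_path R F b [:: a]) (1 + eps) (3/2).
  apply: integral_eq => t t01; rewrite word_edge_final; last by apply: segment_ge => //; lra.
  by congr (edge_path _ _ _ _); lra.
have := hv b a; rewrite -(integralD _ _ (1/2) (1 + eps) (3/2)) -e.
by rewrite [in X in _ -> X](integralN _ _ eps (1/2)); lia.
Qed.

Definition primitive (x : K) : int := pre_primitive (repr x).

Lemma primitiveE p : primitive (piK p) = pre_primitive p.
Proof. exact: bd_invariant pre_primitive_glue p. Qed.

Lemma primitive_point e y : lo e <= y <= hi e ->
  primitive (bd_point F e y) = match e with
  | inl a => v a + integral z (edge_path R F (inl a)) (1/2) y
  | inr (a, b) => v a + integral z (word_path R F a [:: b]) (1/2) (1 + y)
  end.
Proof.
move=> ye; rewrite -[bd_point _ _ _]/(piK (bd_elt F e y)) primitiveE /pre_primitive bd_elt_coord//.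
Qed.

Lemma bd_continuous_at (W : set K) (Y : K -> R) :
  (forall p, W (piK p) -> \forall p' \near p, W (piK p')) ->
  (forall p (e : R), W (piK p) -> 0 < e -> \forall p' \near p, `|Y (piK p') - Y (piK p)| < e) ->
  forall x, W x -> {for x, continuous Y}.
Proof.
move=> hW hY x Wx O /nbhs_ballP[e /= e00 he].
pose D := [set y : K | W y /\ `|Y y - Y x| < e].
have oD : open D.
  apply: bd_quotient_open => p [Wp dp].
  have d0 : 0 < e - `|Y (piK p) - Y x| by lra.
  apply: filterS2 (hW p Wp) (hY p _ Wp d0) => p' Wp' dp'; split=> //.
  have -> : Y (piK p') - Y x = (Y (piK p') - Y (piK p)) + (Y (piK p) - Y x) by ring.
  by apply: le_lt_trans (ler_normD _ _) _; lra.
have : nbhs x D by apply: open_nbhs_nbhs; split=> //; split=> //; rewrite subrr normr0.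
move=> nD; have {}nD : \forall y \near x, ball (Y x) e (Y y).
  by apply: filterS nD => y [_]; rewrite distrC.
by apply: filterS nD => y; exact: he.
Qed.

Lemma near_dist (x : R) (e : R) : 0 < e -> \forall y \near x, `|y - x| < e.
Proof. by move=> e00; apply/nbhs_ballP; exists e => //= y; rewrite distrC. Qed.

(** The open edge e_ab, contracted to its midpoint. It serves for that midpoint, which the stars of
    the letters leave out. *)
Lemma edge_neighbourhood a b : exists W : set K,
  (forall y, - eps < y < eps -> nbhs (bd_point F (inr (a, b)) y) W) /\
  forall g : continuousType R K, (forall s, W (g s)) ->
    forall c d, integral z g c d = primitive (g d) - primitive (g c).
Proof.
have E0 := e0; have E1 := e1.
pose pY (p : pre) : R := if projT1 p == inr (a, b) then
  (if - eps < bd_coord p < eps then bd_coord p else 0) else 0.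
pose pW (p : pre) := projT1 p = inr (a, b) /\ - eps < bd_coord p < eps.
have gY p p' : bd_glue p p' -> pY p = pY p'.
  by move=> [c [d [[h1 h2 h3 h4]|[h1 h2 h3 h4]]]]; rewrite /pY h1 h3 h4 ltxx ?andbF /=; case: ifP.
have gW p p' : bd_glue p p' -> pW p = pW p'.
  move=> [c [d [[h1 h2 h3 h4]|[h1 h2 h3 h4]]]]; rewrite /pW h1 h3 h4 ltxx ?andbF.
    by apply/propext; split=> -[].
  by apply/propext; split=> -[].
pose W (x : K) := pW (repr x); pose Y (x : K) := pY (repr x).
have WE p : W (piK p) = pW p by exact: bd_invariant gW p.
have YE p : Y (piK p) = pY p by exact: bd_invariant gY p.
have nW p : pW p -> \forall p' \near p, pW p'.
  move=> [h1 /andP[h2 h3]]; apply: bd_pre_near; near=> t => p' ep' et.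
  by split; [rewrite ep'|rewrite et; apply/andP; split; near: t; [exact: lt_nbhsr|exact: lt_nbhsl]].
have Wpt p : pW p -> piK p = bd_point F (inr (a, b)) (bd_coord p).
  by move=> [h _]; rewrite -bd_point_coord h.
exists W; split.
  move=> y hy; have W0 : W (bd_point F (inr (a, b)) y).
    by rewrite -[bd_point _ _ _]/(piK (bd_elt F _ y)) WE; split=> //; rewrite bd_elt_coord//=; lra.
  apply: open_nbhs_nbhs; split=> //; apply: bd_quotient_open => p; rewrite WE => /nW.
  by apply: filterS => p'; rewrite WE.
apply: (@contraction_potential R K z unit W (fun=> edge_path R F (inr (a, b))) (fun=> tt) Y 0
  (bd_point F (inr (a, b)) 0) (v a + integral z (word_path R F a [:: b]) (1/2) 1) primitive) => //.
- apply: bd_continuous_at => [p|p e]; rewrite WE.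
    by move/nW; apply: filterS => p'; rewrite WE.
  move=> Wp e00; have [h1 h2] := Wp; rewrite YE /pY h1 eqxx h2.
  apply: filterS2 (nW p Wp) (@bd_pre_near _ _ _ _ p (fun p' => `|bd_coord p' - bd_coord p| < e) _).
    by move=> p' [h1' h2']; rewrite YE /pY h1' eqxx h2'.
  by apply: filterS (near_dist (bd_coord p) e00) => t ht p' _ ->.
- by move=> x _; exact: filterE.
- move=> x; rewrite -(reprK x) WE YE => Wp.
  by rewrite {1}(Wpt _ Wp); case: Wp => h1 h2; rewrite /pY h1 eqxx h2.
- move=> x; rewrite -(reprK x) WE YE => Wp; rewrite primitiveE /pre_primitive.
  case: (Wp) => h1 h2; rewrite /pY h1 eqxx h2 -addrA; congr (_ + _).
  rewrite -(integralD _ _ (1/2) 1); congr (_ + _).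
  apply: integral_eq => t t01; rewrite word_edge_middle.
    by congr (edge_path _ _ _ _); lra.
  by apply/andP; split; [apply: segment_ge|apply: segment_le] => //; lra.
Unshelve. all: by end_near. Qed.

(* The path from e_b into e_a, parametrised so that it agrees with edge_path on e_a. *)
Definition reentry_path b a : continuousType R K :=
  mkC (continuousT_comp (fun y => cvgD (cvg_cst (1 : R)) cvg_id) (@cts_fun _ _ (word_path R F b [:: a]))).

(** [W] is e_a with the adjacent half of every e_ad and e_ca, without their midpoints: this keeps it
    a tree even though e_aa closes up to a loop. Its rays start at the midpoint of e_a, and [Y]
    extends the coordinate of e_a past both ends, by [1 + bd_coord p] in e_ad and by [bd_coord p] in
    e_ca. *)
Lemma star_neighbourhood a : exists W : set K,
  [/\ forall y, eps <= y <= 1 - eps -> nbhs (bd_point F (inl a) y) W,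
      forall b y, - eps <= y < 0 -> nbhs (bd_point F (inr (a, b)) y) W,
      forall b y, 0 < y <= eps -> nbhs (bd_point F (inr (b, a)) y) W &
  forall g : continuousType R K, (forall s, W (g s)) ->
    forall c d, integral z g c d = primitive (g d) - primitive (g c)].
Proof.
have E0 := e0; have E1 := e1.
pose pY (p : pre) : R := match projT1 p with
  | inl c => if c == a then bd_coord p else 1
  | inr (c, d) => if (d == a) && (0 < bd_coord p) then bd_coord p
      else if (c == a) && (bd_coord p < 0) then 1 + bd_coord p else 1
  end.
(* [Some (true, d)] is the branch leaving through e_ad and [Some (false, c)] the one coming from
   e_ca; the glued ends belong to the branch [None] of e_a, so that the index descends to the
   quotient. *)
pose pb (p : pre) : option (bool * A) := match projT1 p with
  | inl c => None
  | inr (c, d) => if (c == a) && (- eps < bd_coord p < 0) then Some (true, d)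
      else if (d == a) && (0 < bd_coord p < eps) then Some (false, c) else None
  end.
pose pW (p : pre) : Prop := match projT1 p with
  | inl c => c = a
  | inr (c, d) => (c = a /\ bd_coord p < 0) \/ (d = a /\ 0 < bd_coord p)
  end.
have n0 : (0 < - eps) = false by apply/negbTE; rewrite -leNgt; lra.
have n1 : (eps < 0) = false by apply/negbTE; rewrite -leNgt; lra.
have n2 : (- eps < 0) = true by lra.
have gY p p' : bd_glue p p' -> pY p = pY p'.
  move=> [c [d [[h1 h2 h3 h4]|[h1 h2 h3 h4]]]]; rewrite /pY h1 h2 h3 h4.
    by rewrite n0 n2 andbF andbT; case: eqP => // _; case: eqP.
  by rewrite E0 n1 andbF andbT; case: eqP => // _; case: eqP.
have gb p p' : bd_glue p p' -> pb p = pb p'.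
  move=> [c [d [[h1 h2 h3 h4]|[h1 h2 h3 h4]]]]; rewrite /pb h1 h3 h4.
    by rewrite ltxx n0 /= !andbF.
  by rewrite ltxx n1 /= !andbF.
have gW p p' : bd_glue p p' -> pW p = pW p'.
  move=> [c [d [[h1 h2 h3 h4]|[h1 h2 h3 h4]]]]; rewrite /pW h1 h3 h4.
    by apply/propext; split=> [->|[[]|[]]]; rewrite ?n0//; left.
  by apply/propext; split=> [->|[[]|[]]]; rewrite ?n1//; right.
pose W (x : K) := pW (repr x); pose Y (x : K) := pY (repr x); pose b (x : K) := pb (repr x).
have WE p : W (piK p) = pW p by exact: bd_invariant gW p.
have YE p : Y (piK p) = pY p by exact: bd_invariant gY p.
have bE p : b (piK p) = pb p by exact: bd_invariant gb p.
have nWY p (e : R) : pW p -> 0 < e -> \forall p' \near p, pW p' /\ `|pY p' - pY p| < e.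
  rewrite /pW /pY; case ep: (projT1 p) => [c|[c d]].
    move=> ca e00; apply: bd_pre_near; apply: filterS (near_dist (bd_coord p) e00) => t ht p' ep' et.
    by rewrite ep' ep /= ca eqxx et.
  case=> -[ca hx] e00; subst; apply: bd_pre_near.
    apply: filterS2 (lt_nbhsl hx) (near_dist (bd_coord p) e00) => t ht1 ht2 p' ep' et.
    rewrite ep' ep et eqxx ht1 hx /= ![0 < _]ltNge !(ltW ht1) !(ltW hx) !andbF /=.
    split; first by left.
    by have -> : 1 + t - (1 + bd_coord p) = t - bd_coord p by ring.
  apply: filterS2 (lt_nbhsr hx) (near_dist (bd_coord p) e00) => t ht1 ht2 p' ep' et.
  by rewrite ep' ep et eqxx ht1 hx; split=> //; right.
have nb p i : pb p = Some i -> \forall p' \near p, pb p' = Some i.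
  rewrite /pb; case ep: (projT1 p) => [c|[c d]] //.
  case: ifP => [/andP[/eqP ca /andP[h1 h2]] <-|_].
    apply: bd_pre_near; near=> t => p' ep' et; rewrite ep' ep et ca eqxx /= ifT//.
    by apply/andP; split; near: t; [exact: lt_nbhsr|exact: lt_nbhsl].
  case: ifP => // /andP[/eqP da /andP[h1 h2]] <-.
  apply: bd_pre_near; near=> t => p' ep' et; rewrite ep' ep et da eqxx.
  have t0 : 0 < t by near: t; exact: lt_nbhsr.
  have t1 : t < eps by near: t; exact: lt_nbhsl.
  by rewrite t0 t1 [t < 0]ltNge (ltW t0) !andbF.
have bopen x i : b x = Some i -> \forall x' \near x, b x' = Some i.
  move=> bx; apply: open_nbhs_nbhs; split=> //; apply: bd_quotient_open => p; rewrite /= bE => /nb.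
  by apply: filterS => p'; rewrite bE.
have cases p : pW p -> [\/ exists y, [/\ eps <= y <= 1 - eps, piK p = bd_point F (inl a) y,
      pb p = None & pY p = y],
    exists d, [/\ projT1 p = inr (a, d), - eps < bd_coord p < 0, pb p = Some (true, d) & pY p = 1 + bd_coord p] |
    exists c, [/\ projT1 p = inr (c, a), 0 < bd_coord p < eps, pb p = Some (false, c) & pY p = bd_coord p]].
  have itv := bd_coord_itv p; have pt := bd_point_coord p.
  rewrite /pW /pb /pY; move: itv pt; case ep: (projT1 p) => [c|[c d]] /= itv pt.
    by move=> ca; constructor 1; exists (bd_coord p); rewrite -ca eqxx pt.
  case=> -[ca hx]; rewrite ca in ep pt *.
    have [h|h] := ltP (- eps) (bd_coord p).
      by constructor 2; exists d; rewrite eqxx hx [0 < _]ltNge (ltW hx) andbF.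
    have ex : bd_coord p = - eps by lra.
    constructor 1; exists (1 - eps); rewrite -pt ex (bd_point_out _ _ a d) n0 n2 !andbF eqxx /=.
    by split=> //; lra.
  have [h|h] := ltP (bd_coord p) eps.
    by constructor 3; exists c; rewrite eqxx hx [_ < 0]ltNge (ltW hx) !andbF.
  have ex : bd_coord p = eps by lra.
  constructor 1; exists eps; rewrite -pt ex (bd_point_in _ _ a c) n1 E0 !andbF eqxx /=.
  by split=> //; lra.
pose beta (i : option (bool * A)) : continuousType R K := match i with
  | None => edge_path R F (inl a)
  | Some (true, d) => word_path R F a [:: d]
  | Some (false, c) => reentry_path c a
  end.
have beta_mid i y : eps <= y <= 1 - eps -> beta i y = bd_point F (inl a) y.
  move=> /andP[y1 y2]; case: i => [[[] d]|] //; first exact: word_edge_initial.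
  rewrite -[LHS]/(word_path R F d [:: a] (1 + y)) word_edge_final; last lra.
  by congr (bd_point _ _ _); ring.
have oW : open W.
  apply: bd_quotient_open => p; rewrite WE => /nWY - /(_ _ ltr01).
  by apply: filterS => p' []; rewrite WE.
have Wpt e y : lo e <= y <= hi e -> pW (bd_elt F e y) -> nbhs (bd_point F e y) W.
  by move=> ye h; apply: open_nbhs_nbhs; split=> //; rewrite -[bd_point _ _ _]/(piK (bd_elt F e y)) WE.
exists W; split.
- by move=> y ye; apply: Wpt.
- move=> d y /andP[y1 y2]; have yl : lo (inr (a, d)) <= y <= hi (inr (a, d)) by rewrite /=; lra.
  by apply: Wpt => //; left; rewrite bd_elt_coord.
- move=> d y /andP[y1 y2]; have yl : lo (inr (d, a)) <= y <= hi (inr (d, a)) by rewrite /=; lra.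
  by apply: Wpt => //; right; rewrite bd_elt_coord.
apply: (@contraction_potential R K z (option (bool * A)) W beta b Y (1/2)
  (bd_point F (inl a) (1/2)) (v a) primitive).
- apply: bd_continuous_at => [p|p e]; rewrite WE => Wp.
    by have := nWY p 1 Wp ltr01; apply: filterS => p' []; rewrite WE.
  by move=> e00; have := nWY p e Wp e00; apply: filterS => p' []; rewrite !YE.
- move=> x Wx; case bx : (b x) => [i|].
    by have := bopen x i bx; apply: filterS => x' -> .
  apply: filterE => x' t t01; rewrite !beta_mid //.
    move: Wx bx; rewrite -(reprK x) WE YE bE => /cases[[y [y1 _ _ ->]] _|[d [_ _ -> //]]|[d [_ _ -> //]]].
    move/andP: y1 => [y1 y2]; apply/andP; split; first by apply: segment_ge => //; lra.
    by apply: segment_le => //; lra.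
  move: Wx bx; rewrite -(reprK x) WE YE bE => /cases[[y [y1 _ _ ->]] _|[d [_ _ -> //]]|[d [_ _ -> //]]].
  move/andP: y1 => [y1 y2]; apply/andP; split; first by apply: segment_ge => //; lra.
  by apply: segment_le => //; lra.
- by move=> i; apply: beta_mid; lra.
- move=> x; rewrite -(reprK x) WE YE bE => /cases[[y [y1 e -> ->]]|[d [e /andP[y1 y2] -> ->]]|[d [e /andP[y1 y2] -> ->]]].
  + by rewrite e.
  + rewrite -[RHS]/(word_path R F a [:: d] _) word_edge_middle; last lra.
    by rewrite -bd_point_coord e; congr (bd_point _ _ _); ring.
  + rewrite -[RHS]/(word_path R F d [:: a] (1 + bd_coord (repr x))) word_edge_middle; last lra.
    by rewrite -bd_point_coord e; congr (bd_point _ _ _); ring.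
- move=> x; rewrite -(reprK x) WE YE bE => /cases[[y [y1 e -> ->]]|[d [e y1 -> ->]]|[d [e y1 -> ->]]].
  + by rewrite e primitive_point.
  + by rewrite primitiveE /pre_primitive e.
  + rewrite primitiveE /pre_primitive e.
    have -> : integral z (beta (Some (false, d))) (1/2) (bd_coord (repr x)) =
        integral z (word_path R F d [:: a]) (3/2) (1 + bd_coord (repr x)).
      by apply: integral_eq => t t01; rewrite -[LHS]/(word_path R F d [:: a] (1 + _)); congr (word_path _ _ _ _ _); lra.
    have := hv d a; rewrite -(integralD z (word_path R F d [:: a]) (1/2) (3/2) (1 + _)); lia.
Unshelve. all: by end_near. Qed.

Lemma H1_class_edge_coboundary : H1_class z = 0.
Proof.
have E0 := e0; have E1 := e1.
apply: (path_potential_coboundary (U := primitive)); apply: local_potential_path => x.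
have [[a|[a b]] [y [/= ye ->]]] := bd_point_surj x.
  by have [W [h _ _ hW]] := star_neighbourhood a; exists W; split=> //; exact: h.
have [y0|y0|y0] := ltrgtP y 0.
- have [W [_ h _ hW]] := star_neighbourhood a; exists W; split=> //; apply: h; lra.
- have [W [_ _ h hW]] := star_neighbourhood b; exists W; split=> //; apply: h; lra.
- have [W [h hW]] := edge_neighbourhood a b; exists W; split=> //; apply: h; lra.
Qed.

End BargeDiamondInjective.

Lemma coboundary_map1 (S : semisimplicial) (f : simp S 0 -> int) (x : simp S 1) :
  coboundary_map f x = f (face ord0 x) - f (face ord_max x).
Proof.
rewrite /coboundary_map !big_ord_recr big_ord0 /= add0r expr0 expr1 mul1r mulN1r.
by congr (f (face _ x) - _); exact: val_inj.
Qed.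

Section IntegralFunctoriality.
Variables (R : realType) (X Y : topologicalType).

Lemma integral_pull (f : continuousType X Y) (z : cocycle (singular R Y)) (g : continuousType R X) x y :
  integral (pull_cocycle (singular_map R f) z) g x y =
  integral z (mkC (continuousT_comp (@cts_fun _ _ g) (@cts_fun _ _ f))) x y.
Proof. by rewrite /integral /integral2 /=; congr (cocycle_val z _); exact/continuousEP. Qed.

Lemma integralB (z w : cocycle (singular R X)) g x y :
  integral (z - w) g x y = integral z g x y - integral w g x y.
Proof. by []. Qed.

Lemma integral_class (z w : cocycle (singular R X)) : H1_class z = H1_class w ->
  exists u : X -> int, forall g x y, integral z g x y - integral w g x y = u (g y) - u (g x).
Proof.
move=> /H1_classE[f e]; pose pt (x : X) : simp (singular R X) 0 := mkC (@cst_continuous _ _ x).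
exists (f \o pt) => g x y.
rewrite -integralB -[LHS]/((val z - val w) (affine_simplex (of_path g) (pts1 x y) (pts1 0 0))) e.
rewrite coboundary_map1.
have h (v w0 : 'I_1 -> R) : affine_simplex (of_path g) v w0 = pt (g (v ord0)).
  apply/continuousEP => -[t tP] /=; congr (g _).
  have /set_mem[_] := tP; rewrite /bary !big_ord_recr !big_ord0 /= !add0r => ->.
  by rewrite mul1r; congr v; exact: val_inj.
rewrite !face_affine !h /pts1 /=.
by congr (f (pt (g _)) - f (pt (g _))).
Qed.

End IntegralFunctoriality.

(** * Edge integrals and the maps induced by substitutions *)

Section EdgeRelation.
Variables (R : realType) (A : finType) (k : nat) (F : 'I_k.+1 -> substitution A).
Local Notation eps := (bd_eps R F).
Local Notation K := (bd_complex R F).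
Local Notation piK := (\pi_K : bd_pre R F -> K).

Let e0 : 0 < eps. Proof. exact: bd_eps_gt0. Qed.
Let e1 : eps <= 2^-1. Proof. exact: bd_eps_le_half. Qed.

Lemma bd_path_rcons_initial a w b u : u <= (size w).+1%:R - eps ->
  bd_path F a (rcons w b) u = bd_path F a w u.
Proof.
elim: w a u => [|c w IH] a u /=; first by move=> ->.
move=> h; rewrite IH//.
by move: h; rewrite [in X in X -> _]mulrS; lra.
Qed.

Lemma bd_path_rcons_middle a w b u : (size w).+1%:R - eps <= u <= (size w).+1%:R + eps ->
  bd_path F a (rcons w b) u = bd_point F (inr (last a w, b)) (u - (size w).+1%:R).
Proof.
have E0 := e0; have E1 := e1.
elim: w a u => [|c w IH] a u; first exact: bd_path_middle.
rewrite [rcons _ _]/= [size _]/= [in X in X -> _]mulrS => h.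
have n1 : 1 <= (size w).+1%:R :> R by rewrite ler1n.
rewrite bd_path_shift; last lra.
by rewrite IH /=; [congr (bd_point _ _ _); rewrite [in RHS]mulrS; ring|lra].
Qed.

Lemma bd_path_rcons_final a w b u : (size w).+1%:R + eps <= u ->
  bd_path F a (rcons w b) u = bd_point F (inl b) (u - (size w).+1%:R).
Proof.
have E0 := e0; have E1 := e1.
elim: w a u => [|c w IH] a u; first exact: bd_path_shift.
rewrite [rcons _ _]/= [size _]/= [in X in X -> _]mulrS => h.
have n1 : 1 <= (size w).+1%:R :> R by rewrite ler1n.
rewrite bd_path_shift; last lra.
by rewrite IH /=; [congr (bd_point _ _ _); rewrite [in RHS]mulrS; ring|lra].
Qed.

Definition edge_integral (z : cocycle (singular R K)) a b : int :=
  integral z (word_path R F a [:: b]) (1/2) (3/2).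

(** The path is cut at the midpoints of the edges of its letters; each piece is, up to a shift, the
    path of a two-letter word from 1/2 to 3/2. *)
Lemma integral_word_path z a w :
  integral z (word_path R F a w) (1/2) ((size w)%:R + 1/2) = psum (edge_integral z) a w.
Proof.
have E0 := e0; have E1 := e1.
elim: w a => [|b w IH] a /=; first by rewrite add0r integral_refl.
rewrite -(integralD _ _ _ (3/2)) -IH; congr (_ + _).
  apply: integral_eq => t t01; have h : 1/2 + t * (3/2 - 1/2) <= 3/2 :> R by apply: segment_le => //; lra.
  move: (_ + _ : R) h => u h; rewrite -[LHS]/(bd_path F a (b :: w) u) -[RHS]/(bd_path F a [:: b] u).
  have [u1|u1] := leP u (1 + eps).
    by rewrite /= u1.
  by rewrite !bd_path_shift ?(ltW u1)// bd_path_initial//; lra.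
apply: integral_eq => t t01; have h : 3/2 <= 3/2 + t * ((size w).+1%:R + 1/2 - 3/2) :> R.
  by apply: segment_ge => //; rewrite mulrS; have := ler0n R (size w); lra.
rewrite -[LHS]/(bd_path F a (b :: w) _) bd_path_shift; last by move: h; lra.
by rewrite -[RHS]/(bd_path F b w _); congr (bd_path _ _ _ _); rewrite mulrS; field.
Qed.

Lemma bd_map_inl (phi : 'I_k.+1) a y : eps <= y <= 1 - eps ->
  bd_map (F phi) (bd_point F (inl a) y) =
  bd_path F (head a (F phi a)) (behead (F phi a))
    (eps + (y - eps) * (((size (F phi a))%:R - 2 * eps) / (1 - 2 * eps))).
Proof.
move=> ye; rewrite -[bd_point _ _ _]/(piK (bd_elt F (inl a) y)) bd_mapE /bd_pre_map.
by rewrite bd_elt_coord.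
Qed.

Lemma bd_map_inr (phi : 'I_k.+1) a b y : - eps <= y <= eps ->
  bd_map (F phi) (bd_point F (inr (a, b)) y) =
  bd_point F (inr (last a (F phi a), head b (F phi b))) y.
Proof.
move=> ye; rewrite -[bd_point _ _ _]/(piK (bd_elt F (inr (a, b)) y)) bd_mapE /bd_pre_map.
by rewrite bd_elt_coord.
Qed.

Definition bd_scale (phi : 'I_k.+1) a : R := ((size (F phi a))%:R - 2 * eps) / (1 - 2 * eps).

(* When eps = 1/2 the scale is 0 by the convention x / 0 = 0, but then every image of
   a letter has length one and both sides vanish. *)
Lemma bd_scaleE phi a : (1 - 2 * eps) * bd_scale phi a = (size (F phi a))%:R - 2 * eps.
Proof.
have E1 := e1.
have [e2|ne2] := eqVneq (1 - 2 * eps) 0; last by rewrite /bd_scale; field.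
have le1 := bd_eps_le R F phi a.
have n0 : (0 < size (F phi a))%N by rewrite size_subst_gt0.
have n1 : (size (F phi a))%:R <= 1 :> R.
  have eh : eps = 2^-1 by lra.
  by move: le1; rewrite eh lef_pV2 ?posrE ?mulr_gt0 ?ltr0n//; lra.
have n2 : 1 <= (size (F phi a))%:R :> R by rewrite ler1n.
by rewrite e2 mul0r; lra.
Qed.

(* The image of the path from the midpoint of e_a to that of e_b runs between the
   images M a, M b of the midpoints; v accounts for the difference with the midpoints
   of the first letters of phi(a) and phi(b). *)
Lemma edge_integral_pull (phi : 'I_k.+1) z : exists v, forall a b,
  edge_integral (pull_cocycle (singular_map R (bd_map (F phi))) z) a b =
  pull_edge (F phi) (edge_integral z) a b + (v b - v a).
Proof.
have E0 := e0; have E1 := e1.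
pose hd a := head a (F phi a); pose tl a := behead (F phi a).
pose M a := eps + (1/2 - eps) * bd_scale phi a.
pose v a := integral z (word_path R F (hd a) (tl a)) (1/2) (M a).
exists v => a b; set n := (size (tl a)).+1.
have ne : size (F phi a) = n by rewrite /n /tl size_behead prednK// size_subst_gt0.
have eM : M a + (1/2 - eps) * bd_scale phi a = n%:R - eps.
  by have := bd_scaleE phi a; rewrite /M ne; lra.
rewrite [LHS]/edge_integral integral_pull; set g := mkC _.
have gE y : g y = bd_map (F phi) (bd_path F a [:: b] y) by [].
have n1 : 1 <= n%:R :> R by rewrite ler1n.
(* The path is cut where it enters and leaves e_ab. The pieces in e_a and e_b are stretched by
   [bd_scale], the one in e_ab is moved isometrically, and each is compared with the path of phi(a)
   followed by the first letter of phi(b). *)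
have i1 : integral z g (1/2) (1 - eps) = integral z (word_path R F (hd a) (tl a)) (M a) (n%:R - eps).
  apply: integral_eq => t t01; rewrite gE bd_path_initial; last by apply: segment_le => //; lra.
  rewrite bd_map_inl; last by apply/andP; split; [apply: segment_ge|apply: segment_le] => //; lra.
  rewrite -[RHS]/(bd_path F (hd a) (tl a) _) -eM /M; congr (bd_path _ _ _ _).
  by rewrite -/(bd_scale phi a); field.
have i2 : integral z g (1 - eps) (1 + eps) =
    integral z (word_path R F (hd a) (rcons (tl a) (hd b))) (n%:R - eps) (n%:R + eps).
  apply: integral_eq => t t01.
  rewrite gE bd_path_middle; last by apply/andP; split; [apply: segment_ge|apply: segment_le] => //; lra.
  rewrite bd_map_inr; last first.
    by rewrite lerBrDr lerBlDr; apply/andP; split; [apply: segment_ge|apply: segment_le] => //; lra.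
  rewrite -[RHS]/(bd_path F (hd a) (rcons (tl a) (hd b)) _) bd_path_rcons_middle -/n; last first.
    by apply/andP; split; [apply: segment_ge|apply: segment_le] => //; lra.
  have -> : last a (F phi a) = last (hd a) (tl a).
    by rewrite /hd /tl; case: (F phi a) (size_subst_gt0 (F phi) a).
  by congr (bd_point _ _ _); ring.
have i3 : integral z g (1 + eps) (3/2) = integral z (word_path R F (hd b) (tl b)) eps (M b).
  apply: integral_eq => t t01; rewrite gE bd_path_shift; last by apply: segment_ge => //; lra.
  rewrite [bd_path _ _ _ _]/= bd_map_inl; last first.
    by rewrite lerBrDr lerBlDr; apply/andP; split; [apply: segment_ge|apply: segment_le] => //; lra.
  rewrite -[RHS]/(bd_path F (hd b) (tl b) _) /M; congr (bd_path _ _ _ _).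
  by rewrite -/(bd_scale phi b); field.
have i4 : integral z (word_path R F (hd a) (tl a)) (1/2) (n%:R - eps) =
    integral z (word_path R F (hd a) (rcons (tl a) (hd b))) (1/2) (n%:R - eps).
  apply: integral_eq => t t01; rewrite -[RHS]/(bd_path F (hd a) (rcons (tl a) (hd b)) _).
  rewrite bd_path_rcons_initial -/n //; apply: segment_le => //; lra.
have i5 : integral z (word_path R F (hd b) (tl b)) eps (1/2) =
    integral z (word_path R F (hd a) (rcons (tl a) (hd b))) (n%:R + eps) (n%:R + 1/2).
  apply: integral_eq => t t01; rewrite -[RHS]/(bd_path F (hd a) (rcons (tl a) (hd b)) _).
  rewrite bd_path_rcons_final -/n; last by apply: segment_ge => //; lra.
  rewrite -[LHS]/(bd_path F (hd b) (tl b) _) bd_path_initial; last by apply: segment_le => //; lra.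
  by congr (bd_point _ _ _); ring.
have i6 : pull_edge (F phi) (edge_integral z) a b =
    integral z (word_path R F (hd a) (rcons (tl a) (hd b))) (1/2) (n%:R + 1/2).
  by rewrite /pull_edge -/(hd a) -/(tl a) -/(hd b) -integral_word_path size_rcons.
rewrite i6 -(integralD _ g _ (1 + eps)) -(integralD _ g _ (1 - eps)) i1 i2 i3.
have := integralD z (word_path R F (hd a) (rcons (tl a) (hd b))) (1/2) (n%:R - eps) (n%:R + 1/2).
have := integralD z (word_path R F (hd a) (rcons (tl a) (hd b))) (n%:R - eps) (n%:R + eps) (n%:R + 1/2).
have := integralD z (word_path R F (hd a) (tl a)) (1/2) (M a) (n%:R - eps).
have := integralD z (word_path R F (hd b) (tl b)) eps (1/2) (M b).
rewrite -/(v a) -/(v b) -i4 -i5; lia.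
Qed.

End EdgeRelation.

(** * Comparison of the two limits *)

Section EdgeClasses.
Variables (R : realType) (A : finType) (k : nat) (F : 'I_k.+1 -> substitution A).
Local Notation K := (bd_complex R F).
Implicit Types (y : bd_H1 R F) (c : A -> A -> int).

Lemma psumB c c' x w : psum (fun a b => c a b - c' a b) x w = psum c x w - psum c' x w.
Proof. by elim: w x => [|y w IH] x //=; rewrite IH; lia. Qed.

Lemma pull_edgeB (phi : substitution A) c c' a b :
  pull_edge phi (fun a b => c a b - c' a b) a b = pull_edge phi c a b - pull_edge phi c' a b.
Proof. exact: psumB. Qed.

(** The slack v(b) - v(a) is part of the relation because the induced maps create it: they do not
    send midpoints to midpoints. *)
Definition edge_rel y c := exists z v,
  y = H1_class z /\ forall a b, c a b = edge_integral z a b + (v b - v a).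

Lemma edge_relB y y' c c' : edge_rel y c -> edge_rel y' c' ->
  edge_rel (y - y') (fun a b => c a b - c' a b).
Proof.
move=> [z [v [-> h]]] [z' [v' [-> h']]]; exists (z - z'), (fun a => v a - v' a).
by rewrite H1_classB; split=> // a b; rewrite h h' /edge_integral integralB; lia.
Qed.

Lemma edge_rel_total y : exists c, edge_rel y c.
Proof.
rewrite -(H1_reprK y); set z := repr y.
by exists (edge_integral z), z, (fun=> 0); split=> // a b; rewrite subrr addr0.
Qed.

Lemma edge_rel_surj c : exists y, edge_rel y c.
Proof.
have [z hz] := edge_cocycle_exists R F c.
by exists (H1_class z), z, (fun=> 0); split=> // a b; rewrite subrr addr0 /edge_integral hz.
Qed.

Lemma edge_rel0 c : edge_rel 0 c -> exists v, forall a b, c a b = v b - v a.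
Proof.
have e0 := bd_eps_gt0 R F; have e1 := bd_eps_le_half R F.
move=> [z [v [z0 h]]].
have : H1_class z = H1_class (0 : cocycle (singular R K)).
  by rewrite -z0 -[0 in RHS](subrr (0 : cocycle (singular R K))) H1_classB subrr.
move=> /integral_class[u hu]; exists (fun a => u (bd_point F (inl a) (1/2)) + v a) => a b.
rewrite h /edge_integral; have := hu (word_path R F a [:: b]) (1/2) (3/2).
rewrite -[integral 0 _ _ _]/(0 : int) subr0 => ->.
rewrite -[word_path _ _ _ _ (1/2)]/(bd_path F a [:: b] (1/2)) bd_path_initial; last lra.
rewrite -[word_path _ _ _ _ (3/2)]/(bd_path F a [:: b] (3/2)) bd_path_shift; last lra.
have -> : 3/2 - 1 = 1/2 :> R by field.
by rewrite [bd_path _ _ _ _]/=; lia.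
Qed.

Lemma edge_rel_cob y (v : A -> int) : edge_rel y (fun a b => v b - v a) -> y = 0.
Proof.
move=> [z [v' [-> h]]]; apply: (@H1_class_edge_coboundary R A k F z (fun a => v a - v' a)) => a b.
by have := h a b; rewrite /edge_integral; lia.
Qed.

Lemma edge_rel_pull i y c : edge_rel y c -> edge_rel (bd_H1_map R F i y) (pull_edge (F i) c).
Proof.
move=> [z [v [-> h]]]; have [w hw] := edge_integral_pull i z.
exists (pull_cocycle (singular_map R (bd_map (F i))) z).
exists (fun a => v (head a (F i a)) - w a); split; first exact: H1_mapE.
move=> a b; have := pull_edgeB (F i) c (edge_integral z) a b.
have -> : (fun a b => c a b - edge_integral z a b) = (fun a b => v b - v a).
  by apply/funext => a'; apply/funext => b'; rewrite h addrC addKr.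
by rewrite pull_edge_cob hw; lia.
Qed.

End EdgeClasses.

Section Comparison.
Variables (R : realType) (A : finType) (k : nat) (F : 'I_k.+1 -> substitution A).
Variable s : nat -> 'I_k.+1.
Local Notation Adm := (Adm F s).
Local Notation H := (cech_H1 (tiling_space F R s)).
Local Notation D := (bd_system R F s).
Implicit Types (f u : biseq A -> int) (c : A -> A -> int).

(** [f] lives at level 0 and [c] at level [n], and they are compared at level [n]. *)
Definition level_rel n f c := exists2 u, loc_const (Adm n) u &
  forall T, Adm n T -> pull (Phi F s 0 n) f T = edge_fun c T + (u (bishift 1 T) - u T).

Lemma level_relB n f f' c c' : level_rel n f c -> level_rel n f' c' ->
  level_rel n (fun T => f T - f' T) (fun a b => c a b - c' a b).
Proof.
move=> [u lu h] [u' lu' h']; exists (fun T => u T - u' T); first exact: loc_constB.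
by move=> T AT; rewrite pullB h// h'// /edge_fun; lia.
Qed.

Lemma level_rel_succ n f c : level_rel n f c -> level_rel n.+1 f (pull_edge (F (s n)) c).
Proof.
move=> [u lu h]; exists (u \o subst_biseq (F (s n))).
  apply: loc_const_comp lu => S; first exact: admissible_subst.
  exact: subst_biseq_near.
move=> T AT; rewrite /= add0n pull_comp.
transitivity (pull (F (s n)) (fun S => edge_fun c S + (u (bishift 1 S) - u S)) T).
  by apply: eq_bigr => j _; apply/h/Adm_bishift/admissible_subst.
by rewrite /pull /bsum big_split /= -pull_edge_fun -pull_cob.
Qed.

Definition level_class n (x : H) (y : bd_H1 R F) := exists f c,
  [/\ loc_const (Adm 0) f, tiling_rel x f, level_rel n f c & edge_rel y c].

Lemma seq_mapS (G : zmodType) (h : nat -> {additive G -> G}) n j y :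
  seq_map h n (n + j.+1) y = h (n + j)%N (seq_map h n (n + j) y).
Proof.
by rewrite /seq_map /index_iota !addKn -addn1 iotaD foldl_cat.
Qed.

Lemma level_rel_shift n j f c : level_rel n f c -> level_rel (n + j) f (pull_edge (Phi F s n j) c).
Proof.
move=> h; elim: j => [|j IH].
  rewrite addn0; have -> // : pull_edge (Phi F s n 0) c = c.
  by apply/funext => a; apply/funext => b; exact: pull_edge_id.
rewrite addnS; have -> : pull_edge (Phi F s n j.+1) c =
    pull_edge (F (s (n + j))) (pull_edge (Phi F s n j) c).
  by apply/funext => a; apply/funext => b; exact: pull_edge_comp.
exact: level_rel_succ.
Qed.

Lemma edge_rel_shift n j y c : edge_rel y c ->
  edge_rel (seq_map (fun n => bd_H1_map R F (s n)) n (n + j) y) (pull_edge (Phi F s n j) c).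
Proof.
move=> h; elim: j => [|j IH].
  rewrite addn0 seq_map_id//; have -> // : pull_edge (Phi F s n 0) c = c.
  by apply/funext => a; apply/funext => b; exact: pull_edge_id.
rewrite seq_mapS; have -> : pull_edge (Phi F s n j.+1) c =
    pull_edge (F (s (n + j))) (pull_edge (Phi F s n j) c).
  by apply/funext => a; apply/funext => b; exact: pull_edge_comp.
exact: edge_rel_pull.
Qed.

Lemma level_class_shift n m (h : (n <= m)%N) x y : level_class n x y ->
  level_class m x (@ds_map D n m h y).
Proof.
move=> [f [c [lf xf fc yc]]]; have [j mj] : exists j, m = (n + j)%N by exists (m - n)%N; rewrite subnKC.
subst m; exists f, (pull_edge (Phi F s n j) c); split=> //; first exact: level_rel_shift.
exact: edge_rel_shift.
Qed.

Lemma level_classB n x x' y y' : level_class n x y -> level_class n x' y' ->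
  level_class n (x - x') (y - y').
Proof.
move=> [f [c [lf xf fc yc]]] [f' [c' [lf' xf' fc' yc']]].
exists (fun T => f T - f' T), (fun a b => c a b - c' a b).
by split; [exact: loc_constB|exact: tiling_relB|exact: level_relB|exact: edge_relB].
Qed.

Definition limit_rel (x : H) (y : dlim D) := exists n (yn : bd_H1 R F),
  level_class n x yn /\ y = @dlim_in D n yn.

Lemma limit_relB x x' y y' : limit_rel x y -> limit_rel x' y' -> limit_rel (x - x') (y - y').
Proof.
move=> [n [z [h ->]]] [n' [z' [h' ->]]].
have l := leq_maxl n n'; have r := leq_maxr n n'.
exists (maxn n n'), (@ds_map D n (maxn n n') l z - @ds_map D n' (maxn n n') r z'); split.
  by apply: level_classB; exact: level_class_shift.
rewrite -(dlim_in_map (D := D) l z) -(dlim_in_map (D := D) r z').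
by rewrite -dlim_inD -dlim_inN.
Qed.

Hypothesis prim : primitive_system F s.
Hypothesis recog : recognisable F R s.
Hypothesis corr : self_correcting F s.

Lemma limit_rel_total x : exists y, limit_rel x y.
Proof.
have [f lf xf] := tiling_rel_total x; have [n [c [u [lu h]]]] := eventually_edge prim lf.
have [y yc] := edge_rel_surj R F c.
by exists (@dlim_in D n y), n, y; split=> //; exists f, c; split=> //; exists u.
Qed.

Lemma limit_rel_surj y : exists x, limit_rel x y.
Proof.
have [n [yn ->]] := dlim_elim y; have [c yc] := edge_rel_total yn.
have lc : loc_const (Adm n) (edge_fun c).
  move=> S _; apply: filterS2 (coord_near S 0) (coord_near S 1) => T e0 e1 _.
  by rewrite /edge_fun e0 e1.
have [f lf hf] := pull_Phi_surj (recognisable_biseq recog) lc.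
have [x xf] := tiling_rel_surj R lf; exists x, n, yn; split=> //.
exists f, c; split=> //; exists (fun=> 0); first exact: loc_const_cst.
by move=> T AT; rewrite subrr addr0; exact: hf.
Qed.

(** At some level [m] the singular class vanishes and [c] is an increment of [v], so the pullback of
    [f] is the coboundary of [v (T 0) + u T]. Recognisability brings this down to level 0. *)
Lemma limit_rel_injl x : limit_rel x 0 -> x = 0.
Proof.
move=> [n [y [hy]]]; rewrite -[0](dlim_in0 (D := D) 0%N) => /esym/dlim_inE[m [h [h0]]].
rewrite raddf0 => e; have := level_class_shift h hy; rewrite e.
move=> [f [c [lf xf [u lu hu] /edge_rel0[v cv]]]].
have lw : loc_const (Adm m) (fun T => v (T 0) + u T).
  by apply: loc_constD lu; exact: loc_const_coord.
have [|w lw' hw] := pull_Phi_inj (recognisable_biseq recog) lf lw.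
  by move=> T AT; rewrite hu// /edge_fun cv /bishift add0r; lia.
exact: tiling_rel_inj lw' hw xf.
Qed.

(** Here [f] is the coboundary of [w], so on admissible sequences [c] is the coboundary of [w]
    composed with [Phi F s 0 n], minus [u]. Self-correction makes it an increment on all pairs [j]
    levels further on, where the class therefore vanishes. *)
Lemma limit_rel_injr y : limit_rel 0 y -> y = 0.
Proof.
move=> [n [yn [[f [c [lf /tiling_rel0[w lw hw] [u lu hu] yc]]] ->]]].
pose u' T := w (subst_biseq (Phi F s 0 n) T) - u T.
have lu' : loc_const (Adm n) u'.
  apply: loc_constB lu; apply: (loc_const_comp _ _ lw) => S; last exact: subst_biseq_near.
  exact: (@Adm_Phi _ _ F s 0 n).
have [|j [v hv]] := edge_cob_eventually prim corr (c := c) lu'.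
  move=> T AT; have := hu T AT; rewrite /u'.
  have -> : pull (Phi F s 0 n) f T = pull (Phi F s 0 n) (fun S => w (bishift 1 S) - w S) T.
    apply: eq_bigr => i _; apply/hw.
    have AS : Adm 0 (bishift i%:Z (subst_biseq (Phi F s 0 n) T)).
      by apply: Adm_bishift; exact: (@Adm_Phi _ _ F s 0 n).
    exact: AS.
  by rewrite pull_cob; lia.
have := edge_rel_shift n j yc.
have -> : pull_edge (Phi F s n j) c = (fun a b => v b - v a).
  by apply/funext => a; apply/funext => b.
move=> /edge_rel_cob e.
rewrite -(dlim_in_map (D := D) (leq_addr j n : ds_le (d := D) n (n + j)%N)).
rewrite -[ds_map _ _]/(seq_map (fun n => bd_H1_map R F (s n)) n (n + j) yn) e.
exact: dlim_in0.
Qed.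

End Comparison.

(** Two images of one element differ by an image of 0, hence coincide, and symmetrically for
    preimages: such a relation is the graph of an isomorphism. *)
Lemma additive_relation_iso (G H : zmodType) (r : G -> H -> Prop) :
  (forall x x' y y', r x y -> r x' y' -> r (x - x') (y - y')) ->
  (forall x, exists y, r x y) -> (forall y, exists x, r x y) ->
  (forall x, r x 0 -> x = 0) -> (forall y, r 0 y -> y = 0) ->
  exists f : {additive G -> H}, bijective f.
Proof.
move=> rB /choice[f hf] /choice[g hg] r0l r0r.
have fE x y : r x y -> f x = y.
  by move=> xy; apply/eqP; rewrite -subr_eq0; apply/eqP/r0r; rewrite -(subrr x); exact: rB.
have fB : zmod_morphism f by move=> x y; apply: fE; exact: rB.
exists (HB.pack_for {additive G -> H} f (GRing.isZmodMorphism.Build _ _ f fB)).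
exists g => [x|y]; last exact: fE.
by apply/eqP; rewrite -subr_eq0; apply/eqP/r0l; rewrite -(subrr (f x)); exact: rB.
Qed.

Theorem corollary3p24 (R : realType) (A : finType) (k : nat)
    (F : 'I_k.+1 -> substitution A) (s : nat -> 'I_k.+1) :
  primitive_system F s -> recognisable F R s -> self_correcting F s ->
  exists f : {additive cech_H1 (tiling_space F R s) -> dlim (bd_system R F s)},
    bijective f.
Proof.
move=> prim recog corr; apply: (@additive_relation_iso _ _ (@limit_rel R A k F s)).
- exact: limit_relB.
- exact: limit_rel_total.
- exact: limit_rel_surj.
- exact: limit_rel_injl.
- exact: limit_rel_injr.
Qed.
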